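(* Suppose $M=\Omega/\Gamma$ is a properly convex $n$-manifold such that every end of $M$ is a generalized cusp. Let $d_\Omega$ be the Hilbert metric on $\Omega$. If $[A]\in\Gamma$ and $\inf\{d_\Omega(x,[A]x)\mid x\in\Omega\}=0$, then $[A]$ is the holonomy of an element of $\pi_1C$ for some generalized cusp $C\subset M$, and $[A]$ is conjugate in $\mathrm{PGL}(n+1,\mathbb R)$ to a parabolic in $\mathrm{PO}(n,1)$.
   Context: A subset $\Omega\subset\mathbb{RP}^n$ is properly convex if its intersection with every projective line is connected and omits at least two points; $\partial\Omega=\Omega\setminus\operatorname{int}\Omega$. A properly convex manifold is $\Omega/\Gamma$ with $\Omega$ properly convex and $\Gamma\subset\mathrm{PGL}(n+1,\mathbb R)$ discrete, preserving $\Omega$ and acting freely; for $M=\Omega/\Gamma$ above, $\Omega$ is open so that its Hilbert metric is defined. Hilbert metric: if distinct $p,q\in\Omega$ lie on a projective segment with endpoints in the frontier of $\Omega$ and interior in $\Omega$, affinely parametrized by $[a,b]$, with $p,q$ at parameters $x,y$, then $d_\Omega(p,q)=\frac12\left|\log\frac{|b-x||y-a|}{|b-y||x-a|}\right|$. A generalized cusp is a properly convex manifold $C=\Omega'/\Gamma'$ with $\Gamma'$ virtually abelian, $\partial C=\partial\Omega'/\Gamma'$ compact, connected and strictly convex ($\partial\Omega'$ contains no line segment), and $C$ diffeomorphic to $\partial C\times[0,\infty)$. ''Every end of $M$ is a generalized cusp'' means each end of $M$ has a neighborhood $C\subset M$ which is a generalized cusp. A parabolic in $\mathrm{PO}(n,1)\cong\mathrm{Isom}(\mathbb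 H^n)$ is a parabolic isometry of $\mathbb H^n$.
   Formalization: The element [A] is assumed to be nontrivial: the identity of Γ has displacement infimum 0 but is not conjugate to a parabolic, so the statement fails for it as written. *)

(* Defs.v *)
From HB Require Import structures.
From mathcomp Require Import all_boot all_order all_algebra.
From mathcomp Require Import generic_quotient.
From mathcomp Require Import all_classical all_reals all_analysis.

Set Implicit Arguments.
Unset Strict Implicit.
Unset Printing Implicit Defensive.

Import Order.TTheory GRing.Theory Num.Theory.
Import numFieldNormedType.Exports.

Local Open Scope classical_set_scope.
Local Open Scope ring_scope.
Local Open Scope quotient_scope.

Section Proportionality.
Context {R : realType} {V : normedModType R} (S : set V).

Definition proportional (u v : S) : bool :=
  `[< exists2 c : R, c != 0 & val v = c *: val u >].

Lemma proportional_refl : reflexive proportional.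
Proof. by move=> u; apply/asboolP; exists 1; rewrite ?oner_neq0 ?scale1r. Qed.

Lemma proportional_sym : symmetric proportional.
Proof.
have H (u v : S) : proportional u v -> proportional v u.
  move=> /asboolP[c c0 E]; apply/asboolP; exists c^-1; first by rewrite invr_eq0.
  by rewrite E scalerA mulVf// scale1r.
by move=> u v; apply/idP/idP; apply: H.
Qed.

Lemma proportional_trans : transitive proportional.
Proof.
move=> v u w /asboolP[c c0 E] /asboolP[d d0 F]; apply/asboolP.
by exists (d * c); rewrite ?mulf_neq0// F E scalerA.
Qed.

Canonical proportional_equiv :=
  EquivRel proportional proportional_refl proportional_sym proportional_trans.

Definition projectivization : Type :=
  quotient_topology {eq_quot proportional}.

HB.instance Definition _ := Topological.on projectivization.
HB.instance Definition _ := Quotient.on projectivization.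

Definition pclass (x0 : S) (v : V) : projectivization :=
  \pi_projectivization (insubd x0 v).

Lemma pclassE (x0 x1 : S) (u v : V) : u \in S -> v \in S ->
  (pclass x0 u = pclass x1 v) <-> exists2 c : R, c != 0 & v = c *: u.
Proof.
move=> uS vS; split.
  move/eqmodP => /= /asboolP; rewrite !insubdK//.
move=> cuv; apply/eqmodP => /=; apply/asboolP; rewrite !insubdK//.
Qed.

End Proportionality.

Section ProjectiveSpace.
Context (R : realType).

Definition nzvec (n : nat) : set 'cV[R]_n.+1 := [set v | v != 0].
Definition invmat (m : nat) : set 'M[R]_m := [set A | A \in unitmx].

(* RP n has dimension n, so PGL n.+1 acts on it. *)
Definition RP (n : nat) : Type := projectivization (@nzvec n).
HB.instance Definition _ n := Topological.on (RP n).
HB.instance Definition _ n := Quotient.on (RP n).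

Definition PGL (m : nat) : Type := projectivization (@invmat m).
HB.instance Definition _ m := Topological.on (PGL m).
HB.instance Definition _ m := Quotient.on (PGL m).

Fact nzvec1 n : (const_mx 1 : 'cV[R]_n.+1) \in @nzvec n.
Proof.
apply/mem_set/eqP => /matrixP/(_ ord0 ord0); rewrite !mxE => /eqP.
by rewrite oner_eq0.
Qed.

Fact invmat1 m : (1%:M : 'M[R]_m) \in @invmat m.
Proof. by apply/mem_set; exact: unitmx1. Qed.

(* [v] and [A]; the values at v = 0 and at singular A are arbitrary. *)
Definition pt n (v : 'cV[R]_n.+1) : RP n :=
  pclass (exist (fun u => u \in @nzvec n) _ (nzvec1 n)) v.
Definition pgl m (A : 'M[R]_m) : PGL m :=
  pclass (exist (fun B => B \in @invmat m) _ (invmat1 m)) A.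

Lemma pt_eq n (u v : 'cV[R]_n.+1) : u != 0 -> v != 0 ->
  pt u = pt v <-> exists2 c : R, c != 0 & v = c *: u.
Proof. by move=> u0 v0; apply: pclassE; apply/mem_set. Qed.

Lemma pgl_eq m (A B : 'M[R]_m) : A \in unitmx -> B \in unitmx ->
  pgl A = pgl B <-> exists2 c : R, c != 0 & B = c *: A.
Proof. by move=> u0 v0; apply: pclassE; apply/mem_set. Qed.

Definition vec_of n (p : RP n) : 'cV[R]_n.+1 := val (repr p).
Definition mat_of m (g : PGL m) : 'M[R]_m := val (repr g).

Lemma vec_of_neq0 n (p : RP n) : vec_of p != 0.
Proof. exact: (set_valP (repr p)). Qed.

Lemma mat_of_unit m (g : PGL m) : mat_of g \in unitmx.
Proof. exact: (set_valP (repr g)). Qed.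

Lemma vec_ofK n (p : RP n) : pt (vec_of p) = p.
Proof. by rewrite /pt /pclass /vec_of valKd reprK. Qed.

Lemma mat_ofK m (g : PGL m) : pgl (mat_of g) = g.
Proof. by rewrite /pgl /pclass /mat_of valKd reprK. Qed.

Lemma mat_of_pgl m (A : 'M[R]_m) : A \in unitmx ->
  exists2 c : R, c != 0 & mat_of (pgl A) = c *: A.
Proof.
by move=> uA; apply/pgl_eq => //; rewrite ?mat_ofK ?mat_of_unit.
Qed.

Lemma vec_of_pt n (v : 'cV[R]_n.+1) : v != 0 ->
  exists2 c : R, c != 0 & vec_of (pt v) = c *: v.
Proof.
by move=> v0; apply/pt_eq => //; rewrite ?vec_ofK ?vec_of_neq0.
Qed.

Definition pgl_mul m (g h : PGL m) : PGL m := pgl (mat_of g *m mat_of h).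
Definition pgl_inv m (g : PGL m) : PGL m := pgl (invmx (mat_of g)).

Lemma pgl_mulE m (A B : 'M[R]_m) : A \in unitmx -> B \in unitmx ->
  pgl_mul (pgl A) (pgl B) = pgl (A *m B).
Proof.
move=> uA uB; apply/esym/pgl_eq; rewrite ?unitmx_mul ?uA ?uB ?mat_of_unit//.
have [a a0 ->] := mat_of_pgl uA; have [b b0 ->] := mat_of_pgl uB.
exists (a * b); first by rewrite mulf_neq0.
by rewrite -scalemxAl -scalemxAr scalerA.
Qed.

Lemma pgl_mulA m : associative (@pgl_mul m).
Proof.
move=> f g h; rewrite -(mat_ofK f) -(mat_ofK g) -(mat_ofK h).
by rewrite !pgl_mulE ?unitmx_mul ?mat_of_unit// mulmxA.
Qed.

Lemma pgl_mul1g m : left_id (pgl 1%:M) (@pgl_mul m).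
Proof.
by move=> g; rewrite -(mat_ofK g) pgl_mulE ?unitmx1 ?mat_of_unit// mul1mx.
Qed.

Lemma pgl_mulg1 m : right_id (pgl 1%:M) (@pgl_mul m).
Proof.
by move=> g; rewrite -(mat_ofK g) pgl_mulE ?unitmx1 ?mat_of_unit// mulmx1.
Qed.

Lemma pgl_mulVg m : left_inverse (pgl 1%:M) (@pgl_inv m) (@pgl_mul m).
Proof.
move=> g; rewrite -[X in pgl_mul _ X](mat_ofK g) /pgl_inv.
by rewrite pgl_mulE ?unitmx_inv ?mat_of_unit// mulVmx ?mat_of_unit.
Qed.

Lemma pgl_mulgV m : right_inverse (pgl 1%:M) (@pgl_inv m) (@pgl_mul m).
Proof.
move=> g; rewrite -[X in pgl_mul X _](mat_ofK g) /pgl_inv.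
by rewrite pgl_mulE ?unitmx_inv ?mat_of_unit// mulmxV ?mat_of_unit.
Qed.

HB.instance Definition _ m := isGroup.Build (PGL m)
  (@pgl_mulA m) (@pgl_mul1g m) (@pgl_mulg1 m) (@pgl_mulVg m) (@pgl_mulgV m).

Definition pact n (g : PGL n.+1) (p : RP n) : RP n :=
  pt (mat_of g *m vec_of p).

Lemma pactE n (A : 'M[R]_n.+1) (v : 'cV[R]_n.+1) : A \in unitmx -> v != 0 ->
  pact (pgl A) (pt v) = pt (A *m v).
Proof.
have nz (B : 'M[R]_n.+1) (w : 'cV[R]_n.+1) : B \in unitmx -> w != 0 ->
    B *m w != 0.
  move=> uB; apply: contra => /eqP Bw0.
  by rewrite -(mulKmx uB w) Bw0 mulmx0.
move=> uA v0; apply/esym/pt_eq; rewrite ?nz ?mat_of_unit ?vec_of_neq0//.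
have [a a0 ->] := mat_of_pgl uA; have [b b0 ->] := vec_of_pt v0.
exists (a * b); first by rewrite mulf_neq0.
by rewrite -scalemxAl -scalemxAr scalerA.
Qed.

End ProjectiveSpace.

Arguments pt {R n} v.
Arguments pgl {R m} A.

Section Convexity.
Context {R : realType} {n : nat}.
Implicit Types (Omega L : set (RP R n)) (u w : 'cV[R]_n.+1).

Definition projective_line L :=
  exists2 W : 'M[R]_(n.+1, 2), \rank W = 2%N &
    L = [set pt (W *m c) | c in [set c : 'cV[R]_2 | c != 0]].

Definition properly_convex Omega :=
  forall L, projective_line L ->
    connected (Omega `&` L) /\
    exists p q, [/\ p <> q, (L `\` Omega) p & (L `\` Omega) q].

Definition frontier Omega := closure Omega `\` Omega^°.
Definition bdry Omega := Omega `\` Omega^°.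

(* For independent u and w, s |-> [u + s w] is an affine parametrization of a
   projective line minus a point; all affine parametrizations of projective
   segments are restrictions of such maps to some [a, b] with a < b. *)
Definition independent u w := \rank (row_mx u w) = 2%N.
Definition line_pt u w (s : R) : RP R n := pt (u + s *: w).

Definition contains_no_segment (X : set (RP R n)) :=
  ~ exists u w (a b : R), [/\ independent u w, a < b &
      forall s, a <= s <= b -> X (line_pt u w s)].

Definition hilbert_value Omega (p q : RP R n) (d : R) :=
  exists u w (a b x y : R),
    [/\ independent u w, a < b,
        [/\ frontier Omega (line_pt u w a), frontier Omega (line_pt u w b) &
            forall s, a < s < b -> Omega (line_pt u w s)],
        [/\ a < x < b, a < y < b, p = line_pt u w x & q = line_pt u w y] &
        d = 2^-1 * `| ln ((`|b - x| * `|y - a|) / (`|b - y| * `|x - a|)) | ].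

Definition hilbert_dist Omega (p q : RP R n) : R :=
  if p == q then 0 else xget 0 (hilbert_value Omega p q).

End Convexity.

Section Groups.
Context {G : groupType}.
Implicit Type Gamma : set G.

Definition is_subgroup Gamma :=
  [/\ Gamma 1%g, forall g h, Gamma g -> Gamma h -> Gamma (g * h)%g &
      forall g, Gamma g -> Gamma g^-1%g].

Definition virtually_abelian Gamma :=
  exists H : set G,
    [/\ is_subgroup H, H `<=` Gamma,
        forall g h, H g -> H h -> (g * h = h * g)%g &
        exists s : seq G, forall g, Gamma g ->
          exists k h, [/\ k \in s, H h & g = (k * h)%g]].

End Groups.

Section Manifolds.
Context {R : realType} {n : nat}.
Implicit Types (Omega : set (RP R n)) (Gamma : set (PGL R n.+1)).

Definition discrete_subset Gamma := forall g, Gamma g -> isolated Gamma g.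

Definition properly_convex_manifold Omega Gamma :=
  [/\ properly_convex Omega, Omega !=set0,
      is_subgroup Gamma, discrete_subset Gamma &
      (forall g, Gamma g -> pact g @` Omega = Omega) /\
      (forall g p, Gamma g -> Omega p -> pact g p = p -> g = 1%g)].

Definition orbit Gamma (p : RP R n) : set (RP R n) :=
  [set pact g p | g in Gamma].

(* When Gamma is a subgroup, p and q have the same orbit iff q = g p for some
   g in Gamma. *)
Definition same_orbit Gamma (p q : RP R n) : bool :=
  `[< orbit Gamma p = orbit Gamma q >].

Lemma same_orbit_refl Gamma : reflexive (same_orbit Gamma).
Proof. by move=> p; apply/asboolP. Qed.

Lemma same_orbit_sym Gamma : symmetric (same_orbit Gamma).
Proof. by move=> p q; apply/asboolP/asboolP. Qed.

Lemma same_orbit_trans Gamma : transitive (same_orbit Gamma).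
Proof. by move=> q p r /asboolP pq /asboolP qr; apply/asboolP; rewrite pq. Qed.

Canonical same_orbit_equiv Gamma :=
  EquivRel (same_orbit Gamma) (same_orbit_refl Gamma) (@same_orbit_sym Gamma)
    (@same_orbit_trans Gamma).

Definition orbit_space Gamma : Type :=
  quotient_topology {eq_quot (same_orbit Gamma)}.
HB.instance Definition _ Gamma := Topological.on (orbit_space Gamma).
HB.instance Definition _ Gamma := Quotient.on (orbit_space Gamma).

Definition oproj Gamma (p : RP R n) : orbit_space Gamma :=
  \pi_(orbit_space Gamma) p.

Arguments oproj Gamma p : clear implicits.

(* The orbit map is open, so for Gamma-invariant Omega the subspace topology on
   this set is the quotient topology of Omega / Gamma. *)
Definition quotient_set Omega Gamma : set (orbit_space Gamma) :=
  oproj Gamma @` Omega.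
Arguments quotient_set Omega Gamma : clear implicits.

End Manifolds.

Arguments oproj {R n} Gamma p.
Arguments quotient_set {R n} Omega Gamma.

Section Smooth.
Context {R : realType}.

Fixpoint Ck (k : nat) (V W : normedModType R) (U : set V) (f : V -> W) : Prop :=
  if k is k'.+1 then
    (forall x, U x -> differentiable f x) /\ forall v, Ck k' U ('D_v f)
  else forall x, U x -> {for x, continuous f}.

Definition smooth (V W : normedModType R) (U : set V) (f : V -> W) :=
  forall k, Ck k U f.

(* P and Q play the role of charts: D and E are subsets of normed spaces, and
   P, Q are restrictions to them of submersions followed by coverings.  f is
   smooth from P @` D to Q @` E when f \o P locally lifts through Q to a map
   into E that extends to a C^oo map on an open set.  This is the usual notion
   of a smooth map between arbitrary subsets of manifolds; a diffeomorphism in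
   this sense from Omega / Gamma to (bdry Omega / Gamma) x [0, +oo[ can only
   exist when bdry Omega is a smooth hypersurface. *)
Definition smooth_map (V W : normedModType R) (X Y : Type)
    (P : V -> X) (D : set V) (Q : W -> Y) (E : set W) (f : X -> Y) :=
  forall v, D v -> exists (U : set V) (F : V -> W),
    [/\ open U, U v, smooth U F &
        forall w, U w -> D w -> E (F w) /\ Q (F w) = f (P w)].

Definition diffeomorphic (V W : normedModType R) (X Y : Type)
    (P : V -> X) (D : set V) (Q : W -> Y) (E : set W) :=
  exists (f : X -> Y) (g : Y -> X),
    [/\ smooth_map P D Q E f, smooth_map Q E P D g,
        forall x, (P @` D) x -> g (f x) = x &
        forall y, (Q @` E) y -> f (g y) = y].

End Smooth.

Section Cusps.
Context {R : realType} {n : nat}.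
Implicit Types (Omega : set (RP R n)) (Gamma : set (PGL R n.+1)).

Definition cone Omega : set 'cV[R]_n.+1 := [set v | v != 0 /\ Omega (pt v)].

Definition vproj Gamma (v : 'cV[R]_n.+1) : orbit_space Gamma :=
  oproj Gamma (pt v).
Arguments vproj Gamma v : clear implicits.

(* The image of vproj on cone Omega is Omega / Gamma, and the image of
   vproj x id on cone (bdry Omega) x [0, +oo[ is (bdry Omega / Gamma) x
   [0, +oo[. *)
Definition diffeo_to_collar Omega Gamma :=
  @diffeomorphic R 'cV[R]_n.+1 ('cV[R]_n.+1 * R)%type
    (orbit_space Gamma) (orbit_space Gamma * R)%type
    (vproj Gamma) (cone Omega)
    (fun vt => (vproj Gamma vt.1, vt.2))
    (cone (bdry Omega) `*` [set t | 0 <= t]).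

Definition generalized_cusp Omega Gamma :=
  [/\ properly_convex_manifold Omega Gamma,
      virtually_abelian Gamma,
      compact (quotient_set (bdry Omega) Gamma) /\
      connected (quotient_set (bdry Omega) Gamma),
      contains_no_segment (bdry Omega) &
      diffeo_to_collar Omega Gamma].

(* The generalized cusp Omega' / Gamma' embeds in Omega / Gamma as the image of
   Omega': two points of Omega' in the same Gamma-orbit are in the same
   Gamma'-orbit. *)
Definition cusp_in Omega Gamma (Omega' : set (RP R n))
    (Gamma' : set (PGL R n.+1)) :=
  [/\ generalized_cusp Omega' Gamma', Omega' `<=` Omega, Gamma' `<=` Gamma &
      forall g p, Gamma g -> Omega' p -> Omega' (pact g p) -> Gamma' g].

(* A loop in Omega / Gamma is the image of a path s in Omega, its lift to the
   universal cover, with s 1 = g (s 0) for some g in Gamma; that g is the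
   holonomy of the loop. *)
Definition holonomy_pi1 Omega Gamma (g : PGL R n.+1) :=
  Gamma g /\ exists s : R -> RP R n,
    [/\ {within `[0, 1], continuous s},
        forall t, 0 <= t <= 1 -> Omega (s t) & s 1 = pact g (s 0)].

End Cusps.

Arguments vproj {R n} Gamma v.

Section Ends.
Context {X : topologicalType}.
Implicit Types (M K N : set X) (e : set X -> set X).

(* Freudenthal ends: compatible choices of a connected component of M `\` K
   for every compact K `<=` M. *)
Definition is_end M e :=
  (forall K, compact K -> K `<=` M ->
    exists2 x, (M `\` K) x & e K = connected_component (M `\` K) x) /\
  (forall K K', compact K -> compact K' -> K `<=` K' -> K' `<=` M ->
    e K' `<=` e K).

Definition end_nbhd M e N :=
  exists K, [/\ compact K, K `<=` M, e K `<=` N & N `<=` M].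

End Ends.

Definition every_end_is_generalized_cusp (R : realType) (n : nat)
    (Omega : set (RP R n)) (Gamma : set (PGL R n.+1)) :=
  forall e, is_end (quotient_set Omega Gamma) e ->
    exists (Omega' : set (RP R n)) (Gamma' : set (PGL R n.+1)),
      cusp_in Omega Gamma Omega' Gamma' /\
      end_nbhd (quotient_set Omega Gamma) e (quotient_set Omega' Gamma).

Section Hyperbolic.
Context {R : realType} {n : nat}.

Definition lorentz : 'M[R]_n.+1 :=
  diag_mx (\row_i (if i == ord_max then -1 else 1)).

Definition lorentz_norm (v : 'cV[R]_n.+1) : R :=
  (v^T *m lorentz *m v) ord0 ord0.

Definition PO : set (PGL R n.+1) :=
  [set pgl A | A in [set A : 'M[R]_n.+1 | A^T *m lorentz *m A = lorentz]].

Definition hyperbolic_space : set (RP R n) :=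
  [set pt v | v in [set v | lorentz_norm v < 0]].

Definition sphere_at_infinity : set (RP R n) :=
  [set pt v | v in [set v | v != 0 /\ lorentz_norm v = 0]].

Definition parabolic (g : PGL R n.+1) :=
  [/\ PO g, forall p, hyperbolic_space p -> pact g p <> p &
      exists! p, sphere_at_infinity p /\ pact g p = p].

End Hyperbolic.

(* Main.v *)
(* Write Omega as the projectivization of an open cone K with pointed closure.
   The points moved less and less by g leave every compact subset of M; an
   ultrafilter of such points selects an end, hence a cusp Omega' / Gamma', and
   near that end the segments from x to g x stay in a translate of Omega', so a
   conjugate of Gamma' contains g.

   Let C be the closed convex cone spanned by the strictly convex boundary of
   Omega'. If X preserves C, X^2 = 0, X <> 0, and X commutes with the abelian
   group H of lifts, then X s is never proportional to a boundary vector s, so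
   that 1 + X maps the boundary into the interior of C and, by cocompactness,
   1 + X + e Y preserves C for every Y commuting with H and small e > 0. This
   makes the set of such X one-dimensional. A power B of g lies in H; after
   rescaling, its powers grow subexponentially (the displacement of g is 0) and
   are unbounded (H is discrete and torsion free), so normalized limits give
   such an X, of rank one. It follows that B is the sum of a bounded part and a
   unipotent part 1 + N on its generalized 1-eigenspace, with N of rank two and
   N^2 a nonzero multiple of X. Such a B preserves a Lorentzian form; averaging
   makes the form g-invariant, and g is parabolic for it. *)
Require Import Defs.
From HB Require Import structures.
From mathcomp Require Import all_boot all_order all_algebra.
From mathcomp Require Import generic_quotient.
From mathcomp Require Import all_classical all_reals all_analysis.
From mathcomp Require Import lra ring zify.

Set Implicit Arguments.
Unset Strict Implicit.
Unset Printing Implicit Defensive.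

Import Order.TTheory GRing.Theory Num.Theory.
Import numFieldNormedType.Exports.

Local Open Scope classical_set_scope.
Local Open Scope ring_scope.
Local Open Scope quotient_scope.

(** * Topology and matrices *)

(** The hull [C] of the boundary vectors is used rather than the closure of the cone over Omega'
    because a matrix preserves [C] as soon as it maps boundary vectors into [C], and those are
    compact modulo the group and positive scaling; one [e] then serves for all of them. Omega' need
    be neither open nor closed in projective space, so a segment issuing from a boundary point might
    leave it at once: local closedness has to be extracted from the collar diffeomorphism before the
    absence of boundary segments can produce interior points. The length three of the Jordan block
    of B is forced from both sides: with length two, the powers of B and of its inverse, divided by
    the exponent, would tend to opposite matrices preserving a pointed cone; with a longer block,
    two successive powers of N would be multiples of X. Metric arguments take place in one nappe [K]
    of the cone over Omega, where comparability in the order of the closed cone replaces the Hilbert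
    distance and is preserved by lifts. *)

Section Topology.

(** Compactness in the form of an induction. The sets whose complement in [K] satisfies [P] form a
    filter, which is proper if [P K] fails; near a cluster point in [K] the local hypothesis gives a
    neighbourhood whose complement belongs to the filter, a contradiction. *)
Lemma compact_ind (X : topologicalType) (K : set X) (P : set X -> Prop) :
  compact K -> P set0 -> (forall A B, P A -> P B -> P (A `|` B)) ->
  (forall A B, A `<=` B -> P B -> P A) ->
  (forall x, K x -> exists2 A, nbhs x A & P A) -> P K.
Proof.
move=> cK P0 PU PS PK; apply: contrapT => nPK.
pose F : set_system X := [set B | P (K `\` B)].
have FF : Filter F.
  split; rewrite /F /=.
  - by rewrite setDT.
  - by move=> A B PA PB; move: (PU _ _ PA PB); rewrite -setDIr.
  - by move=> A B AB; apply: PS => x [Kx nBx]; split=> // /AB.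
have PF : ProperFilter F.
  by split=> //; rewrite /F /= setD0.
have FK : F K by rewrite /F /= setDv.
have [x [Kx clx]] := cK F PF FK.
have [A xA PA] := PK x Kx.
have FA : F (~` A) by apply: PS PA => y [_ /contrapT].
by have [y []] := clx _ _ FA xA.
Qed.

(** Connectedness of the unit interval for two predicates that are open only relative to it, which
    is all that a path defined on [[0, 1]] provides. The supremum of the points of [A] can be
    neither in [B] nor, unless it is 1, in [A]. *)
Lemma real_segment_connected (R : realType) (A B : set R) :
  A 0 -> (forall t, 0 <= t <= 1 -> A t \/ B t) ->
  (forall t, A t -> B t -> False) ->
  (forall t, 0 <= t <= 1 -> A t -> \forall u \near t, 0 <= u <= 1 -> A u) ->
  (forall t, 0 <= t <= 1 -> B t -> \forall u \near t, 0 <= u <= 1 -> B u) ->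
  A 1.
Proof.
move=> A0 AB disj oA oB; apply: contrapT => nA1.
have B1 : B 1 by case: (AB 1) => //; rewrite ler01 lexx.
pose S := [set t : R | 0 <= t <= 1 /\ A t].
have S0 : S 0 by split=> //; rewrite lexx ler01.
have uS : has_ubound S by exists 1 => t [/andP[]].
have sS : has_sup S by split=> //; exists 0.
pose c := sup S.
have c01 : 0 <= c <= 1.
  rewrite /c (ub_le_sup uS S0)/=.
  by apply: ge_sup; [exists 0|move=> t [/andP[]]].
have [Ac|Bc] := AB c c01.
- have /nbhs_ballP[e e0 he] := oA c c01 Ac.
  have [c1|c1] := leP 1 c.
    by apply: nA1; have -> : 1 = c by apply/eqP; rewrite eq_le c1; case/andP: c01.
  pose t := Num.min 1 (c + e / 2).
  have e0' : 0 < e / 2 by rewrite divr_gt0.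
  have ct : c < t by rewrite lt_min c1 ltrDl.
  have t01 : 0 <= t <= 1.
    by rewrite ge_min lexx/= (le_trans _ (ltW ct))//; case/andP: c01.
  have At : A t.
    apply: he => //; rewrite /ball/= distrC ger0_norm ?subr_ge0 ?(ltW ct)//.
    by rewrite ltrBlDl (@le_lt_trans _ _ (c + e / 2)) ?ge_min ?lexx ?orbT//;
      rewrite ltrD2l ltr_pdivrMr// ltr_pMr// ltr1n.
  have : t <= c by apply: ub_le_sup.
  by rewrite leNgt ct.
- have /nbhs_ballP[e e0 he] := oB c c01 Bc.
  have [t [t01 At]] : exists2 t, S t & c - e < t.
    by apply: sup_adherent.
  move=> cet; apply: (disj t) => //; apply: he => //.
  have tc : t <= c by apply: ub_le_sup.
  by rewrite /ball/= ger0_norm ?subr_ge0//; lra.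
Qed.

End Topology.

Lemma segment_continuous (R : realType) (V : normedModType R) (u v : V) :
  continuous (fun t : R => (1 - t) *: u + t *: v).
Proof.
move=> t; apply: (@continuousD R V R (fun t => (1 - t) *: u) (fun t => t *: v)).
  apply: (@continuous_comp _ _ _ (fun x : R => 1 - x) (fun a : R => a *: u)).
    apply: (@continuousB R R^o R (fun=> 1) id); first exact: cst_continuous.
    exact: cvg_id.
  exact: scalel_continuous.
exact: scalel_continuous.
Qed.

Section MatrixAnalysis.
Context {R : realType}.

Lemma mx_entry_le m n (A : 'M[R]_(m, n)) i j : `|A i j| <= `|A|.
Proof.
rewrite [leRHS]/Num.Def.normr /= mx_normrE; apply/bigmax_geP; right => /=.
by exists (i, j).
Qed.

Lemma mx_norm_le m n (A : 'M[R]_(m, n)) (c : R) : 0 <= c ->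
  (forall i j, `|A i j| <= c) -> `|A| <= c.
Proof.
move=> c0 Ac; rewrite /Num.Def.normr /= mx_normrE; apply/bigmax_leP.
by split=> // -[i j] _ /=.
Qed.

(** The norm is the largest absolute value of an entry, and an entry of the product is a sum of [n]
    terms; hence the factor [n%:R]. *)
Lemma mulmx_norm_le m n p (A : 'M[R]_(m, n)) (B : 'M[R]_(n, p)) :
  `|A *m B| <= n%:R * `|A| * `|B|.
Proof.
apply: mx_norm_le => [|i j]; first by rewrite !mulr_ge0.
rewrite mxE (le_trans (ler_norm_sum _ _ _))//.
rewrite -mulrA -[n in n%:R]card_ord -sum1_card natr_sum mulr_suml.
apply: ler_sum => k _; rewrite mul1r normrM.
by apply: ler_pM => //; exact: mx_entry_le.
Qed.

Lemma cvg_mx m n (T : Type) (F : set_system T) (FF : Filter F)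
    (f : T -> 'M[R]_(m, n)) (A : 'M[R]_(m, n)) :
  (forall i j, f t i j @[t --> F] --> A i j) -> f t @[t --> F] --> A.
Proof.
move=> fA; apply/cvgrPdist_le => e e0.
have : \forall t \near F, forall ij : 'I_m * 'I_n, `|A ij.1 ij.2 - f t ij.1 ij.2| <= e.
  apply: filter_forall => -[i j] /=.
  by have /cvgrPdist_le/(_ _ e0) := fA i j.
apply: filterS => t fAt; apply: mx_norm_le; first exact: ltW.
by move=> i j; rewrite !mxE; exact: (fAt (i, j)).
Qed.

Lemma cvg_mx_entry m n (T : Type) (F : set_system T) (FF : Filter F)
    (f : T -> 'M[R]_(m, n)) (A : 'M[R]_(m, n)) i j :
  f t @[t --> F] --> A -> f t i j @[t --> F] --> A i j.
Proof.
by move=> fA; have := @coord_continuous R m n i j A; exact: cvg_comp.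
Qed.

Lemma cvg_mulmx m n p (T : Type) (F : set_system T) (FF : Filter F)
    (f : T -> 'M[R]_(m, n)) (g : T -> 'M[R]_(n, p))
    (A : 'M[R]_(m, n)) (B : 'M[R]_(n, p)) :
  f t @[t --> F] --> A -> g t @[t --> F] --> B ->
  f t *m g t @[t --> F] --> A *m B.
Proof.
move=> fA gB; apply: cvg_mx => i j.
under eq_fun do rewrite mxE; rewrite mxE.
apply: cvg_big => [|k _]; first exact: add_continuous.
by apply: cvgM; exact: cvg_mx_entry.
Qed.

Lemma mulmxl_continuous m n p (A : 'M[R]_(m, n)) :
  continuous (fun B : 'M[R]_(n, p) => A *m B).
Proof. move=> B; apply: (@cvg_mulmx _ _ _ _ (nbhs B) _ (fun=> A) id).
  exact: cvg_cst.
exact: cvg_id. Qed.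

Lemma mulmxr_continuous m n p (B : 'M[R]_(n, p)) :
  continuous (fun A : 'M[R]_(m, n) => A *m B).
Proof. move=> A; apply: (@cvg_mulmx _ _ _ _ (nbhs A) _ id (fun=> B)).
  exact: cvg_id.
exact: cvg_cst. Qed.

(** Heine-Borel for row vectors, carried to matrices by the continuous map [vec_mx]. *)
Lemma mx_bounded_closed_compact m n (A : set 'M[R]_(m, n)) (c : R) :
  (forall M, A M -> `|M| <= c) -> closed A -> compact A.
Proof.
move=> Ac clA.
have cvec : continuous (vec_mx : 'rV[R]_(m * n) -> 'M[R]_(m, n)).
  move=> v; apply: (@cvg_mx _ _ _ (nbhs v)) => i j; under eq_fun do rewrite mxE; rewrite mxE.
  exact: coord_continuous.
have -> : A = vec_mx @` (vec_mx @^-1` A).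
  apply/seteqP; split => [M AM|M [v /= Av <-//]].
  by exists (mxvec M); rewrite /= mxvecK.
apply: continuous_compact; first exact: continuous_subspaceT.
apply: bounded_closed_compact; last first.
  by apply: closed_comp => // v _; exact: cvec.
exists c; split; first exact: num_real.
move=> d cd v Av; apply: le_trans (ltW cd).
have c0 : 0 <= c by apply: le_trans (Ac _ Av).
apply: mx_norm_le => // i k; rewrite ord1 => {i}.
case/mxvec_indexP: k => i j.
by rewrite -[v]vec_mxK mxvecE; apply: le_trans (mx_entry_le _ _ _) (Ac _ Av).
Qed.

End MatrixAnalysis.

(** * Cones and the matrices preserving them *)

Section Cones.
Context {R : realType} {n : nat}.
Local Notation V := 'cV[R]_n.+1.
Local Notation M := 'M[R]_n.+1.
Implicit Types (C : set V) (X Y Z : M).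

Definition convex_cone C :=
  [/\ C 0, forall u v, C u -> C v -> C (u + v) &
      forall (c : R) u, 0 <= c -> C u -> C (c *: u)].

Definition pointed_cone C := forall v, C v -> C (- v) -> v = 0.

Definition preserves C X := forall v, C v -> C (X *m v).

Lemma closed_approx (T : normedModType R) (F : set T) (x : T) : closed F ->
  (forall e : R, 0 < e -> exists2 y, F y & `|x - y| <= e) -> F x.
Proof.
move=> clF Fx; apply: clF => B /nbhs_ballP[e e0 eB].
have e2 : 0 < e / 2 by rewrite divr_gt0.
have [y Fy xy] := Fx (e / 2) e2.
exists y; split=> //; apply: eB; rewrite -ball_normE /ball_/=.
by apply: le_lt_trans xy _; rewrite ltr_pdivrMr// ltr_pMr// ltr1n.
Qed.

Lemma closed_approx_ray (T : normedModType R) (F : set T) (x w : T) :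
  closed F -> (forall k, F (x + k.+1%:R^-1 *: w)) -> F x.
Proof.
move=> clF Fx; apply: closed_approx => // e e0.
have [w0|w0] := eqVneq w 0.
  by exists (x + 1%:R^-1 *: w); rewrite ?(Fx 0)// w0 scaler0 addr0 subrr normr0 ltW.
have w0' : 0 < `|w| by rewrite normr_gt0.
pose k := Num.bound (`|w| / e).
exists (x + k.+1%:R^-1 *: w); first exact: Fx.
rewrite opprD addrA subrr sub0r normrN normrZ ger0_norm// mulrC.
rewrite ler_pdivrMr// -ler_pdivrMl// mulrC ltW//.
apply: lt_le_trans (archi_boundP _) _; first by rewrite divr_ge0 ?ltW.
by rewrite ler_nat.
Qed.

Lemma preserves1 C : preserves C 1.
Proof. by move=> v Cv; rewrite mul1mx. Qed.

Lemma preservesM C X Y : preserves C X -> preserves C Y -> preserves C (X * Y).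
Proof. by move=> PX PY v Cv; rewrite -mulmxE -mulmxA; apply/PX/PY. Qed.

Lemma preservesX C X k : preserves C X -> preserves C (X ^+ k).
Proof.
move=> PX; elim: k => [|k IH]; first exact: preserves1.
by rewrite exprS; exact: preservesM.
Qed.

Lemma preservesD C X Y : convex_cone C ->
  preserves C X -> preserves C Y -> preserves C (X + Y).
Proof. by move=> [_ CD _] PX PY v Cv; rewrite mulmxDl; apply: CD; auto. Qed.

Lemma preservesZ C X (c : R) : convex_cone C -> 0 <= c ->
  preserves C X -> preserves C (c *: X).
Proof. by move=> [_ _ CZ] c0 PX v Cv; rewrite -scalemxAl; apply: CZ; auto. Qed.

Lemma preserves_closed C : closed C -> closed (preserves C).
Proof.
move=> clC; have -> : preserves C = \bigcap_(v in C) [set X | C (X *m v)].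
  by apply/seteqP; split.
apply: closed_bigI => v Cv; apply: closed_comp => // X _.
exact: mulmxr_continuous.
Qed.

Lemma interior_perturb C y z : C° y ->
  exists2 e : R, 0 < e & C (y + e *: z) /\ C (y - e *: z).
Proof.
move=> /nbhs_ballP[e e0 eC]; have [z0|z0] := eqVneq z 0.
  exists 1 => //; rewrite z0 scaler0 subr0 addr0.
  by split; apply: eC; exact: ballxx.
have z0' : 0 < `|z| by rewrite normr_gt0.
have H (s : R) : `|s| = 1 -> C (y + (s * (e / 2 / `|z|)) *: z).
  move=> s1; apply: eC; rewrite -ball_normE /ball_/= opprD addrA subrr sub0r.
  rewrite normrN normrZ normrM s1 mul1r ger0_norm ?divr_ge0 ?ltW//.
  by rewrite divfK ?gt_eqF// gtr_pMr// invf_lt1// ltr1n.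
exists (e / 2 / `|z|); first by rewrite !divr_gt0.
split; first by rewrite -[X in X *: z]mul1r; apply: H; rewrite normr1.
by rewrite -scaleNr -mulN1r; apply: H; rewrite normrN1.
Qed.

(** For small [e] both [y + e b] and [y - e b] lie in [C], whatever the basis vector [b]. If [X]
    kills [y], it sends them to opposite vectors of the pointed cone, so it kills [b]. *)
Lemma preserves_annih C y X : pointed_cone C -> preserves C X ->
  C° y -> X *m y = 0 -> X = 0.
Proof.
move=> pC PX iy Xy0; apply/matrixP => i j; rewrite mxE.
have [e e0 [C1 C2]] := interior_perturb (delta_mx j ord0) iy.
have := pC _ (PX _ C1); rewrite mulmxDr Xy0 add0r -scalemxAr.
move: (PX _ C2); rewrite mulmxBr Xy0 sub0r -scalemxAr => C3 /(_ C3) /eqP.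
rewrite scaler_eq0 gt_eqF//= => /eqP/matrixP/(_ i ord0).
by rewrite -colE !mxE.
Qed.

Lemma preserves_pointed C y X : pointed_cone C -> C° y ->
  preserves C X -> preserves C (- X) -> X = 0.
Proof.
move=> pC iy PX PNX; apply: (preserves_annih pC PX iy).
have Cy : C y := interior_subset iy.
by apply: pC; [exact: PX|rewrite -mulNmx; exact: PNX].
Qed.

Lemma expr1D_sq0 (X : M) k : X * X = 0 -> (1 + X) ^+ k = 1 + k%:R *: X.
Proof.
move=> X0; elim: k => [|k IH]; first by rewrite expr0 scale0r addr0.
rewrite exprS IH mulrDl mul1r mulrDr mulr1 -scalerAr X0 scaler0 addr0.
by rewrite -addrA -[k.+1]add1n natrD scalerDl scale1r [_ *: X + X]addrC.
Qed.

(** [Z] is the limit of [(1 + Z) ^+ k] divided by [k], because [(1 + Z) ^+ k = 1 + k%:R *: Z]. *)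
Lemma preserves_sq0 C Z : closed C -> convex_cone C -> Z * Z = 0 ->
  preserves C (1 + Z) -> preserves C Z.
Proof.
move=> clC cC Z0 P1Z; apply: (@closed_approx_ray _ (preserves C) Z 1) => [|k].
  exact: preserves_closed.
have -> : Z + k.+1%:R^-1 *: 1 = k.+1%:R^-1 *: (1 + Z) ^+ k.+1.
  rewrite expr1D_sq0// scalerDr scalerA mulVf ?pnatr_eq0// scale1r addrC.
  by [].
by apply: preservesZ => //; exact: preservesX.
Qed.

(* The cone of the preserving matrices in the plane of X and Y consists of 0
   and of interior points, which is absurd for a pointed cone. *)
Lemma preserves_collinear C (comm : set M) y X Y :
  closed C -> convex_cone C -> pointed_cone C -> C° y ->
  (forall c X' Y', comm X' -> comm Y' -> comm (X' + c *: Y')) ->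
  (forall X' Y', preserves C X' -> comm X' -> X' * X' = 0 -> X' != 0 ->
     comm Y' -> exists2 e : R, 0 < e & preserves C (1 + X' + e *: Y')) ->
  preserves C X -> comm X -> comm Y -> X != 0 ->
  X * X = 0 -> Y * Y = 0 -> X * Y = 0 -> Y * X = 0 ->
  exists c : R, Y = c *: X.
Proof.
move=> clC cC pC iy commD key PX cX cY X0 XX YY XY YX; apply: contrapT => nc.
(* If [Y] is not a multiple of [X], the rays issuing from [X] in the directions [Y] and [- Y] never
   leave the cone of preserving matrices, so both directions belong to this closed cone, against
   pointedness. *)
suff H (s : R) : s != 0 -> preserves C (s *: Y).
  case: nc; exists 0; rewrite scale0r; apply: (preserves_pointed pC iy).
    by rewrite -[Y]scale1r; apply: H; rewrite oner_neq0.
  by rewrite -scaleN1r; apply: H; rewrite oppr_eq0 oner_neq0.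
move=> s0; pose f (t : R) := X + t *: (s *: Y).
have fcomm t : comm (f t) by rewrite /f scalerA; exact: commD.
have f0 t : f t != 0.
  apply/eqP => ft0; apply: nc; have [t0|t0] := eqVneq t 0.
    by move: ft0; rewrite /f t0 scale0r addr0 => /eqP; rewrite (negPf X0).
  exists (- (t * s)^-1); have /eqP := ft0.
  rewrite /f scalerA addr_eq0 => /eqP ->.
  by rewrite scalerN scaleNr opprK scalerA mulVf ?scale1r ?mulf_neq0.
have fsq t : f t * f t = 0.
  rewrite /f scalerA mulrDl !mulrDr -!(scalerAl, scalerAr) XX XY YX YY.
  by rewrite !scaler0 !addr0.
have fconv t u : preserves C (f t) -> 0 <= u <= t -> preserves C (f u).
  move=> Pt /andP[u0 ut]; have [t0|t0] := eqVneq t 0.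
    by have -> : u = t by apply/le_anti; rewrite ut t0.
  have tp : 0 < t by rewrite lt_def t0 (le_trans u0).
  have -> : f u = (u / t) *: f t + (1 - u / t) *: X.
    rewrite /f scalerDr [_ *: (t *: _)]scalerA divfK// addrAC -scalerDl.
    by rewrite [u / t + _]addrC subrK scale1r.
  apply: preservesD => //; apply: preservesZ => //; first exact: divr_ge0 u0 (ltW tp).
  by rewrite subr_ge0 ler_pdivrMr// mul1r.
have PT : closed (preserves C) := preserves_closed clC.
have step t : preserves C (f t) -> exists2 e : R, 0 < e & preserves C (f (t + e)).
  move=> Pt; have csY : comm (s *: Y).
    by have := commD (s - 1) _ _ cY cY; rewrite scalerBl scale1r addrCA subrr addr0.
  have [e e0 Pe] := key _ _ Pt (fcomm t) (fsq t) (f0 t) csY.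
  exists e => //; apply: preserves_sq0 => //.
  by move: Pe; rewrite /f scalerDl !addrA.
pose S := [set t : R | 0 <= t /\ preserves C (f t)].
have S0 : S 0 by split=> //; rewrite /f scale0r addr0.
(* If [S] is unbounded, the direction of the ray is a limit of rescaled points of the ray. If it is
   bounded, its supremum belongs to it by closedness and [step] goes beyond. *)
have [uS|nuS] := pselect (has_ubound S); last first.
  have all_t t : 0 <= t -> preserves C (f t).
    move=> t0; apply: contrapT => nPt; apply: nuS; exists t => u [u0 Pu].
    by rewrite leNgt; apply/negP => tu; apply: nPt; apply: fconv Pu _; rewrite t0 ltW.
  apply: (@closed_approx_ray _ (preserves C) _ X) => // k.
  have -> : s *: Y + k.+1%:R^-1 *: X = k.+1%:R^-1 *: f k.+1%:R.
    by rewrite /f scalerDr [_ *: (k.+1%:R *: _)]scalerA mulVf ?pnatr_eq0//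
      scale1r addrC.
  by apply: preservesZ => //; exact: all_t.
have c0 : 0 <= sup S by exact: ub_le_sup.
have Pc : preserves C (f (sup S)).
  apply: (@closed_approx M (preserves C)) => // e e0.
  have d0 : 0 < e / (`|s *: Y| + 1) by rewrite divr_gt0// ltr_pwDr.
  have [t [t0 Pt] ct] := sup_adherent d0 (conj (ex_intro _ 0 S0) uS).
  exists (f t) => //; rewrite /f opprD addrACA subrr add0r -scalerBl normrZ.
  have tc : t <= sup S by apply: ub_le_sup.
  rewrite ger0_norm ?subr_ge0//.
  have {}ct : sup S - t <= e / (`|s *: Y| + 1) by rewrite lerBlDr -lerBlDl ltW.
  apply: le_trans (ler_wpM2r (normr_ge0 _) ct) _.
  by rewrite -mulrA ger_pMr// mulrC ler_pdivrMr ?ltr_pwDr// mul1r lerDl.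
have [e e0 Pe] := step _ Pc.
have : sup S + e <= sup S by apply: ub_le_sup => //; split=> //; rewrite addr_ge0// ltW.
by rewrite gerDl leNgt e0.
Qed.

End Cones.

(** * Growth of the powers of a matrix *)

Section PowerGrowth.
Context {R : realType}.

Lemma bernoulli_le (x : R) k : 0 <= x -> 1 + k%:R * x <= (1 + x) ^+ k.
Proof.
move=> x0; elim: k => [|k IH]; first by rewrite mul0r addr0 expr0.
have x1 : 0 <= 1 + x by rewrite addr_ge0.
rewrite exprS; apply: le_trans (ler_wpM2l x1 IH); rewrite -[k.+1]addn1 natrD.
have : 0 <= k%:R * x ^+ 2 by rewrite mulr_ge0// sqr_ge0.
by nra.
Qed.

Lemma exists_small_root k : exists2 r : R, 1 < r & r ^+ k <= 3 / 2.
Proof.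
have H (x : R) j : 0 <= x -> (1 - j%:R * x) * (1 + x) ^+ j <= 1.
  move=> x0; elim: j => [|j IH]; first by rewrite mul0r subr0 expr0 mulr1.
  apply: le_trans IH; rewrite exprS mulrA ler_wpM2r ?exprn_ge0 ?addr_ge0//.
  rewrite -[j.+1]addn1 natrD.
  have : 0 <= j%:R * x ^+ 2 by rewrite mulr_ge0// sqr_ge0.
  by have := sqr_ge0 x; nra.
(* With this choice [k%:R * x <= 1 / 3], and [H] bounds [(1 + x) ^+ k] by the inverse of 2 / 3. The
   successor covers [k = 0]. *)
pose x : R := (3 * k.+1%:R)^-1.
have x0 : 0 < x by rewrite invr_gt0 mulr_gt0.
exists (1 + x); first by rewrite ltrDl.
have kx : k%:R * x <= 1 / 3.
  rewrite /x invfM mulrCA div1r ger_pMr ?invr_gt0// ler_pdivrMr// mul1r.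
  by rewrite ler_nat.
have := H x k (ltW x0); have : 0 <= (1 + x) ^+ k by rewrite exprn_ge0// addr_ge0// ltW.
by nra.
Qed.

(** Otherwise [e * a (2 k) > (e * a k) ^+ 2] whenever [a k > 0]. Starting from [k0] with
    [e * a k0 > 2], repeated doubling gives [e * a (2 ^ j * k0) >= 2 ^ (2 ^ j)], whereas
    subexponential growth with [r ^+ k0 <= 3 / 2] allows only a constant times
    [(3 / 2) ^ (2 ^ j)]. *)
Lemma unbounded_subexp (a : nat -> R) (e : R) : 0 < e -> (forall k, 0 <= a k) ->
  (forall r : R, 1 < r -> exists c : R, forall k, a k <= c * r ^+ k) ->
  ~ (exists c : R, forall k, a k <= c) ->
  exists2 k, 0 < a k & a (k + k)%N <= e * a k ^+ 2.
Proof.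
move=> e0 a0 sub unb; apply: contrapT => nk.
have grow k : 0 < a k -> e * a k ^+ 2 < a (k + k)%N.
  by move=> ak; rewrite ltNge; apply/negP => h; apply: nk; exists k.
have [k0 ak0] : exists k, 2 / e < a k.
  apply: contrapT => nb; apply: unb; exists (2 / e) => k.
  by rewrite leNgt; apply/negP => ?; apply: nb; exists k.
have pos j : 0 < a (2 ^ j * k0)%N /\ (2 : R) ^+ (2 ^ j) <= e * a (2 ^ j * k0)%N.
  elim: j => [|j [IH1 IH2]].
    rewrite expn0 mul1n expr1 mulrC -ler_pdivrMr// ltW//; split=> //.
    by apply: lt_trans ak0; rewrite divr_gt0.
  have := grow _ IH1; rewrite addnn -mul2n mulnA -expnS => h.
  have ha : 0 < e * a (2 ^ j * k0)%N ^+ 2 by rewrite mulr_gt0// exprn_gt0.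
  split; first exact: lt_trans h.
  rewrite [X in _ ^+ X]expnS mulnC exprM.
  apply: le_trans (ler_wpM2l (ltW e0) (ltW h)).
  rewrite mulrA -expr2 -exprMn lerXn2r ?nnegrE ?exprn_ge0// mulr_ge0// ?ltW//.
have [r r1 rk] := exists_small_root k0.
have [c hc] := sub r r1.
have bnd j : (4 / 3 : R) ^+ (2 ^ j) <= e * c.
  have [_ h] := pos j; have := hc (2 ^ j * k0)%N => h'.
  have h2 : (2 : R) ^+ (2 ^ j) <= e * (c * (3 / 2) ^+ (2 ^ j)).
    apply: le_trans h _; apply: (ler_wpM2l (ltW e0)); apply: le_trans h' _.
    have c0 : 0 <= c by have := hc 0%N; rewrite expr0 mulr1; exact: le_trans.
    apply: (ler_wpM2l c0); rewrite mulnC exprM lerXn2r ?nnegrE ?exprn_ge0//; lra.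
  rewrite mulrA -ler_pdivrMr ?exprn_gt0 ?divr_gt0// -exprVn -exprMn in h2.
  by have -> : (4 / 3 : R) = 2 * (3 / 2)^-1 by field.
pose j := Num.bound (3 * (e * c)).
have := bnd j; rewrite leNgt => /negP; apply.
have -> : (4 / 3 : R) = 1 + 1 / 3 by field.
have h3 : (0 : R) <= 1 / 3 by rewrite divr_ge0.
apply: lt_le_trans (bernoulli_le _ h3).
have ec0 : 0 <= e * c.
  by apply: le_trans (bnd 0%N); rewrite exprn_ge0// divr_ge0.
have hj := archi_boundP (mulr_ge0 (ler0n _ 3) ec0).
have h4 : (j%:R : R) <= (2 ^ j)%:R by rewrite ler_nat ltnW// ltn_expl.
by rewrite -/j in hj; lra.
Qed.

Context {n : nat}.
Local Notation M := 'M[R]_n.+1.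

(* Choosing k with |A^(2k)| much smaller than |A^k|^2 makes the limit of
   A^k / |A^k| square to zero. *)
Lemma power_limit_sq0 (A P : M) : P * P = P -> A * P = P * A ->
  (forall r : R, 1 < r -> exists c : R, forall k, `|A ^+ k * P| <= c * r ^+ k) ->
  ~ (exists c : R, forall k, `|A ^+ k * P| <= c) ->
  exists X : M, [/\ X != 0, X * X = 0 &
    forall F : set M, closed F ->
      (forall c k, 0 < c -> F (c *: (A ^+ k * P))) -> F X].
Proof.
move=> PP AP sub unb; pose a k := `|A ^+ k * P|.
have [f hf] : {f : nat -> nat & forall i, 0 < a (f i) /\
    a (f i + f i)%N <= i.+1%:R^-1 * a (f i) ^+ 2}.
  apply: (@choice _ _ (fun i k => 0 < a k /\ a (k + k)%N <= i.+1%:R^-1 * a k ^+ 2)) => i.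
  have i0 : (0 : R) < i.+1%:R^-1 by rewrite invr_gt0.
  by have [k k1 k2] := @unbounded_subexp a _ i0 (fun=> normr_ge0 _) sub unb; exists k.
pose X_ i : M := (a (f i))^-1 *: (A ^+ f i * P).
have X1 i : `|X_ i| = 1.
  have [h _] := hf i; rewrite normrZ ger0_norm ?invr_ge0 ?(ltW h)//.
  by rewrite mulVf// gt_eqF.
have comm k : P * A ^+ k = A ^+ k * P.
  by apply: commrX; rewrite /GRing.comm AP.
have Xsq i : `|X_ i * X_ i| <= i.+1%:R^-1.
  have [h1 h2] := hf i.
  rewrite -scalerAl -scalerAr scalerA mulrA -(mulrA _ P) comm mulrA -exprD.
  rewrite -mulrA PP normrZ normrM ger0_norm ?invr_ge0 ?(ltW h1)//.
  by rewrite -invfM -expr2 [leLHS]mulrC ler_pdivrMr// exprn_gt0.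
have cS : compact [set X : M | `|X| = 1].
  apply: (@mx_bounded_closed_compact _ _ _ _ 1) => [X ->//|].
  apply: (@closed_comp _ _ (fun X : M => `|X|) [set 1 : R]).
    by move=> X _; exact: norm_continuous.
  exact: closed_eq.
have [X [X1' clX]] : [set X : M | `|X| = 1] `&` cluster (X_ @ \oo) !=set0.
  by apply: cS; exists 0%N => // i _ /=.
(* A cluster point lies in every closed set containing a tail of the sequence; all properties of the
   limit [X] are read off in this way. *)
have XF (F : set M) i : closed F -> (forall j, (i <= j)%N -> F (X_ j)) -> F X.
  move=> clF hF; apply: clF; rewrite clusterE in clX; apply: clX.
  by exists i => // j /= ij; exact: hF.
exists X; split.
- by rewrite -normr_gt0 X1'.
- apply/eqP; rewrite -normr_eq0; apply/eqP/le_anti; rewrite normr_ge0 andbT.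
  apply/ler_addgt0Pl => e e0; rewrite addr0.
  pose i := Num.bound e^-1.
  apply: (XF [set Y : M | `|Y * Y| <= e] i).
    apply: (@closed_comp _ _ (fun X : M => `|X * X|) [set x : R | x <= e]).
      move=> Y _; apply: (@continuous_comp _ _ _ (fun Y : M => Y * Y) Num.norm).
        by apply: (@cvg_mulmx _ _ _ _ _ (nbhs Y) _ id id); exact: cvg_id.
      exact: norm_continuous.
    exact: closed_le.
  move=> j ij; apply: le_trans (Xsq j) _; rewrite -[e]invrK lef_pV2 ?posrE ?invr_gt0//.
  have := archi_boundP (ltW (eq_ind_r is_true e0 (invr_gt0 e))); rewrite -/i => h.
  by apply: ltW (lt_le_trans h _); rewrite ler_nat ltnW.
- move=> F clF hF; apply: (XF F 0%N) => // j _; apply: hF.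
  by have [h _] := hf j; rewrite invr_gt0.
Qed.

End PowerGrowth.

(** * Splitting off the generalized eigenspace of the eigenvalue 1 *)

Section FittingDecomposition.
Context {F : fieldType} {n : nat}.
Local Notation M := 'M[F]_n.+1.

(** Bezout for [(X - 1) ^ m.+1] and the cofactor [q] of the power of [X - 1] in the characteristic
    polynomial: [P] projects onto the generalized eigenspace of 1 and [Q] onto its complement. The
    exponent [m.+1] stays positive when 1 is not an eigenvalue. Being polynomials in [B], all three
    matrices commute with whatever commutes with [B]. *)
Lemma fitting1 (B : M) : exists (P Q W : M) (m : nat),
  [/\ P + Q = 1, P * Q = 0, Q = W * (B - 1) ^+ m.+1 & (B - 1) ^+ m.+1 * P = 0] /\
  (forall Z : M, Z * B = B * Z -> [/\ Z * P = P * Z, Z * Q = Q * Z & Z * W = W * Z]).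
Proof.
have [m [q q1 pE]] := multiplicity_XsubC (char_poly B) 1.
have p0 : char_poly B != 0 by rewrite monic_neq0// char_poly_monic.
have cop : coprimep q (('X - 1%:P) ^+ m.+1).
  by rewrite coprimep_expr// coprimep_XsubC; rewrite p0 in q1.
have /Bezout_eq1_coprimepP[[u v] /= uv1] := cop.
have XE : horner_mx B (('X - 1%:P) ^+ m.+1) = (B - 1) ^+ m.+1.
  by rewrite rmorphXn/= rmorphB/= horner_mx_X horner_mx_C.
have hM (p1 p2 : {poly F}) : horner_mx B (p1 * p2) = horner_mx B p1 * horner_mx B p2.
  by rewrite rmorphM.
have pB : horner_mx B (q * ('X - 1%:P) ^+ m.+1) = 0.
  by rewrite exprSr mulrA -pE hM Cayley_Hamilton mul0r.
exists (horner_mx B (u * q)), (horner_mx B (v * ('X - 1%:P) ^+ m.+1)), (horner_mx B v), m.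
split; first split.
- by rewrite -rmorphD uv1 rmorph1.
- by rewrite -hM mulrACA hM pB mulr0.
- by rewrite hM XE.
- by rewrite -XE -hM mulrCA [_ ^+ m.+1 * q]mulrC hM pB mulr0.
- by move=> Z ZB; split; apply: comm_mx_horner.
Qed.

End FittingDecomposition.

Lemma mul_col_row_eq0 (F : fieldType) m n (u : 'cV[F]_m) (l : 'rV[F]_n) :
  u *m l = 0 -> u = 0 \/ l = 0.
Proof.
move=> ul; have [u0|/eqP u0] := pselect (u = 0); [by left|right].
have /cV0Pn[k uk] := u0; apply/rowP => j.
have /matrixP/(_ k j) := ul; rewrite !mxE big_ord1 => /eqP.
by rewrite mulf_eq0 (negPf uk) /= => /eqP.
Qed.

(** Two matrices [h] and [k] are allowed so that [k = 0] covers the closed condition [X * h = 0]. *)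
Lemma commute_closed (R : realType) (n : nat) (h k : 'M[R]_n.+1) :
  closed [set X : 'M[R]_n.+1 | X * h = k * X].
Proof.
have -> : [set X : 'M[R]_n.+1 | X * h = k * X] = [set X | X * h - k * X = 0].
  apply/seteqP; split=> X /= => [->|/eqP]; first by rewrite subrr.
  by rewrite subr_eq0 => /eqP.
apply: (@closed_comp _ _ (fun X : 'M[R]_n.+1 => X * h - k * X) [set 0]); last first.
  exact: (accessible_closed_set1 (hausdorff_accessible (@norm_hausdorff _ _))).
move=> X _; apply: (@continuousB _ _ _ (fun X : 'M[R]_n.+1 => X * h) (fun X => k * X)).
  exact: (@mulmxr_continuous R n.+1 n.+1 n.+1 h X).
exact: (@mulmxl_continuous R n.+1 n.+1 n.+1 k X).
Qed.

(** * Jordan structure of a matrix with unbounded subexponential powers *)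

Section ParabolicStructure.
Context {R : realType} {n : nat}.
Local Notation V := 'cV[R]_n.+1.
Local Notation M := 'M[R]_n.+1.
Context (C : set V) (H : set M) (y : V) (B B' : M).

(** The centralizer of all of [H] is considered, not of [B] alone: a perturbation can be controlled
    uniformly along the boundary only if it commutes with a cocompact group, and this control is
    what the hypothesis [key] expresses. *)
Definition centralizes (X : M) := forall h, H h -> X * h = h * X.

Context (clC : closed C) (cC : convex_cone C) (pC : pointed_cone C) (iy : C° y)
  (HC : forall h, H h -> preserves C h)
  (Hab : forall h, H h -> centralizes h)
  (key : forall X Y, preserves C X -> centralizes X -> X * X = 0 -> X != 0 ->
     centralizes Y -> exists2 e : R, 0 < e & preserves C (1 + X + e *: Y))
  (HB : H B) (HB' : H B') (BB' : B * B' = 1)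
  (subB : forall r : R, 1 < r -> exists c : R, forall k, `|B ^+ k| <= c * r ^+ k)
  (subB' : forall r : R, 1 < r -> exists c : R, forall k, `|B' ^+ k| <= c * r ^+ k)
  (unb : ~ exists c : R, forall k, `|B ^+ k| <= c /\ `|B' ^+ k| <= c).

Lemma centralizesD c X Y :
  centralizes X -> centralizes Y -> centralizes (X + c *: Y).
Proof.
move=> cX cY h Hh.
by rewrite mulrDl mulrDr (cX _ Hh) -scalerAl (cY _ Hh) scalerAr.
Qed.

Lemma centralizesM X Y : centralizes X -> centralizes Y -> centralizes (X * Y).
Proof. by move=> cX cY h Hh; rewrite -mulrA (cY _ Hh) mulrA (cX _ Hh) mulrA. Qed.

Let collinear X Y : preserves C X -> centralizes X -> centralizes Y -> X != 0 ->
  X * X = 0 -> Y * Y = 0 -> X * Y = 0 -> Y * X = 0 -> exists c : R, Y = c *: X.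
Proof. exact: preserves_collinear clC cC pC iy centralizesD key. Qed.

Let B'B : B' * B = 1.
Proof. by rewrite -(Hab HB HB'). Qed.

(** Unboundedness is known only for the powers of [B] and [B'] taken together, so the limit is
    formed with whichever of the two has unbounded powers. *)
Lemma parabolic_square_zero : exists X, [/\ X != 0, X * X = 0, preserves C X &
  forall Z : M, Z * B = B * Z -> Z * X = X * Z].
Proof.
have main (D : M) : preserves C D -> (forall Z, Z * B = B * Z -> Z * D = D * Z) ->
    (forall r : R, 1 < r -> exists c : R, forall k, `|D ^+ k| <= c * r ^+ k) ->
    ~ (exists c : R, forall k, `|D ^+ k| <= c) ->
    exists X, [/\ X != 0, X * X = 0, preserves C X &
      forall Z : M, Z * B = B * Z -> Z * X = X * Z].
  move=> PD cD subD unbD.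
  have [||r r1|[c hc]|X [X0 XX XF]] := @power_limit_sq0 R n D 1.
  - by rewrite mulr1.
  - by rewrite mulr1 mul1r.
  - have [c hc] := subD r r1; exists c => k; rewrite mulr1; exact: hc.
  - by apply: unbD; exists c => k; have := hc k; rewrite mulr1.
  exists X; split=> //.
  - apply: (XF (preserves C)) => [|c k c0]; first exact: preserves_closed.
    by rewrite mulr1; apply: preservesZ => //; [exact: ltW|exact: preservesX].
  - move=> Z ZB.
    apply/esym; apply: (XF [set X | X * Z = Z * X]); first exact: commute_closed.
    move=> c k _ /=; rewrite mulr1 -scalerAr -scalerAl; congr (_ *: _).
    by apply/esym/commrX; exact: cD.
have comB' Z : Z * B = B * Z -> Z * B' = B' * Z.
  move=> ZB; rewrite -[LHS]mul1r -B'B -mulrA (mulrA B) -ZB -(mulrA Z) BB' mulr1.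
  by [].
have [bB|nbB] := pselect (exists c : R, forall k, `|B ^+ k| <= c); last first.
  by apply: (main B) => //; exact: HC.
have [bB'|nbB'] := pselect (exists c : R, forall k, `|B' ^+ k| <= c); last first.
  by apply: (main B') => //; exact: HC.
case: unb; have [c hc] := bB; have [c' hc'] := bB'.
exists (Num.max c c') => k.
by rewrite !le_max hc hc' orbT.
Qed.

(** For [h] in [H], the product [X * h] centralizes [H], squares to zero and annihilates [X] on both
    sides, so it is a multiple of [X]. The same then holds of [X * D * X] for an elementary matrix
    [D], which has rank one. The eigenvalue of [B] on [e] is 1 because it and its inverse are
    nonnegative and at most 1. *)
Lemma parabolic_rank_one : exists (e : V) (l : 'rV[R]_n.+1),
  [/\ e != 0, l != 0, l *m e = 0 & preserves C (e *m l)] /\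
  [/\ forall h, H h -> exists x : R, h *m e = x *: e /\ l *m h = x *: l,
      forall Z : M, Z * B = B * Z -> Z *m (e *m l) = (e *m l) *m Z,
      B *m e = e & l *m B = l].
Proof.
have [X [X0 XX PX cX]] := parabolic_square_zero.
have cenX : centralizes X by move=> h Hh; rewrite -cX// (Hab Hh HB).
have chi h : H h -> exists x : R, X * h = x *: X.
  move=> Hh; apply: collinear => //; first by apply: centralizesM => //; exact: Hab.
  - by rewrite {1}(cenX h Hh) -mulrA (mulrA X X) XX mul0r mulr0.
  - by rewrite mulrA XX mul0r.
  - by rewrite (cenX h Hh) -mulrA XX mulr0.
have [i [j Xij]] : exists i j, X i j != 0.
  apply: contrapT => nX; case/eqP: X0; apply/matrixP => i j; rewrite mxE.
  by apply/eqP; apply: contrapT => /negP h; apply: nX; exists i, j.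
(* With these indices the entry [(i, j)] of [X * D * X] is the square of [X i j], so the multiple of
   [X] found below is not zero. *)
pose D : M := delta_mx j i.
have [c Yc] : exists c : R, X * D * X = c *: X.
  apply: collinear => //.
  - move=> h Hh; have [x hx] := chi _ Hh.
    rewrite -mulrA hx -scalerAr !mulrA -(cenX h Hh) hx.
    by rewrite -!scalerAl.
  - by rewrite !mulrA -(mulrA (X * D)) XX mulr0 !mul0r.
  - by rewrite !mulrA XX !mul0r.
  - by rewrite -mulrA XX mulr0.
have YE : X * D * X = col j X *m row i X.
  by rewrite -!mulmxE colE rowE /D -(mul_delta_mx (0 : 'I_1)) !mulmxA.
have c0 : c != 0.
  have /matrixP/(_ i j) := Yc; rewrite YE !mxE big_ord1 !mxE => h.
  by apply/eqP => c0; move/eqP: h; rewrite c0 mul0r mulf_eq0 (negPf Xij).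
have [e [l XE]] : exists (e : V) (l : 'rV[R]_n.+1), X = e *m l.
  exists (c^-1 *: col j X), (row i X).
  by rewrite -scalemxAl -YE Yc scalerA mulVf// scale1r.
have e0 : e != 0 by apply: contraNneq X0 => e0; rewrite XE e0 mul0mx.
have l0 : l != 0 by apply: contraNneq X0 => l0; rewrite XE l0 mulmx0.
have canl (u : V) : u *m l = 0 -> u = 0.
  by move/mul_col_row_eq0 => [//|/eqP]; rewrite (negPf l0).
have cane (w : 'rV[R]_n.+1) : e *m w = 0 -> w = 0.
  by move/mul_col_row_eq0 => [/eqP|//]; rewrite (negPf e0).
have le0 : l *m e = 0.
  have : ((l *m e) ord0 ord0) *: X = 0.
    rewrite -[RHS]XX -mulmxE {2 3}XE mulmxA -(mulmxA e) [l *m e in RHS]mx11_scalar.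
    by rewrite mul_mx_scalar -scalemxAl -XE.
  move/eqP; rewrite scaler_eq0 (negPf X0) orbF => /eqP a0.
  by rewrite [l *m e]mx11_scalar a0 raddf0.
have chi2 h x : H h -> X * h = x *: X -> h *m e = x *: e /\ l *m h = x *: l.
  move=> Hh hx; split.
    apply/eqP; rewrite -subr_eq0; apply/eqP/canl.
    have hX : h *m X = x *: X := etrans (esym (cenX h Hh)) hx.
    by rewrite mulmxBl -scalemxAl -mulmxA -XE hX subrr.
  apply/eqP; rewrite -subr_eq0; apply/eqP/cane.
  by rewrite mulmxBr -scalemxAr mulmxA -XE [X *m h]hx subrr.
(* [X * D' ^+ k = x ^+ k *: X] makes [x ^+ k] at most a constant times the norm of [D' ^+ k]; a
   value of [x] above 1 is excluded by taking [r] midway between 1 and [x]. *)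
have subexp_le1 (D' : M) (x : R) : X * D' = x *: X -> 0 <= x ->
    (forall r : R, 1 < r -> exists c : R, forall k, `|D' ^+ k| <= c * r ^+ k) -> x <= 1.
  move=> Dx x0 subD; rewrite leNgt; apply/negP => x1.
  pose r := (1 + x) / 2; have r1 : 1 < r by rewrite /r; lra.
  have [d hd] := subD r r1.
  have Xk k : X * D' ^+ k = x ^+ k *: X.
    elim: k => [|k IH]; first by rewrite mulr1 scale1r.
    by rewrite exprS mulrA Dx -scalerAl IH scalerA exprS.
  have bnd k : (x / r) ^+ k <= n.+1%:R * d.
    rewrite expr_div_n ler_pdivrMr ?exprn_gt0 ?(lt_trans ltr01)//.
    have X0' : 0 < `|X| by rewrite normr_gt0.
    rewrite -(ler_pM2r X0') -[x ^+ k]ger0_norm ?exprn_ge0// -normrZ -Xk.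
    apply: le_trans (mulmx_norm_le _ _) _.
    have -> : n.+1%:R * d * r ^+ k * `|X| = n.+1%:R * `|X| * (d * r ^+ k) by ring.
    by rewrite ler_wpM2l// mulr_ge0.
  have d0 : 0 <= x / r - 1.
    by rewrite subr_ge0 ler_pdivlMr ?(lt_trans ltr01)// mul1r /r; lra.
  have d1 : 0 < x / r - 1.
    by rewrite subr_gt0 ltr_pdivlMr ?(lt_trans ltr01)// mul1r /r; lra.
  pose k := Num.bound (n.+1%:R * d / (x / r - 1)).
  have nd0 : 0 <= n.+1%:R * d by apply: le_trans (bnd 0%N); rewrite expr0.
  have := archi_boundP (divr_ge0 nd0 d0); rewrite -/k ltr_pdivrMr// => h.
  have := bernoulli_le k d0; rewrite [1 + (x / r - 1)]addrC subrK => h2.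
  have := le_trans h2 (bnd k); rewrite leNgt => /negP; apply.
  by apply: lt_le_trans h _; rewrite lerDr.
have [b Xb] := chi _ HB; have [b' Xb'] := chi _ HB'.
have bb' : b * b' = 1.
  have : X * (B * B') = (b * b') *: X by rewrite mulrA Xb -scalerAl Xb' scalerA.
  rewrite BB' mulr1 => /eqP; rewrite -subr_eq0 -{1}[X]scale1r -scalerBl.
  by rewrite scaler_eq0 (negPf X0) orbF subr_eq0 => /eqP.
(* Both [X] and [X * D' = x *: X] preserve [C]; were [x] negative, [- X] would preserve it too. *)
have b_ge0 (D' : M) (x : R) : H D' -> X * D' = x *: X -> 0 <= x.
  move=> HD Dx; rewrite leNgt; apply/negP => x0; case/eqP: X0.
  apply: (preserves_pointed pC iy PX).
  have -> : - X = (- x)^-1 *: (x *: X).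
    by rewrite scalerA invrN mulNr mulVf ?lt_eqF// scaleN1r.
  apply: preservesZ => //; first by rewrite invr_ge0 oppr_ge0 ltW.
  by rewrite -Dx; apply: preservesM => //; exact: HC.
have b0 := b_ge0 _ _ HB Xb; have b0' := b_ge0 _ _ HB' Xb'.
have b1 : b = 1.
  have h1 := subexp_le1 _ _ Xb b0 subB; have h2 := subexp_le1 _ _ Xb' b0' subB'.
  by nra.
exists e, l; split; first by split=> //; rewrite -XE.
have [Be lB] := chi2 _ _ HB Xb; rewrite b1 !scale1r in Be lB.
split=> //; last by move=> Z /cX; rewrite -XE.
by move=> h Hh; have [x hx] := chi _ Hh; exists x; exact: chi2.
Qed.

(** If [D ^+ k * Q] were unbounded, a normalized limit [Y] would square to zero, centralize [H] and
    satisfy [Y P = P Y = 0], hence be a multiple of [X], while [X P = X]. [Y] is not claimed to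
    preserve [C]; this is why [collinear] asks it of [X] only. *)
Lemma bounded_complement (P Q X D : M) : P + Q = 1 -> P * Q = 0 ->
  X != 0 -> X * X = 0 -> preserves C X -> centralizes X ->
  X * P = X -> P * X = X ->
  P * D = D * P -> (forall h, H h -> h * D = D * h) ->
  (forall r : R, 1 < r -> exists c : R, forall k, `|D ^+ k| <= c * r ^+ k) ->
  (forall h, H h -> h * Q = Q * h) ->
  exists c : R, forall k, `|D ^+ k * Q| <= c.
Proof.
move=> PQ1 PQ0 X0 XX PX cX XP XP' PD hD subD hQ; apply: contrapT => unbQ.
have QE : Q = 1 - P by rewrite -PQ1 addrAC subrr add0r.
have QP0 : Q * P = 0.
  by rewrite QE mulrBl mul1r; apply/eqP; rewrite subr_eq0 -{1}[P]mulr1 -PQ1 mulrDr PQ0 addr0.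
have QQ : Q * Q = Q by rewrite {2}QE mulrBr mulr1 QP0 subr0.
have DQ : D * Q = Q * D by rewrite QE mulrBr mulrBl mulr1 mul1r PD.
have subQ (r : R) : 1 < r -> exists c : R, forall k, `|D ^+ k * Q| <= c * r ^+ k.
  move=> r1; have [c hc] := subD r r1; exists (n.+1%:R * c * `|Q|) => k.
  apply: le_trans (mulmx_norm_le _ _) _.
  have -> : n.+1%:R * c * `|Q| * r ^+ k = n.+1%:R * (c * r ^+ k) * `|Q| by ring.
  by rewrite ler_wpM2r// ler_wpM2l.
have [Y [Y0 YY YF]] := power_limit_sq0 QQ DQ subQ unbQ.
have YP : Y * P = 0.
  have -> : 0 = 0 * Y :> M by rewrite mul0r.
  apply: (YF [set X | X * P = 0 * X]); first exact: commute_closed.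
  by move=> c k _ /=; rewrite mul0r -scalerAl -mulrA QP0 mulr0 scaler0.
have PY : P * Y = 0.
  rewrite -YP; apply/esym.
  apply: (YF [set X | X * P = P * X]); first exact: commute_closed.
  move=> c k _ /=; rewrite -scalerAl -scalerAr -mulrA QP0 mulr0 mulrA.
  by rewrite (commrX k PD) -mulrA PQ0 mulr0.
have cY : centralizes Y.
  move=> h Hh; apply: (YF [set X | X * h = h * X]); first exact: commute_closed.
  move=> c k _ /=; rewrite -scalerAl -scalerAr -mulrA -hQ//.
  by rewrite (mulrA h) (commrX k (hD _ Hh)) mulrA.
have [c Yc] : exists c : R, Y = c *: X.
  apply: collinear => //.
    by rewrite -XP -mulrA PY mulr0.
  by rewrite -XP' mulrA YP mul0r.
by move: YP; rewrite Yc -scalerAl XP -Yc => /eqP; exact/negP.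
Qed.

(** [N = (B - 1) P] is the nilpotent part at the eigenvalue 1. The relations say that it has a
    single nontrivial Jordan block, of size three, as for a parabolic isometry. The clause on
    matrices commuting with [B] serves to pass later to a matrix of which [B] is a power. *)
Theorem parabolic_structure :
  exists (P Q N : M) (e g : V) (l w : 'rV[R]_n.+1) (c : R),
  [/\ P + Q = 1, P * Q = 0, B * P = P + N & N * P = N] /\
  [/\ N = g *m l + e *m w, N * N = e *m l, e != 0 & l != 0] /\
  [/\ N *m e = 0, l *m N = 0, P *m e = e & l *m P = l] /\
  [/\ forall Z : M, Z * B = B * Z -> [/\ Z * P = P * Z, Z * Q = Q * Z & Z * N = N * Z],
      forall k, `|B ^+ k * Q| <= c & forall k, `|B' ^+ k * Q| <= c].
Proof.
have [e [l [[e0 l0 le0 PX] [hel cX Be lB]]]] := parabolic_rank_one.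
pose X : M := e *m l.
have canl (u : V) : u *m l = 0 -> u = 0.
  by move/mul_col_row_eq0 => [//|/eqP]; rewrite (negPf l0).
have cane (u : 'rV[R]_n.+1) : e *m u = 0 -> u = 0.
  by move/mul_col_row_eq0 => [/eqP|//]; rewrite (negPf e0).
have X0 : X != 0 by apply: contraNneq e0 => /canl ->.
have XX : X * X = 0.
  by rewrite -mulmxE /X mulmxA -(mulmxA e) le0 mulmx0 mul0mx.
have {}cX (Z : M) : Z * B = B * Z -> Z * X = X * Z by exact: cX.
have cenB h : H h -> h * B = B * h by move=> Hh; exact: (Hab Hh HB).
have cenX : centralizes X by move=> h Hh; rewrite -cX// cenB.
have XB : X * B = X by rewrite -mulmxE -mulmxA lB.
have BX : B * X = X by rewrite -mulmxE mulmxA Be.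
have [P [Q [W [m [[PQ1 PQ0 QE BP0] comm]]]]] := fitting1 B.
have [BP BQ BW] := comm B erefl.
have PB1 : P * (B - 1) = (B - 1) * P by rewrite mulrBr mulrBl BP mulr1 mul1r.
have B1X : (B - 1) * X = 0 by rewrite mulrBl BX mul1r subrr.
have XB1 : X * (B - 1) = 0 by rewrite mulrBr XB mulr1 subrr.
have QX : Q * X = 0 by rewrite QE exprSr -!mulrA B1X !mulr0.
have XQ : X * Q = 0.
  have -> : X * Q = Q * X by have [_ -> _] := comm X (etrans XB (esym BX)).
  exact: QX.
have XP : X * P = X by rewrite -[RHS]mulr1 -PQ1 mulrDr XQ addr0.
have PX' : P * X = X by rewrite -[RHS]mul1r -PQ1 mulrDl QX addr0.
have QP0 : Q * P = 0 by have [_ <- _] := comm P (esym BP).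
have PP : P * P = P by rewrite -[RHS]mulr1 -PQ1 mulrDr PQ0 addr0.
have PB' : P * B' = B' * P.
  rewrite -[LHS]mul1r -B'B -mulrA (mulrA B) BP -!mulrA (_ : B * B' = 1) ?mulr1//.
have hQ h : H h -> h * Q = Q * h by move=> /cenB /comm[].
have [c1 hc1] := bounded_complement PQ1 PQ0 X0 XX PX cenX XP PX' (esym BP) cenB subB hQ.
have cenB' h : H h -> h * B' = B' * h by move=> Hh; exact: (Hab Hh HB').
have [c2 hc2] := bounded_complement PQ1 PQ0 X0 XX PX cenX XP PX' PB' cenB' subB' hQ.
have [N NdefE] : exists N : M, N = (B - 1) * P by exists ((B - 1) * P).
have NE : B * P = P + N by rewrite NdefE mulrBl mul1r addrC subrK.
have NP : N * P = N by rewrite NdefE -mulrA PP.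
have PN : P * N = N by rewrite NdefE mulrA PB1 -mulrA PP.
have commN (Z : M) : Z * B = B * Z -> Z * N = N * Z.
  move=> ZB; have [ZP _ _] := comm Z ZB.
  have ZB1 : Z * (B - 1) = (B - 1) * Z by rewrite mulrBr mulrBl mulr1 mul1r ZB.
  by rewrite NdefE mulrA ZB1 -!mulrA ZP.
have NX : N * X = 0 by rewrite NdefE -PB1 -mulrA B1X mulr0.
have XN : X * N = 0 by rewrite NdefE mulrA XB1 mul0r.
have cenN k : centralizes (N ^+ k).
  by move=> h Hh; apply/esym/commrX; apply: commN; exact: cenB.
have Nk k : N ^+ k.+1 = (B - 1) ^+ k.+1 * P.
  elim: k => [|k IH]; first by rewrite !expr1.
  by rewrite exprS IH NdefE -mulrA (mulrA P) (commrX k.+1 PB1) -mulrA PP mulrA -exprS.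
(* Otherwise [B] and [B'] are the identity on the image of [P], and their powers are bounded there
   as well as on the image of [Q]. *)
have N0 : N != 0.
  apply/eqP => N0; apply: unb; exists (`|P| + Num.max c1 c2) => k.
  have split_ (D : M) (c : R) : D * P = P -> (forall k, `|D ^+ k * Q| <= c) ->
      c <= Num.max c1 c2 -> `|D ^+ k| <= `|P| + Num.max c1 c2.
    move=> DP hD cc; have -> : D ^+ k = P + D ^+ k * Q.
      rewrite -[LHS]mulr1 -PQ1 mulrDr; congr (_ + _).
      by elim: k => [|k IH]; [rewrite mul1r|rewrite exprSr -mulrA DP IH].
    by apply: le_trans (ler_normD _ _) _; rewrite lerD2l; exact: le_trans cc.
  split; apply: split_.
  - by rewrite NE N0 addr0.
  - exact: hc1.
  - by rewrite le_max lexx.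
  - by rewrite -[LHS]addr0 -(mulr0 B') -N0 -mulrDr -NE mulrA B'B mul1r.
  - exact: hc2.
  - by rewrite le_max lexx orbT.
have exN : exists s, N ^+ s == 0 by exists m.+1; rewrite Nk BP0.
have [s /eqP Ns smin] := ex_minnP exN.
have {smin} Nlt k : (k < s)%N -> N ^+ k != 0.
  by rewrite ltnNge; apply: contra => /smin.
case: s Ns Nlt => [/eqP|[|r]]; first by rewrite expr0 oner_eq0.
  by rewrite expr1 => N0'; rewrite N0' eqxx in N0.
move=> Nr Nlt.
have Nab a b : (r.+2 <= a + b)%N -> N ^+ a * N ^+ b = 0.
  by move=> h; rewrite -exprD -(subnK h) exprD Nr mulr0.
have [c Nc] : exists c : R, N ^+ r.+1 = c *: X.
  apply: (collinear PX cenX (cenN r.+1) X0 XX).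
  - by apply: Nab; lia.
  - by rewrite exprS mulrA XN mul0r.
  - by rewrite exprSr -mulrA NX mulr0.
have c0 : c != 0.
  have := Nlt r.+1 (leqnn _); rewrite Nc; apply: contraNneq => ->.
  by rewrite scale0r.
(* The nilpotency index of [N] is [r.+2]; it has to be 3. *)
have r1 : r = 1%N.
  case: r Nr Nlt Nab Nc => [|[//|r]] Nr Nlt Nab Nc.
  - rewrite expr1 in Nc.
    (* Index 2: then [D ^+ k = P + D ^+ k * Q + (k%:R * s) *: X], so [D ^+ k] divided by [k] tends
       to [s *: X]. Applied to [B] and to [B'], this gives opposite values of [s]. *)
    have key2 (D : M) (s d : R) : preserves C D -> D * X = X -> D * P = P + s *: X ->
        (forall k, `|D ^+ k * Q| <= d) -> preserves C (s *: X).
      move=> PD DX DP hd.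
      have DkP k : D ^+ k * P = P + (k%:R * s) *: X.
        elim: k => [|k IH]; first by rewrite expr0 mul1r mul0r scale0r addr0.
        rewrite exprS -mulrA IH mulrDr DP -scalerAr DX -addrA -scalerDl.
        by rewrite -[k.+1]add1n natrD mulrDl mul1r.
      have d0 : 0 <= `|P| + d by rewrite addr_ge0// (le_trans _ (hd 0%N)).
      apply: (@closed_approx _ _ (preserves C)); first exact: preserves_closed.
      move=> eps eps0; pose k := Num.bound ((`|P| + d) / eps).
      exists (k.+1%:R^-1 *: D ^+ k.+1).
        by apply: preservesZ => //; exact: preservesX.
      have -> : D ^+ k.+1 = P + D ^+ k.+1 * Q + (k.+1%:R * s) *: X.
        by rewrite -[LHS]mulr1 -PQ1 mulrDr DkP addrAC.
      rewrite scalerDr scalerA mulrA mulVf ?pnatr_eq0// mul1r opprD addrCA subrr addr0.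
      rewrite normrN normrZ ger0_norm// mulrC ler_pdivrMr//.
      apply: le_trans (ler_normD _ _) _; apply: (@le_trans _ _ (`|P| + d)).
        by rewrite lerD2l.
      rewrite -ler_pdivrMl// mulrC; apply: ltW; apply: lt_le_trans (archi_boundP _) _.
        by rewrite divr_ge0// ltW.
      by rewrite ler_nat.
    have PcX : preserves C (c *: X) by apply: key2 hc1 => //; [exact: HC|rewrite NE Nc].
    have B'X : B' * X = X by rewrite -[X in B' * X]BX mulrA B'B mul1r.
    have PNcX : preserves C (- c *: X).
      apply: key2 hc2 => //; first exact: HC.
      apply/eqP; rewrite scaleNr eq_sym subr_eq; apply/eqP.
      by rewrite -[LHS]mul1r -B'B -mulrA NE Nc mulrDr -scalerAr B'X.
    have /eqP : c *: X = 0.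
      by apply: (preserves_pointed pC iy PcX); rewrite -scaleNr.
    by rewrite scaler_eq0 (negPf c0) (negPf X0).
  (* Index at least 4: the last power but one also squares to zero, so it is a multiple of [X], and
     a further factor [N] kills it too early. *)
  - have [d Nd] : exists d : R, N ^+ r.+2 = d *: X.
      apply: (collinear PX cenX (cenN r.+2) X0 XX).
      + by apply: Nab; lia.
      + by rewrite exprS mulrA XN mul0r.
      + by rewrite exprSr -mulrA NX mulr0.
    by have := Nlt r.+3 (leqnn _); rewrite exprS Nd -scalerAr NX scaler0 eqxx.
subst r; have NN : N * N = e *m (c *: l) by rewrite -scalemxAr -Nc expr2.
have Ne : N *m e = 0 by apply: canl; rewrite -mulmxA; exact: NX.
(* As [h] acts on [e] and on [l] by one scalar [x], the matrix [(h - x) N] squares to zero and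
   annihilates [X] on both sides. *)
have hN h : H h -> exists2 x : R, h *m e = x *: e /\ l *m h = x *: l &
    exists d : R, h * N = x *: N + d *: X.
  move=> Hh; have [x [hx1 hx2]] := hel h Hh; exists x => //.
  have cY : centralizes ((h + (- x) *: 1) * N).
    apply: centralizesM; last by have := cenN 1%N; rewrite expr1.
    apply: centralizesD; first exact: Hab.
    by move=> h' _; rewrite mulr1 mul1r.
  have hX : (h + (- x) *: 1) * X = 0.
    rewrite mulrDl -scalerAl mul1r -mulmxE mulmxA hx1 -scalemxAl -scalerDl.
    by rewrite subrr scale0r.
  have Xh : X * (h + (- x) *: 1) = 0.
    rewrite mulrDr -scalerAr mulr1 -mulmxE -mulmxA hx2 -scalemxAr -scalerDl.
    by rewrite subrr scale0r.
  have Nh : N * (h + (- x) *: 1) = (h + (- x) *: 1) * N.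
    rewrite mulrDr mulrDl -scalerAr -scalerAl mulr1 mul1r.
    by rewrite commN ?cenB.
  have [|||d hd] := collinear PX cenX cY X0 XX.
  - rewrite -mulrA (mulrA N) Nh -mulrA -expr2 Nc -!scalerAr hX.
    by rewrite mulr0 scaler0.
  - by rewrite mulrA Xh mul0r.
  - by rewrite -mulrA NX mulr0.
  exists d; rewrite -hd mulrDl -scalerAl mul1r scaleNr addrC subrK.
  by [].
(* Source of the rank bound: row vectors killing [e] form a hyperplane, which [N] maps into the line
   of [l]. By [hN], the matrix [e u N] centralizes [H], the error term [d *: X] being killed by
   [u]. *)
have rowN (u : 'rV[R]_n.+1) : u *m e = 0 -> exists d : R, u *m N = d *: l.
  move=> ue; pose Y : M := e *m (u *m N).
  have cY : centralizes Y.
    move=> h Hh; have [x [hx1 hx2] [d hNd]] := hN h Hh.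
    rewrite -mulmxE /Y -!mulmxA [N *m h](_ : _ = h * N); last first.
      by apply/esym/commN; exact: cenB.
    have uX : u *m X = 0 by rewrite mulmxA ue mul0mx.
    rewrite hNd mulmxDr -!scalemxAr uX scaler0 addr0 -scalemxAr (mulmxA h) hx1.
    by rewrite -scalemxAl.
  have [|||d hd] := collinear PX cenX cY X0 XX.
  - by rewrite -mulmxE /Y -!mulmxA (mulmxA N) Ne !(mul0mx, mulmx0).
  - by rewrite -mulmxE /Y -!mulmxA (mulmxA l) le0 !(mul0mx, mulmx0).
  - by rewrite -mulmxE /Y -!mulmxA (mulmxA N) Ne !(mul0mx, mulmx0).
  exists d; apply/eqP; rewrite -subr_eq0; apply/eqP/cane.
  by rewrite mulmxBr -/Y hd -scalemxAr subrr.
have [i ei] : exists i, e i ord0 != 0 by have /cV0Pn := e0.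
pose u : 'rV[R]_n.+1 := (e i ord0)^-1 *: delta_mx ord0 i.
have ue : u *m e = 1%:M.
  rewrite [LHS]mx11_scalar -scalemxAl -rowE !mxE mulVf//.
pose T : M := 1 - e *m u.
have Te : T *m e = 0 by rewrite mulmxBl mul1mx -mulmxA ue mulmx1 subrr.
have [f hf] : {f : 'I_n.+1 -> R & forall k, row k T *m N = f k *: l}.
  apply: (@choice _ _ (fun k d => row k T *m N = d *: l)) => k.
  by apply: rowN; rewrite -row_mul Te row0.
(* Here [u e = 1] and [N = (1 - e u) N + e (u N)]. The factor [c] in [N ^+ 2 = c *: X] is absorbed
   into [l] and compensated in [g]. *)
exists P, Q, N, e, (c^-1 *: \col_k f k), (c *: l), (u *m N), (Num.max c1 c2).
split; first by split.
have XcN : l *m N = 0 by apply: cane; rewrite mulmxA; exact: XN.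
split; first split=> //.
- have -> : c^-1 *: \col_k f k *m (c *: l) = T *m N.
    rewrite -scalemxAl -scalemxAr scalerA mulVf// scale1r.
    apply/row_matrixP => k; rewrite !row_mul hf; apply/rowP => j.
    by rewrite !mxE big_ord1 !mxE.
  by rewrite mulmxBl mul1mx mulmxA subrK.
- by rewrite scaler_eq0 (negPf c0).
split; first split=> //.
- by rewrite -scalemxAl XcN scaler0.
- apply/eqP; rewrite -subr_eq0; apply/eqP/canl.
  by rewrite mulmxBl -mulmxA [P *m _]PX' subrr.
- rewrite -scalemxAl; congr (_ *: _); apply/eqP; rewrite -subr_eq0; apply/eqP/cane.
  by rewrite mulmxBr mulmxA [_ *m P]XP subrr.
split=> [Z ZB|k|k]; last 2 first.
- by rewrite le_max hc1.
- by rewrite le_max hc2 orbT.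
by have [ZP ZQ _] := comm Z ZB; split=> //; exact: commN.
Qed.

End ParabolicStructure.

(** * Lorentzian forms and parabolics *)

Section Lorentz.
Context {R : realType}.

Definition qform m (S : 'M[R]_m) (u v : 'cV[R]_m) : R := (u^T *m S *m v) ord0 ord0.

Lemma qformE m (S T : 'M[R]_m) u v : qform S (T *m u) (T *m v) = qform (T^T *m S *m T) u v.
Proof. by rewrite /qform trmx_mul !mulmxA. Qed.

Lemma qformD m (S T : 'M[R]_m) u v : qform (S + T) u v = qform S u v + qform T u v.
Proof. by rewrite /qform mulmxDr mulmxDl mxE. Qed.

Lemma qform_sum m I (r : seq I) (S : I -> 'M[R]_m) u v :
  qform (\sum_(i <- r) S i) u v = \sum_(i <- r) qform (S i) u v.
Proof. by rewrite /qform mulmx_sumr mulmx_suml summxE. Qed.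

Lemma qform_Zl m (S : 'M[R]_m) (a : R) u v : qform S (a *: u) v = a * qform S u v.
Proof. by rewrite /qform linearZ/= -!scalemxAl mxE. Qed.

Lemma qform_Zr m (S : 'M[R]_m) (a : R) u v : qform S u (a *: v) = a * qform S u v.
Proof. by rewrite /qform -scalemxAr mxE. Qed.

Lemma qform_Dl m (S : 'M[R]_m) u u' v : qform S (u + u') v = qform S u v + qform S u' v.
Proof. by rewrite /qform linearD/= !mulmxDl mxE. Qed.

Lemma qform_Dr m (S : 'M[R]_m) u v v' : qform S u (v + v') = qform S u v + qform S u v'.
Proof. by rewrite /qform mulmxDr mxE. Qed.

Lemma qform_tr m (S : 'M[R]_m) u v : qform S^T u v = qform S v u.
Proof.
by rewrite /qform -[u^T *m _ *m v]trmxK mxE !trmx_mul !trmxK mulmxA.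
Qed.

Lemma qform_Z m (S : 'M[R]_m) (a : R) u v : qform (a *: S) u v = a * qform S u v.
Proof. by rewrite /qform -scalemxAr -scalemxAl mxE. Qed.

Lemma qformN m (S : 'M[R]_m) u v : qform (- S) u v = - qform S u v.
Proof. by rewrite /qform mulmxN mulNmx mxE. Qed.

Lemma qform_outer m (a b : 'rV[R]_m) u v :
  qform (a^T *m b) u v = (a *m u) ord0 ord0 * (b *m v) ord0 ord0.
Proof. by rewrite /qform mulmxA -(mulmxA _ b) -trmx_mul mxE big_ord1 mxE. Qed.

Lemma qform_inj m (S T : 'M[R]_m) : (forall u v, qform S u v = qform T u v) -> S = T.
Proof.
move=> h; apply/matrixP => i j; have := h (delta_mx i ord0) (delta_mx j ord0).
by rewrite /qform !trmx_delta -!rowE -!colE !mxE.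
Qed.

Lemma qform1 m (u : 'cV[R]_m) : qform 1%:M u u = \sum_i u i ord0 ^+ 2.
Proof. by rewrite /qform mulmx1 mxE; apply: eq_bigr => i _; rewrite mxE expr2. Qed.

Lemma qform1_ge0 m (u : 'cV[R]_m) : 0 <= qform 1%:M u u.
Proof. by rewrite qform1 sumr_ge0// => i _; rewrite sqr_ge0. Qed.

Lemma qform1_norm m (u : 'cV[R]_m) : `|u| ^+ 2 <= qform 1%:M u u.
Proof.
have s0 := qform1_ge0 u.
rewrite -(sqr_sqrtr s0) lerXn2r ?nnegrE ?sqrtr_ge0//.
apply: mx_norm_le => [|i j]; first exact: sqrtr_ge0.
rewrite ord1 -sqrtr_sqr ler_wsqrtr// qform1 (bigD1 i)//= lerDl.
by apply: sumr_ge0 => k _; rewrite sqr_ge0.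
Qed.

Lemma qform1_eq0 m (u : 'cV[R]_m) : qform 1%:M u u = 0 -> u = 0.
Proof.
move=> h; apply/eqP; rewrite -normr_eq0 -sqrf_eq0; apply/eqP/le_anti.
by rewrite sqr_ge0 andbT -{1}h qform1_norm.
Qed.

(* Cholesky *)
Lemma posdef_congruent1 m (S : 'M[R]_m) : S^T = S ->
  (forall u, u != 0 -> 0 < qform S u u) ->
  exists2 T, T \in unitmx & T^T *m S *m T = 1%:M.
Proof.
elim: m S => [|m IH] S symS pdS.
  exists 1%:M; first exact: unitmx1.
  by apply/matrixP => -[].
move: S symS pdS; rewrite -[m.+1]/(1 + m)%N => S symS pdS.
pose a := S ord0 ord0; pose b : 'rV[R]_m := ursubmx S; pose D : 'M[R]_m := drsubmx S.
have SE : S = block_mx a%:M b b^T D.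
  rewrite -[LHS]submxK /b /D; congr block_mx.
    apply/matrixP => i j; rewrite !ord1 !mxE/= mulr1n /a.
    by congr (S _ _); apply/val_inj.
  by rewrite -[in LHS]symS -trmx_ursub.
have a0 : 0 < a.
  have := pdS (delta_mx ord0 ord0); rewrite /qform trmx_delta -rowE -colE !mxE; apply.
  by apply/eqP => /matrixP/(_ ord0 ord0)/eqP; rewrite !mxE !eqxx oner_eq0.
pose s := Num.sqrt a; have s0 : 0 < s by rewrite sqrtr_gt0.
have ss : s * s = a by rewrite -expr2 sqr_sqrtr// ltW.
(* One step of elimination; [S1] is the Schur complement of the corner entry [a]. *)
pose T1 : 'M[R]_(1 + m) := block_mx (s^-1)%:M (- a^-1 *: b) 0 1%:M.
pose S1 := D - a^-1 *: (b^T *m b).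
have uT1 : T1 \in unitmx.
  by rewrite unitmxE det_ublock !det_scalar1 det1 mulr1 unitfE invr_eq0 gt_eqF.
have T1S : T1^T *m S *m T1 = block_mx 1%:M 0 0 S1.
  rewrite SE /T1 tr_block_mx -mulmxA !mulmx_block.
  rewrite !(tr_scalar_mx, trmx0, mulmx0, mul0mx, mul1mx, mulmx1, addr0, add0r).
  rewrite !linearZ/= -!scalar_mxM !mul_scalar_mx -!scalemxAl.
  have an0 : a != 0 by rewrite gt_eqF.
  have -> : - a^-1 *: (a *: b) + b = 0.
    by rewrite scalerA mulNr mulVf// scaleN1r addNr.
  rewrite !(mulmx0, scaler0, add0r) mul_mx_scalar scalerA mul_mx_scalar -scalerDl.
  have -> : s^-1 * (a / s) = 1 by rewrite -ss; field; rewrite gt_eqF.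
  have -> : - a^-1 * (a / s) + s^-1 = 0.
    by rewrite mulrA mulNr mulVf// mulN1r addNr.
  by rewrite scale0r scaleNr addrC.
have symS1 : S1^T = S1.
  rewrite /S1 linearB/= linearZ/= trmx_mul trmxK; congr (_ - _).
  by rewrite /D -[in RHS]symS trmx_drsub.
have [|T2 uT2 T2S] := IH S1 symS1.
  move=> v v0; pose u : 'cV[R]_(1 + m) := col_mx 0 v.
  have -> : qform S1 v v = qform S (T1 *m u) (T1 *m u).
    rewrite qformE T1S /qform /u tr_col_mx mul_row_block mul_row_col.
    by rewrite !(mulmx0, mul0mx, add0r).
  apply: pdS; apply: contra v0 => /eqP Tu0.
  have : u = 0 by rewrite -(mulKmx uT1 u) Tu0 mulmx0.
  by rewrite /u -[0 in RHS]vsubmxK => /eq_col_mx[_ ->]; rewrite linear0.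
exists (T1 *m block_mx 1%:M 0 0 T2).
  by rewrite unitmx_mul uT1 unitmxE det_ublock det1 mul1r -unitmxE.
rewrite trmx_mul -!mulmxA (mulmxA T1^T) (mulmxA (T1^T *m S)) T1S.
rewrite tr_block_mx !mulmx_block !trmx0 trmx1 !mulmx0 !mul0mx !mul1mx !addr0 !add0r.
by rewrite mulmxA T2S mulmx0 -scalar_mx_block.
Qed.

(** The Householder reflection along [u = z - b]. Since the squared length of [u] is [2 * (1 - t)],
    the usual factor 2 over that length becomes [(1 - t)^-1]. *)
Lemma reflection_to_basis n (z : 'cV[R]_n) (i : 'I_n) : z^T *m z = 1%:M ->
  exists O : 'M[R]_n, O^T *m O = 1%:M /\ O^T *m z = delta_mx i ord0.
Proof.
move=> zz; pose b : 'cV[R]_n := delta_mx i ord0.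
have bb : b^T *m b = 1%:M.
  by rewrite /b trmx_delta -rowE; apply/matrixP => x y; rewrite !mxE !ord1 eqxx.
have [zb|zb] := eqVneq z b.
  by exists 1%:M; rewrite trmx1 !mul1mx zb.
pose u := z - b; pose t : R := (b^T *m z) ord0 ord0.
have bz : b^T *m z = t%:M by rewrite [LHS]mx11_scalar.
have zb' : z^T *m b = t%:M by rewrite -[LHS]trmxK trmx_mul trmxK bz tr_scalar_mx.
have uz : u^T *m z = (1 - t)%:M.
  by rewrite /u linearB/= mulmxBl zz bz raddfB.
have uu : u^T *m u = (2 * (1 - t))%:M.
  rewrite {2}/u mulmxBr uz /u linearB/= mulmxBl zb' bb -!raddfB/=.
  by congr (_%:M); ring.
have t1 : 1 - t != 0.
  apply/eqP => t1; move: uu; rewrite t1 mulr0 => uu0.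
  have /eqP : u = 0 by apply: qform1_eq0; rewrite /qform mulmx1 uu0 mxE.
  by rewrite /u subr_eq0 (negPf zb).
pose O : 'M[R]_n := 1%:M - (1 - t)^-1 *: (u *m u^T).
have OT : O^T = O by rewrite /O linearB/= linearZ/= trmx_mul trmxK trmx1.
have Oz : O *m z = b.
  rewrite /O mulmxBl mul1mx -scalemxAl -mulmxA uz mul_mx_scalar scalerA mulVf//.
  by rewrite scale1r /u opprB addrCA subrr addr0.
exists O; rewrite OT; split=> //.
have Ou : O *m u = - u.
  rewrite /O mulmxBl mul1mx -scalemxAl -mulmxA uu mul_mx_scalar scalerA mulrCA mulVf//.
  by rewrite mulr1 scaler_nat mulr2n opprD addrA subrr add0r.
rewrite {2}/O mulmxBr mulmx1 -scalemxAr mulmxA Ou mulNmx scalerN opprK.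
by rewrite /O subrK.
Qed.

(** [ker l] is the orthogonal complement of the isotropic vector [e], and the form is positive on it
    modulo [e]; this forces signature (n, 1). Reversing the sign along a vector [d] of square -1
    gives a positive definite form [S']. Cholesky makes [S'] standard, and a reflection then moves
    the image of [d] to the last axis. *)
Lemma lorentzian_congruent n (S : 'M[R]_n.+1) (e : 'cV[R]_n.+1) (l : 'rV[R]_n.+1) (c : R) :
  S^T = S -> 0 < c -> e != 0 -> l != 0 -> l *m e = 0 -> e^T *m S = - c *: l ->
  (forall v, l *m v = 0 -> 0 <= qform S v v) ->
  (forall v, l *m v = 0 -> qform S v v = 0 -> exists x : R, v = x *: e) ->
  exists2 T, T \in unitmx & T^T *m S *m T = lorentz.
Proof.
move=> symS c0 e0 l0 le0 eS pos pos0.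
have Se : S *m e = - c *: l^T by rewrite -linearZ/= -eS trmx_mul trmxK symS.
have qev v : qform S e v = - c * (l *m v) ord0 ord0.
  by rewrite /qform eS -scalemxAl mxE.
have qve v : qform S v e = - c * (l *m v) ord0 ord0 by rewrite -qform_tr symS qev.
have qee : qform S e e = 0 by rewrite qev le0 mxE mulr0.
have [f lf] : exists f : 'cV[R]_n.+1, l *m f = 1%:M.
  have /rV0Pn[i li] := l0; exists ((l ord0 i)^-1 *: delta_mx i ord0).
  by rewrite [LHS]mx11_scalar -scalemxAr -colE !mxE mulVf.
(* The square of [f + t *: e] is [qform S f f - 2 * c * t]; this [t] makes it -1. *)
pose t := (qform S f f + 1) / (2 * c).
have [d dE] : exists d, d = f + t *: e by exists (f + t *: e).
have dd : qform S d d = -1.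
  rewrite dE !(qform_Dl, qform_Dr, qform_Zl, qform_Zr) qee qev qve lf mxE mulr1n mulr1.
  by rewrite /t; field; rewrite gt_eqF.
have ld : l *m d = 1%:M by rewrite dE mulmxDr lf -scalemxAr le0 scaler0 addr0.
pose S' := S + 2 *: (S *m d *m (S *m d)^T).
have qS' v : qform S' v v = qform S v v + 2 * qform S d v ^+ 2.
  rewrite qformD qform_Z -[X in X *m _^T]trmxK qform_outer trmx_mul symS.
  by rewrite -expr2.
have pd v : v != 0 -> 0 < qform S' v v.
  move=> v0; pose a := (l *m v) ord0 ord0.
  pose k := v - a *: d.
  have lk : l *m k = 0.
    by rewrite mulmxBr -scalemxAr ld [l *m v]mx11_scalar scalemx1 subrr.
  have vE : v = a *: d + k by rewrite /k addrC subrK.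
  have qk := pos k lk.
  have qkE : qform S k k = qform S v v - 2 * a * qform S d v - a ^+ 2.
    rewrite /k !(qform_Dl, qform_Dr) -scaleNr !(qform_Zl, qform_Zr) dd.
    have -> : qform S v d = qform S d v by rewrite -qform_tr symS.
    by ring.
  rewrite qS' ltNge; apply/negP => le_0.
  (* With [b = qform S d v], nonnegativity on [k] gives [qform S v v >= a ^+ 2 + 2 * a * b], so that
     [qform S' v v] is at least [(a + b) ^+ 2 + b ^+ 2]. *)
  have [a0 b0 k0] : [/\ a = 0, qform S d v = 0 & qform S k k = 0].
    have := sqr_ge0 (a + qform S d v); have := sqr_ge0 (qform S d v) => h1 h2.
    have b0 : qform S d v ^+ 2 = 0 by apply/le_anti; rewrite h1 andbT; nra.
    have a0 : (a + qform S d v) ^+ 2 = 0 by apply/le_anti; rewrite h2 andbT; nra.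
    have {}b0 : qform S d v = 0 by apply/eqP; rewrite -sqrf_eq0 b0.
    have {}a0 : a = 0 by move/eqP: a0; rewrite sqrf_eq0 b0 addr0 => /eqP.
    by split=> //; apply/le_anti; rewrite qk andbT; move: le_0; rewrite qkE a0 b0; nra.
  have [x kx] := pos0 k lk k0.
  move: b0; rewrite vE a0 scale0r add0r kx qform_Zr qve ld mxE mulr1 mulrN => /eqP.
  rewrite oppr_eq0 mulf_eq0 [c == 0]gt_eqF// orbF => /eqP x0.
  by case/eqP: v0; rewrite vE a0 kx x0 !scale0r addr0.
have symS' : S'^T = S'.
  by rewrite /S' linearD/= linearZ/= trmx_mul trmxK symS.
have [T uT TS'] := posdef_congruent1 symS' pd.
pose z := T^T *m (S *m d).
have S'd : S' *m d = - (S *m d).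
  rewrite mulmxDl -scalemxAl -mulmxA [_^T *m d](_ : _ = (-1)%:M).
    by rewrite mul_mx_scalar scalerA mulrN1 scaleNr scaler_nat mulr2n opprD addrA subrr add0r.
  by rewrite [LHS]mx11_scalar trmx_mul symS -dd.
have TTS' : T *m T^T *m S' = 1%:M.
  apply: (can_inj (mulmxK uT)); rewrite mul1mx -!mulmxA [_ *m (S' *m T)]mulmxA TS' mulmx1.
  by [].
have Tz : T *m z = - d.
  by rewrite /z mulmxA -[S *m d]opprK -S'd mulmxN mulmxA TTS' mul1mx.
have zTz : z^T *m z = 1%:M.
  rewrite {1}/z !trmx_mul trmxK symS -!mulmxA Tz !mulmxN mulmxA [LHS]mx11_scalar.
  by rewrite mxE -/(qform S d d) dd opprK.
have [U [UU Uz]] := reflection_to_basis ord_max zTz.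
have zU : z^T *m U = delta_mx ord0 ord_max.
  by rewrite -[LHS]trmxK trmx_mul trmxK Uz trmx_delta.
have [_ uU] := mulmx1_unit UU.
exists (T *m U); first by rewrite unitmx_mul uT.
have -> : S = S' - 2 *: (S *m d *m (S *m d)^T) by rewrite addrK.
rewrite trmx_mul mulmxBr mulmxBl.
have -> : U^T *m T^T *m S' *m (T *m U) = 1%:M.
  by rewrite !mulmxA -(mulmxA _ T^T) -(mulmxA _ (T^T *m S')) TS' mulmx1.
rewrite -scalemxAr -scalemxAl.
have -> : U^T *m T^T *m (S *m d *m (S *m d)^T) *m (T *m U) = delta_mx ord_max ord_max.
  have -> : U^T *m T^T *m (S *m d *m (S *m d)^T) *m (T *m U) = (U^T *m z) *m (z^T *m U).
    by rewrite /z [(T^T *m _)^T]trmx_mul trmxK !mulmxA.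
  by rewrite Uz zU mul_delta_mx.
apply/matrixP => i j; rewrite !mxE; case: (i =P j) => [->|ij] /=.
  by case: (j =P ord_max) => _ /=; rewrite ?mulr1n ?mulr1 ?mulr0 ?subr0//; ring.
rewrite mulr0n; case: (i =P ord_max) => [iE|_] /=; last by rewrite mulr0 subr0.
case: (j =P ord_max) => [jE|_] /=; last by rewrite mulr0 subr0.
by case: ij; rewrite iE jE.
Qed.

End Lorentz.

(** * Invariant form on the part with bounded powers *)

Section InvariantForm.
Context {R : realType} {n : nat}.
Local Notation V := 'cV[R]_n.+1.
Local Notation M := 'M[R]_n.+1.

(** A cluster point of the averages of the forms [v -> |B ^+ k Q v|^2]. Invariance comes from
    telescoping, with an error of order 1 / m. Definiteness on the image of [Q] survives in the
    limit because [Q v = (B' ^+ k Q) (B ^+ k Q v)] bounds every term below uniformly; the [+ 1] in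
    the constant keeps the denominator positive if [c = 0]. *)
Lemma bounded_invariant_form (B B' Q : M) (c : R) :
  B' * B = 1 -> Q * B = B * Q -> Q * B' = B' * Q -> Q * Q = Q ->
  (forall k, `|B ^+ k * Q| <= c) -> (forall k, `|B' ^+ k * Q| <= c) ->
  exists S : M, [/\ S^T = S, B^T *m S *m B = S, forall v : V, 0 <= qform S v v,
    forall v : V, qform S v v = 0 -> Q *m v = 0 &
    forall v : V, Q *m v = 0 -> v^T *m S = 0].
Proof.
move=> B'B QB QB' QQ hB hB'.
pose C k : M := B ^+ k * Q.
have CB k : C k * B = C k.+1 by rewrite /C -mulrA QB mulrA -exprSr.
have c0 : 0 <= c := le_trans (normr_ge0 _) (hB 0%N).
pose S_ m : M := m.+1%:R^-1 *: \sum_(k < m.+1) ((C k)^T * C k).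
pose K := n.+1%:R * c * c.
have K0 : 0 <= K by rewrite !mulr_ge0.
have CC k : `|(C k)^T * C k| <= K.
  apply: le_trans (mulmx_norm_le _ _) _; rewrite /K.
  have CT : `|(C k)^T| <= c.
    apply: mx_norm_le => // i j; rewrite mxE.
    exact: le_trans (mx_entry_le _ _ _) (hB k).
  by apply: ler_pM; rewrite ?mulr_ge0 ?ler_wpM2l ?hB.
have S_le m : `|S_ m| <= K.
  rewrite normrZ ger0_norm// ler_pdivrMl//.
  apply: le_trans (ler_norm_sum _ _ _) _.
  apply: (@le_trans _ _ (\sum_(k < m.+1) K)); first by apply: ler_sum.
  by rewrite sumr_const card_ord mulr_natl.
have S_sym m : (S_ m)^T = S_ m.
  rewrite linearZ/= raddf_sum/=; congr (_ *: _); apply: eq_bigr => k _.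
  by rewrite -mulmxE trmx_mul trmxK.
have S_inv m : `|B^T *m S_ m *m B - S_ m| <= (2 * K) / m.+1%:R.
  have -> : B^T *m S_ m *m B - S_ m =
      m.+1%:R^-1 *: ((C m.+1)^T * C m.+1 - (C 0%N)^T * C 0%N).
    rewrite /S_ -scalemxAr -scalemxAl -scalerBr; congr (_ *: _).
    rewrite mulmx_sumr mulmx_suml.
    under eq_bigr => k _ do rewrite -mulmxE mulmxA -trmx_mul -mulmxA !mulmxE CB.
    rewrite -sumrB -(big_mkord xpredT (fun k => (C k.+1)^T * C k.+1 - (C k)^T * C k)).
    by rewrite telescope_sumr.
  rewrite normrZ ger0_norm// mulrC ler_wpM2r//.
  by apply: le_trans (ler_normB _ _) _; rewrite mulr_natl mulr2n lerD.
have qC k v : qform ((C k)^T * C k) v v = qform 1%:M (C k *m v) (C k *m v).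
  by rewrite qformE mulmx1.
have S_pos m v : `|Q *m v| ^+ 2 / (n.+1%:R * c + 1) ^+ 2 <= qform (S_ m) v v.
  have d0 : 0 < n.+1%:R * c + 1 by rewrite ltr_pwDr// mulr_ge0.
  rewrite qform_Z qform_sum ler_pdivlMl//.
  have -> : m.+1%:R * (`|Q *m v| ^+ 2 / (n.+1%:R * c + 1) ^+ 2) =
      \sum_(k < m.+1) (`|Q *m v| ^+ 2 / (n.+1%:R * c + 1) ^+ 2).
    by rewrite sumr_const card_ord mulr_natl.
  apply: ler_sum => k _; rewrite qC; apply: le_trans (qform1_norm _).
  rewrite ler_pdivrMr ?exprn_gt0// -exprMn lerXn2r ?nnegrE ?mulr_ge0 ?(ltW d0)//.
  have -> : Q *m v = (B' ^+ k * Q) *m (C k *m v).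
    rewrite mulmxA; congr (_ *m v); rewrite mulmxE /C.
    have -> : B ^+ k * Q = Q * B ^+ k by apply/esym/commrX.
    rewrite mulrA -[_ * Q * Q]mulrA QQ.
    have -> : B' ^+ k * Q = Q * B' ^+ k by apply/esym/commrX.
    rewrite -mulrA (_ : B' ^+ k * B ^+ k = 1) ?mulr1//.
    elim: (k : nat) => [|j IH]; first by rewrite mulr1.
    by rewrite exprSr exprS mulrA -(mulrA _ B') B'B mulr1.
  apply: le_trans (mulmx_norm_le _ _) _; rewrite mulrC.
  apply: ler_wpM2l => //; apply: (@le_trans _ _ (n.+1%:R * c)); last by rewrite lerDl.
  by rewrite ler_wpM2l.
have S_ker m v : Q *m v = 0 -> v^T *m S_ m = 0.
  move=> Qv; rewrite -[LHS]trmxK trmx_mul trmxK S_sym.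
  rewrite -scalemxAl mulmx_suml big1 ?scaler0 ?trmx0// => k _.
  by rewrite -mulmxE -!mulmxA Qv !mulmx0.
have cS : compact [set S : M | `|S| <= K].
  apply: (@mx_bounded_closed_compact _ _ _ _ K) => //.
  apply: (@closed_comp _ _ (fun X : M => `|X|) [set x : R | x <= K]).
    by move=> X _; exact: norm_continuous.
  exact: closed_le.
have [S [_ clS]] : [set S : M | `|S| <= K] `&` cluster (S_ @ \oo) !=set0.
  by apply: cS; exists 0%N => // i _ /=.
have SF (F : set M) i : closed F -> (forall j, (i <= j)%N -> F (S_ j)) -> F S.
  move=> clF hF; apply: clF; rewrite clusterE in clS; apply: clS.
  by exists i => // j /= ij; exact: hF.
have qcont (v : V) : continuous (fun S : M => qform S v v).
  move=> X; apply: (@cvg_mx_entry _ _ _ _ (nbhs X) _ (fun S => v^T *m S *m v)).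
  apply: (@cvg_mulmx _ _ _ _ _ (nbhs X) _ (fun S : M => v^T *m S) (fun=> v)).
    exact: mulmxl_continuous.
  exact: cvg_cst.
have S_low v : `|Q *m v| ^+ 2 / (n.+1%:R * c + 1) ^+ 2 <= qform S v v.
  apply: (SF [set S | `|Q *m v| ^+ 2 / (n.+1%:R * c + 1) ^+ 2 <= qform S v v] 0%N); last first.
    by move=> j _; exact: S_pos.
  apply: (@closed_comp _ _ (fun S : M => qform S v v)
    [set x : R | `|Q *m v| ^+ 2 / (n.+1%:R * c + 1) ^+ 2 <= x]).
    by move=> X _; exact: qcont.
  exact: closed_ge.
exists S; split.
- apply/matrixP => i j; rewrite mxE.
  apply: (SF [set X : M | X j i = X i j] 0%N); last first.
    by move=> m _ /=; rewrite -[in LHS]S_sym mxE.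
  have -> : [set X : M | X j i = X i j] = [set X : M | X j i - X i j = 0].
    apply/seteqP; split=> X /= => [->|/eqP]; first by rewrite subrr.
    by rewrite subr_eq0 => /eqP.
  apply: (@closed_comp _ _ (fun X : M => X j i - X i j) [set 0 : R]); last exact: closed_eq.
  by move=> X _; apply: (@continuousB _ _ _ (fun X : M => X j i) (fun X => X i j));
    exact: coord_continuous.
- apply/eqP; rewrite -subr_eq0 -normr_eq0; apply/eqP/le_anti; rewrite normr_ge0 andbT.
  apply/ler_addgt0Pl => eps eps0; rewrite addr0.
  pose m := Num.bound (2 * K / eps).
  apply: (SF [set X : M | `|B^T *m X *m B - X| <= eps] m).
    apply: (@closed_comp _ _ (fun X : M => `|B^T *m X *m B - X|) [set x : R | x <= eps]).
      move=> X _; apply: (@continuous_comp _ _ _ (fun X : M => B^T *m X *m B - X) Num.norm).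
        apply: (@continuousB _ _ _ (fun X : M => B^T *m X *m B) id); last exact: cvg_id.
        apply: (@cvg_mulmx _ _ _ _ _ (nbhs X) _ (fun S : M => B^T *m S) (fun=> B)).
          exact: mulmxl_continuous.
        exact: cvg_cst.
      exact: norm_continuous.
    exact: closed_le.
  move=> j mj; apply: le_trans (S_inv j) _; rewrite ler_pdivrMr// -ler_pdivrMl// mulrC.
  have h : 0 <= 2 * K / eps by rewrite divr_ge0 ?mulr_ge0// ltW.
  apply: ltW; apply: lt_le_trans (archi_boundP h) _.
  by rewrite ler_nat; apply: leq_trans mj _.
- move=> v; apply: le_trans (S_low v).
  by rewrite divr_ge0 ?sqr_ge0.
- move=> v qv0; apply/eqP; rewrite -normr_eq0 -sqrf_eq0; apply/eqP/le_anti.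
  rewrite sqr_ge0 andbT; have := S_low v; rewrite qv0 ler_pdivrMr ?mul0r//.
  by rewrite exprn_gt0// ltr_pwDr// mulr_ge0.
- move=> v Qv; apply: (SF [set X : M | v^T *m X = 0] 0%N); last by move=> j _; exact: S_ker.
  apply: (@closed_comp _ _ (fun X : M => v^T *m X) [set 0]).
    by move=> X _; exact: mulmxl_continuous.
  exact: (accessible_closed_set1 (hausdorff_accessible (@norm_hausdorff _ _))).
Qed.

End InvariantForm.

(** * From the Jordan structure to a parabolic isometry *)

Section ParabolicConjugate.
Context {R : realType} {n : nat}.
Local Notation V := 'cV[R]_n.+1.
Local Notation M := 'M[R]_n.+1.

Lemma pglM m (A B : 'M[R]_m) : A \in unitmx -> B \in unitmx ->
  (pgl A * pgl B)%g = pgl (A *m B).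
Proof. exact: pgl_mulE. Qed.

Lemma pglV m (A : 'M[R]_m) : A \in unitmx -> (pgl A)^-1%g = pgl (invmx A).
Proof.
move=> uA; apply: (mulgI (pgl A)); rewrite mulgV.
by rewrite pglM ?unitmx_inv// mulmxV.
Qed.

(** A [B]-invariant form is written down in coordinates adapted to the Jordan block and averaged
    over [A ^+ j] for [j < k]. For the resulting Lorentzian form [e] spans an isotropic line fixed
    by [A], and any other eigenvector of [A] in the closed light cone would be killed by [N] without
    being killed by [N ^+ 2]. *)
Lemma parabolic_conjugate (A B B' P Q N : M) (e g : V) (l w : 'rV[R]_n.+1) (k : nat) (c : R) :
  A \in unitmx -> (0 < k)%N -> B = A ^+ k -> B * B' = 1 ->
  P + Q = 1 -> P * Q = 0 -> B * P = P + N -> N * P = N ->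
  N = g *m l + e *m w -> N * N = e *m l -> e != 0 -> l != 0 ->
  N *m e = 0 -> l *m N = 0 -> P *m e = e -> l *m P = l ->
  (forall Z : M, Z * B = B * Z -> [/\ Z * P = P * Z, Z * Q = Q * Z & Z * N = N * Z]) ->
  (forall k, `|B ^+ k * Q| <= c) -> (forall k, `|B' ^+ k * Q| <= c) ->
  exists h : PGL R n.+1, parabolic (h * pgl A * h^-1)%g.
Proof.
move=> uA k0 BE BB' PQ1 PQ0 BP NP NE NN e0 l0 Ne lN Pe lP comm hB hB'.
have canl (u : V) : u *m l = 0 -> u = 0.
  by move/mul_col_row_eq0 => [//|/eqP]; rewrite (negPf l0).
have cane (u : 'rV[R]_n.+1) : e *m u = 0 -> u = 0.
  by move/mul_col_row_eq0 => [/eqP|//]; rewrite (negPf e0).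
have B'B : B' * B = 1 by apply: mulmx1C.
have [BPc BQc BNc] := comm B erefl.
have PN : P * N = N by have [_ _ ->] := comm P (esym BPc).
have PP : P * P = P by rewrite -[RHS]mulr1 -PQ1 mulrDr PQ0 addr0.
have QP0 : Q * P = 0 by have [_ <- _] := comm P (esym BPc).
have QQ : Q * Q = Q by rewrite -[RHS]mulr1 -PQ1 mulrDr QP0 add0r.
have QN : Q * N = 0 by rewrite -PN mulrA QP0 mul0r.
have NQ : N * Q = 0 by rewrite -NP -mulrA PQ0 mulr0.
have B'Q : Q * B' = B' * Q.
  by rewrite -[LHS]mul1r -B'B -mulrA (mulrA B) BQc -!mulrA BB' mulr1.
have le0 : l *m e = 0.
  have : e *m (l *m e) = 0 by rewrite mulmxA -NN -mulmxE -mulmxA Ne mulmx0.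
  by move/mul_col_row_eq0 => [/eqP|//]; rewrite (negPf e0).
have AB : A * B = B * A by rewrite BE -exprS -exprSr.
have [AP AQ AN] := comm A AB.
have Be : B *m e = e.
  rewrite -{1}Pe mulmxA [B *m P]BP mulmxDl Ne addr0 Pe.
  by [].
have lB : l *m B = l.
  by rewrite -{1}lP -mulmxA [P *m B](_ : _ = P + N) ?mulmxDr ?lN ?addr0// -BP BPc.
have [u lu] : exists u : V, l *m u = 1%:M.
  have /rV0Pn[i li] := l0; exists ((l ord0 i)^-1 *: delta_mx i ord0).
  by rewrite [LHS]mx11_scalar -scalemxAr -colE !mxE mulVf.
(* [A] commutes with [N ^+ 2 = e l], so it preserves the lines of [e] and of [l], with the same
   eigenvalue. *)
have [a [Ae lA]] : exists a : R, A *m e = a *: e /\ l *m A = a *: l.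
  have AX : A *m e *m l = e *m (l *m A).
    rewrite -mulmxA -NN mulmxA -NN [RHS](_ : _ = N * N * A)//.
    by rewrite -mulrA -AN mulrA -AN -mulrA.
  pose a := (l *m A *m u) ord0 ord0.
  have Ae : A *m e = a *: e.
    rewrite -[LHS]mulmx1 -lu mulmxA AX -mulmxA [l *m A *m u]mx11_scalar.
    by rewrite mul_mx_scalar.
  exists a; split=> //; apply/eqP; rewrite -subr_eq0; apply/eqP/cane.
  by rewrite mulmxBr -AX Ae -scalemxAl -scalemxAr subrr.
have Ake j : A ^+ j *m e = a ^+ j *: e.
  elim: j => [|j IH]; first by rewrite mul1mx scale1r.
  by rewrite exprS -mulmxE -mulmxA IH -scalemxAr Ae scalerA -exprSr.
have lAk j : l *m A ^+ j = a ^+ j *: l.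
  elim: j => [|j IH]; first by rewrite mulmx1 scale1r.
  by rewrite exprSr -mulmxE mulmxA IH -scalemxAl lA scalerA -exprSr.
have ak : a ^+ k = 1.
  have /eqP := Ake k; rewrite -BE Be -subr_eq0 -{1}[e]scale1r -scalerBl.
  by rewrite scaler_eq0 (negPf e0) orbF subr_eq0 => /eqP.
(* A real number with a positive power equal to 1 is 1 or -1. *)
have aa : a * a = 1.
  have : `|a| ^+ k = 1 by rewrite -normrX ak normr1.
  move/eqP; rewrite pexpr_eq1// => /eqP a1.
  by rewrite -expr2 -real_normK ?num_real// a1 expr1n.
have [f [lf Pf]] : exists f : V, l *m f = 1%:M /\ P *m f = f.
  by exists (P *m u); rewrite !mulmxA lP [P *m P]PP.
(* [g] and [w] are normalized so that [f], [g0 = N f], [e = N g0] is a Jordan chain in the image of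
   [P], with dual coordinates [l], [m] and [q]. *)
have [g0 [m [NE' Nf mf0]]] : exists (g0 : V) (m : 'rV[R]_n.+1),
    [/\ N = g0 *m l + e *m m, N *m f = g0 & m *m f = 0].
  exists (N *m f), (w - (w *m f) *m l); split=> //; last first.
    by rewrite mulmxBl -(mulmxA (w *m f)) lf mulmx1 subrr.
  rewrite {2}NE mulmxDl -(mulmxA g) lf mulmx1 mulmxDl mulmxBr !mulmxA -addrA.
  by rewrite [X in _ + X]addrC subrK.
have lg : l *m g0 = 0 by rewrite -Nf mulmxA lN mul0mx.
have mE (z : 'M[R]_1) : e *m z = e -> z = 1%:M.
  move=> ez; have : e *m (z - 1%:M) = 0 by rewrite mulmxBr mulmx1 ez subrr.
  move/mul_col_row_eq0 => [/eqP|/eqP]; first by rewrite (negPf e0).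
  by rewrite subr_eq0 => /eqP.
have Ng : N *m g0 = e by rewrite -Nf mulmxA [N *m N]NN -mulmxA lf mulmx1.
have mg : m *m g0 = 1%:M.
  by apply: mE; rewrite mulmxA -[RHS]Ng NE' mulmxDl -(mulmxA g0) lg mulmx0 add0r.
have me : m *m e = 0.
  have : e *m (m *m e) = 0.
    by rewrite mulmxA -[RHS]Ne NE' mulmxDl -(mulmxA g0) le0 mulmx0 add0r.
  by move/mul_col_row_eq0 => [/eqP|//]; rewrite (negPf e0).
have mP : m *m P = m.
  apply/eqP; rewrite -subr_eq0; apply/eqP/cane.
  have : N *m P = N by exact: NP.
  rewrite {1 2}NE' mulmxDl -mulmxA lP => /addrI.
  by rewrite -mulmxA mulmxBr => ->; rewrite subrr.
have Pg : P *m g0 = g0 by rewrite -Nf mulmxA [P *m N]PN.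
have [q [qe qf qg qP]] : exists q : 'rV[R]_n.+1,
    [/\ q *m e = 1%:M, q *m f = 0, q *m g0 = 0 & q *m P = q].
  have /cV0Pn[i ei] := e0; pose r : 'rV[R]_n.+1 := (e i ord0)^-1 *: delta_mx ord0 i.
  have re : r *m e = 1%:M by rewrite [LHS]mx11_scalar -scalemxAl -rowE !mxE mulVf.
  exists ((r - (r *m f) *m l - (r *m g0) *m m) *m P).
  split; last by rewrite -mulmxA [P *m P]PP.
  - by rewrite -mulmxA Pe !mulmxBl -!mulmxA le0 me !mulmx0 !subr0.
  - by rewrite -mulmxA Pf !mulmxBl -!mulmxA lf mf0 mulmx1 !mulmx0 subrr subr0.
  - by rewrite -mulmxA Pg !mulmxBl -!mulmxA lg mg mulmx1 !mulmx0 subr0 subrr.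
(* [U] is what remains of [P] once the Jordan chain is split off; there [B] acts trivially. *)
have [U UE] : exists U : M, U = P - f *m l - g0 *m m - e *m q by eexists.
have mB : m *m B = m + l.
  rewrite -{1}mP -mulmxA [P *m B](_ : _ = P + N); last by rewrite -BP BPc.
  by rewrite mulmxDr mP NE' mulmxDr !mulmxA mg me mul1mx mul0mx addr0.
have qB : q *m B = q + m.
  rewrite -{1}qP -mulmxA [P *m B](_ : _ = P + N); last by rewrite -BP BPc.
  by rewrite mulmxDr qP NE' mulmxDr !mulmxA qg qe mul1mx mul0mx add0r.
have UB : U *m B = U.
  have eg : e *m m = N - g0 *m l by rewrite NE' addrC addKr.
  rewrite UE !mulmxBl -!mulmxA lB mB qB [P *m B](_ : _ = P + N); last by rewrite -BP BPc.
  rewrite (mulmxDr g0) (mulmxDr e) eg; apply/matrixP => i j; rewrite !mxE; ring.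
have Ue : U *m e = 0.
  by rewrite UE !mulmxBl -!mulmxA Pe le0 me qe !mulmx0 mulmx1 !subr0 subrr.
have [S2 [symS2 S2B S2pos S2eq S2ker]] :=
  bounded_invariant_form B'B (esym BQc) B'Q QQ hB hB'.
have Qe : Q *m e = 0 by rewrite -[e]Pe mulmxA [Q *m P]QP0 mul0mx.
(* On the chain this is the quadratic form m^2 - 2 l q - l m. [B] replaces m by m + l and q by q +
   m, and the term - l m compensates the change of the first two. The remaining directions carry the
   Euclidean form through [U] and the averaged form [S2]. *)
pose S := m^T *m m - l^T *m q - q^T *m l - 2^-1 *: (l^T *m m + m^T *m l) +
          U^T *m U + S2.
pose cf (r : 'rV[R]_n.+1) (v : V) := (r *m v) ord0 ord0.
have outer (r r' : 'rV[R]_n.+1) u1 u2 : qform (r^T *m r') u1 u2 = cf r u1 * cf r' u2.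
  exact: qform_outer.
have qS u1 u2 : qform S u1 u2 = cf m u1 * cf m u2 - cf l u1 * cf q u2 - cf q u1 * cf l u2
    - 2^-1 * (cf l u1 * cf m u2 + cf m u1 * cf l u2) + qform 1%:M (U *m u1) (U *m u2)
    + qform S2 u1 u2.
  rewrite /S !(qformD, qformN, qform_Z) !outer qformE mulmx1.
  by [].
have symS : S^T = S.
  apply: qform_inj => u1 u2; rewrite qform_tr !qS.
  rewrite -[qform S2 u2 u1]qform_tr symS2 -[qform 1%:M (U *m u2) _]qform_tr trmx1.
  move: (cf l u1) (cf q u1) (cf m u1) (cf l u2) (cf q u2) (cf m u2) => a1 a2 a3 a4 a5 a6.
  by move: (qform _ _ _) (qform _ _ _) => b1 b2; ring.
have SB : B^T *m S *m B = S.
  apply: qform_inj => u1 u2; rewrite -qformE !qS.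
  have cD (r r' : 'rV[R]_n.+1) v : cf (r + r') v = cf r v + cf r' v.
    by rewrite /cf mulmxDl mxE.
  have cB (r : 'rV[R]_n.+1) v : cf r (B *m v) = cf (r *m B) v by rewrite /cf mulmxA.
  rewrite !cB lB mB qB !cD !(mulmxA U) UB (qformE S2) S2B.
  move: (cf l u1) (cf q u1) (cf m u1) (cf l u2) (cf q u2) (cf m u2) => a1 a2 a3 a4 a5 a6.
  by move: (qform _ _ _) (qform _ _ _) => b1 b2; field.
(* The pulled back forms are periodic in [j] with period [k], since [A ^+ k = B] preserves [S];
   their sum over one period is therefore invariant under [A]. *)
have BkS j : (A ^+ (j + k))^T *m S *m A ^+ (j + k) = (A ^+ j)^T *m S *m A ^+ j.
  rewrite addnC exprD -BE -mulmxE trmx_mul -!mulmxA (mulmxA S B).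
  by rewrite (mulmxA B^T (S *m B)) (mulmxA B^T S B) SB.
pose F j := (A ^+ j)^T *m S *m A ^+ j.
pose SA : M := \sum_(j < k) F j.
have AE j : A ^+ j *m A = A ^+ j.+1 by rewrite exprSr -mulmxE.
have SAA : A^T *m SA *m A = SA.
  rewrite mulmx_sumr mulmx_suml.
  under eq_bigr => j _ do rewrite /F !mulmxA -trmx_mul -mulmxA AE.
  apply/eqP; rewrite -subr_eq0 -sumrB -(big_mkord xpredT (fun j => F j.+1 - F j)).
  by rewrite telescope_sumr// /F -[k]add0n BkS subrr.
have symSA : SA^T = SA.
  rewrite raddf_sum /=; apply: eq_bigr => j _.
  by rewrite /F !trmx_mul trmxK symS mulmxA.
have qSA u1 u2 : qform SA u1 u2 = \sum_(j < k) qform S (A ^+ j *m u1) (A ^+ j *m u2).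
  by rewrite qform_sum; apply: eq_bigr => j _; rewrite /F -qformE.
have qSe v : qform S e v = - cf l v.
  rewrite qS.
  have -> : cf l e = 0 by rewrite /cf le0 mxE.
  have -> : cf m e = 0 by rewrite /cf me mxE.
  have -> : cf q e = 1 by rewrite /cf qe mxE.
  have -> : qform S2 e v = 0 by rewrite /qform (S2ker _ Qe) mul0mx mxE.
  have -> : qform 1%:M (U *m e) (U *m v) = 0 by rewrite Ue /qform trmx0 !mul0mx mxE.
  by move: (cf l v) (cf m v) (cf q v) => x1 x2 x3; ring.
have eSA : e^T *m SA = - k%:R *: l.
  rewrite mulmx_sumr.
  have term (j : nat) : e^T *m F j = - l.
    apply/rowP => i.
    have -> : (e^T *m F j) ord0 i = qform S (A ^+ j *m e) (A ^+ j *m delta_mx i ord0).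
      by rewrite qformE /qform -colE [RHS]mxE.
    rewrite Ake qform_Zl qSe /cf mulmxA lAk -scalemxAl -colE !mxE.
    have : a ^+ j * a ^+ j = 1 by rewrite -exprMn aa expr1n.
    by move: (a ^+ j) => x xx; rewrite mulrN mulrA xx mul1r.
  under eq_bigr => j _ do rewrite term.
  by rewrite sumr_const card_ord scaleNr scaler_nat mulNrn.
have lA0 j v : l *m v = 0 -> l *m (A ^+ j *m v) = 0.
  by move=> lv; rewrite mulmxA lAk -scalemxAl lv scaler0.
have qSl v : l *m v = 0 ->
    qform S v v = cf m v ^+ 2 + qform 1%:M (U *m v) (U *m v) + qform S2 v v.
  move=> lv; rewrite qS; have -> : cf l v = 0 by rewrite /cf lv mxE.
  by rewrite !(mul0r, mulr0, addr0, subr0) expr2.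
have Spos v : l *m v = 0 -> 0 <= qform S v v.
  by move=> lv; rewrite qSl// !addr_ge0// ?sqr_ge0 ?qform1_ge0 ?S2pos.
have Sker v : l *m v = 0 -> qform S v v = 0 -> exists x : R, v = x *: e.
  move=> lv; rewrite qSl// => /eqP.
  rewrite paddr_eq0 ?S2pos ?addr_ge0 ?sqr_ge0 ?qform1_ge0// => /andP[].
  rewrite paddr_eq0 ?sqr_ge0 ?qform1_ge0// sqrf_eq0 => /andP[/eqP m0 /eqP U0 /eqP Q0].
  have {}U0 := qform1_eq0 U0; have {}Q0 := S2eq _ Q0.
  exists ((q *m v) ord0 ord0).
  have : v = P *m v by rewrite -[LHS]mul1mx -[1%:M]PQ1 mulmxDl Q0 addr0.
  have -> : P = U + e *m q + g0 *m m + f *m l by rewrite UE !subrK.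
  have mv0 : m *m v = 0 by rewrite [LHS]mx11_scalar -/(cf m v) m0 raddf0.
  rewrite !mulmxDl U0 -!mulmxA lv mv0 !mulmx0 !addr0 add0r => {1}->.
  by rewrite {1}[q *m v]mx11_scalar mul_mx_scalar.
have SApos v : l *m v = 0 -> 0 <= qform SA v v.
  by move=> lv; rewrite qSA sumr_ge0// => j _; apply/Spos/lA0.
have SAker v : l *m v = 0 -> qform SA v v = 0 -> exists x : R, v = x *: e.
  move=> lv; rewrite qSA => /eqP; rewrite psumr_eq0 => [|j _]; last exact/Spos/lA0.
  move/allP/(_ (Ordinal k0)); rewrite mem_index_enum => /(_ isT) /= /eqP.
  by rewrite mul1mx; exact: Sker.
have kR : (0 : R) < k%:R by rewrite ltr0n.
have [T uT TS] := lorentzian_congruent symSA kR e0 l0 le0 eSA SApos SAker.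
(* If [l v] is not zero, the eigenvalue must be [a], hence [B v = v] and [N v = 0], and then
   [e (l v) = N (N v)] vanishes, a contradiction. If [l v = 0], positivity on [ker l] leaves only
   multiples of [e]. *)
have fixE (x : R) (v : V) : v != 0 -> A *m v = x *: v -> qform SA v v <= 0 ->
    exists y : R, v = y *: e.
  move=> v0 Av qv.
  have [lv|lv] := eqVneq (l *m v) 0.
    by apply: SAker => //; apply/le_anti; rewrite qv SApos.
  have xa : x = a.
    have : (x - a) *: (l *m v) = 0.
      by rewrite scalerBl scalemxAr -Av mulmxA lA -scalemxAl subrr.
    by move/eqP; rewrite scaler_eq0 (negPf lv) orbF subr_eq0 => /eqP.
  have Bv : B *m v = v.
    have Akv j : A ^+ j *m v = x ^+ j *: v.
      elim: j => [|j IH]; first by rewrite mul1mx scale1r.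
      by rewrite exprS -mulmxE -mulmxA IH -scalemxAr Av scalerA -exprSr.
    by rewrite BE Akv xa ak scale1r.
  have Nv : N *m v = 0.
    have : B *m P *m v = P *m v.
      by rewrite [B *m P]BPc -mulmxA Bv.
    by rewrite [B *m P]BP mulmxDl => /eqP; rewrite addrC -subr_eq0 addrK => /eqP.
  have : e *m (l *m v) = 0 by rewrite mulmxA -NN -mulmxE -mulmxA Nv mulmx0.
  by move/mul_col_row_eq0 => [/eqP|/eqP]; rewrite ?(negPf e0) ?(negPf lv).
exists (pgl (invmx T)).
rewrite pglV ?unitmx_inv// invmxK !pglM ?unitmx_mul ?unitmx_inv ?uT//.
have [A2 A2E] : exists A2 : M, A2 = invmx T *m A *m T by eexists.
rewrite -A2E.
have uA2 : A2 \in unitmx by rewrite A2E !unitmx_mul unitmx_inv uT uA.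
have TA2 : T *m A2 = A *m T by rewrite A2E !mulmxA mulmxV// mul1mx.
have normE (v : V) : lorentz_norm v = qform SA (T *m v) (T *m v).
  by rewrite qformE TS.
have T0 (v : V) : v != 0 -> T *m v != 0.
  by apply: contra => /eqP Tv; rewrite -(mulKmx uT v) Tv mulmx0.
have fix2 (v : V) : v != 0 -> pact (pgl A2) (pt v) = pt v -> lorentz_norm v <= 0 ->
    exists y : R, T *m v = y *: e.
  move=> v0; rewrite pactE// => /esym/pt_eq[||x x0 A2v]//.
    by apply: contra v0 => /eqP A2v; rewrite -(mulKmx uA2 v) A2v mulmx0.
  rewrite normE; apply: (fixE x); first exact: T0.
  by rewrite mulmxA -TA2 -mulmxA A2v scalemxAr.
have qee : qform SA e e = 0 by rewrite /qform eSA -scalemxAl le0 scaler0 mxE.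
split.
- exists A2 => //=.
  rewrite -TS.
  have -> : A2^T *m (T^T *m SA *m T) *m A2 = (T *m A2)^T *m SA *m (T *m A2).
    by rewrite trmx_mul !mulmxA.
  rewrite TA2 trmx_mul -!mulmxA (mulmxA SA A) (mulmxA A^T (SA *m A)).
  by rewrite (mulmxA A^T SA A) SAA.
- move=> p [v /= v0 <-] /fix2 h.
  have vn0 : v != 0.
    by apply/eqP => vz; move: v0; rewrite vz /lorentz_norm mulmx0 mxE ltxx.
  have [y Tv] := h vn0 (ltW v0).
  by move: v0; rewrite normE Tv qform_Zl qform_Zr qee !mulr0 ltxx.
- pose e2 := invmx T *m e.
  have Te2 : T *m e2 = e by rewrite mulKVmx.
  have e20 : e2 != 0 by apply: contraNneq e0 => h; rewrite -Te2 h mulmx0.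
  exists (pt e2); split.
    split; first by exists e2 => //; split=> //; rewrite normE Te2.
    have a0 : a != 0 by apply/eqP => h; move: aa; rewrite h mul0r => /eqP; rewrite eq_sym oner_eq0.
    have A2e : A2 *m e2 = a *: e2.
      by rewrite -(mulKmx uT (A2 *m e2)) (mulmxA T A2) TA2 -mulmxA Te2 Ae /e2 -scalemxAr.
    rewrite pactE// A2e; apply/esym/pt_eq => //.
      by rewrite scaler_eq0 negb_or a0.
    by exists a.
  move=> p [[v /= [v0 nv] <-]] /fix2 h.
  have [y Tv] := h v0 (eq_ind_r (fun x => x <= 0) (lexx 0) nv).
  apply/pt_eq => //; exists y.
    apply/eqP => y0; have := T0 _ v0; rewrite Tv y0 scale0r eqxx.
    by [].
  by rewrite -(mulKmx uT v) Tv /e2 scalemxAr.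
Qed.

End ParabolicConjugate.

(** * Projective spaces and orbit spaces *)

Section ProjectiveTopology.
Context {R : realType}.

Lemma open_proj_lift (V : normedModType R) (S : set V) (x0 : S)
    (U : set (projectivization S)) : open U ->
  exists2 W : set V, open W & forall v, v \in S -> (W v <-> U (pclass x0 v)).
Proof.
rewrite /open /= /quotient_open => -[W oW WE]; exists W => // v vS.
have : (val @^-1` W) (insubd x0 v) <-> (\pi_(projectivization S) @^-1` U) (insubd x0 v).
  by rewrite WE.
by rewrite /= /pclass insubdK.
Qed.

Lemma open_proj (V : normedModType R) (S : set V) (x0 : S)
    (U : set (projectivization S)) (W : set V) : open W ->
  (forall v, v \in S -> (W v <-> U (pclass x0 v))) -> open U.
Proof.
move=> oW WU; rewrite /open /= /quotient_open; exists W => //.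
apply/seteqP; split=> x /=.
  by move=> /(WU _ (valP x)); rewrite /pclass valKd.
by move=> Ux; apply/(WU _ (valP x)); rewrite /pclass valKd.
Qed.

Context {n : nat}.
Local Notation V := 'cV[R]_n.+1.
Implicit Types (v w : V) (U : set (RP R n)).

Lemma nzvec_open : open (@nzvec R n).
Proof.
have -> : @nzvec R n = ~` [set 0].
  by apply/seteqP; split=> v /=; [move=> /eqP|move/eqP].
apply: closed_openC.
exact: (accessible_closed_set1 (hausdorff_accessible (@norm_hausdorff _ _))).
Qed.

Lemma open_cone U : open U <-> open (cone U).
Proof.
split=> [/(open_proj_lift (exist (fun u => u \in @nzvec R n) _ (nzvec1 R n)))[W oW WU]|oU].
  have -> : cone U = @nzvec R n `&` W.
    apply/seteqP; split=> v [v0 Uv]; split=> //.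
      by apply/WU => //; apply/mem_set.
    by apply/WU => //; apply/mem_set.
  by apply: openI => //; exact: nzvec_open.
apply: (open_proj (x0 := exist (fun u => u \in @nzvec R n) _ (nzvec1 R n)) oU).
by move=> v /set_mem v0; split=> [[]|].
Qed.

Lemma pt_continuous v : v != 0 -> {for v, continuous (pt : V -> RP R n)}.
Proof.
move=> v0 A; rewrite nbhsE => -[U [oU Uv UA]].
have oc : open (cone U) by apply/open_cone.
by apply: filterS (open_nbhs_nbhs (conj oc (conj v0 Uv))) => w [_ /UA].
Qed.

Lemma pt_scale (c : R) v : c != 0 -> v != 0 -> pt (c *: v) = pt v.
Proof.
move=> c0 v0; apply/pt_eq => //; first by rewrite scaler_eq0 negb_or c0.
by exists c^-1; rewrite ?invr_eq0// scalerA mulVf// scale1r.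
Qed.

Lemma pt_open (W : set V) : open W -> open [set pt v | v in W `&` [set v | v != 0]].
Proof.
move=> oW; apply/open_cone; rewrite openE => v [v0 /= [w [Ww w0] /pt_eq[]// c c0 vE]].
have Wv : \forall u \near v, W (c^-1 *: u).
  apply: (@scaler_continuous R V c^-1 v); apply: open_nbhs_nbhs; split=> //.
  by rewrite vE scalerA mulVf// scale1r.
have v'0 : \forall u \near v, u != 0 by apply: open_nbhs_nbhs; split=> //; exact: nzvec_open.
near=> u.
split; first by near: u.
exists (c^-1 *: u); first split.
- by near: u.
- by rewrite /= scaler_eq0 negb_or invr_eq0 c0 /=; near: u.
- by rewrite pt_scale ?invr_eq0//; near: u.
Unshelve. all: by end_near.
Qed.

Lemma RP_ind (P : RP R n -> Prop) : (forall v, v != 0 -> P (pt v)) -> forall p, P p.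
Proof. by move=> H p; rewrite -(vec_ofK p); apply: H; exact: vec_of_neq0. Qed.

(** For nonzero vectors the matrix [v w^T - w v^T] vanishes exactly when [v] and [w] are
    proportional, and it depends continuously on the pair. *)
Lemma pt_separated v w : v != 0 -> w != 0 -> pt v <> pt w ->
  exists A B : set V, [/\ open A, open B, A v, B w &
    forall v' w', A v' -> B w' -> v' != 0 -> w' != 0 -> pt v' <> pt w'].
Proof.
move=> v0 w0 vw.
pose f (x : V * V) : 'M[R]_n.+1 := x.1 *m x.2^T - x.2 *m x.1^T.
have trc : continuous (trmx : V -> 'rV[R]_n.+1).
  move=> x; apply: (@cvg_mx _ _ _ _ (nbhs x)) => i j.
  by under eq_fun do rewrite mxE; rewrite mxE; exact: coord_continuous.
have fc : continuous f.
  move=> x; apply: (@continuousB _ _ _ (fun x : V * V => x.1 *m x.2^T) (fun x => x.2 *m x.1^T)).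
    apply: (@cvg_mulmx _ _ _ _ _ (nbhs x) _ fst (fun x => x.2^T)); first exact: cvg_fst.
    by apply: (@continuous_comp _ _ _ (snd : V * V -> V) trmx); [exact: cvg_snd|exact: trc].
  apply: (@cvg_mulmx _ _ _ _ _ (nbhs x) _ snd (fun x => x.1^T)); first exact: cvg_snd.
  by apply: (@continuous_comp _ _ _ (fst : V * V -> V) trmx); [exact: cvg_fst|exact: trc].
have fvw : f (v, w) != 0.
  apply/eqP => /eqP; rewrite subr_eq0 /= => /eqP E; apply: vw; apply/esym/pt_eq => //.
  have /cV0Pn[i wi] := w0.
  have vE : v = (v i ord0 / w i ord0) *: w.
    apply/colP => j; have /matrixP/(_ j i) := E; rewrite !mxE !big_ord1 !mxE => h.
    by rewrite mulrAC -[v i _ * _]mulrC -h mulrK// unitfE.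
  exists (v i ord0 / w i ord0) => //.
  by apply: contraNneq v0 => h; rewrite vE h scale0r.
have onz : open [set M : 'M[R]_n.+1 | M != 0].
  have -> : [set M : 'M[R]_n.+1 | M != 0] = ~` [set 0].
    by apply/seteqP; split=> M /=; [move=> /eqP|move/eqP].
  apply: closed_openC.
  exact: (accessible_closed_set1 (hausdorff_accessible (@norm_hausdorff _ _))).
have [[A B] /= [nA nB] AB] : nbhs (v, w) (f @^-1` [set M | M != 0]).
  by apply: fc; exact: open_nbhs_nbhs.
exists A°, B°; split; try exact: open_interior; try exact: nbhs_singleton.
- by move/nbhs_interior: nA => /nbhs_singleton.
- by move/nbhs_interior: nB => /nbhs_singleton.
move=> v' w' /interior_subset Av' /interior_subset Bw' v'0 w'0 /pt_eq[]// c c0 w'E.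
have := AB (v', w') (conj Av' Bw'); rewrite /f /= w'E.
by rewrite linearZ/= -scalemxAr -scalemxAl subrr eqxx.
Qed.

Lemma pactM (g h : PGL R n.+1) p : pact (g * h)%g p = pact g (pact h p).
Proof.
elim/RP_ind: p => v v0; rewrite -(mat_ofK g) -(mat_ofK h).
have Bv0 : mat_of h *m v != 0.
  by apply: contra v0 => /eqP Bv; rewrite -(mulKmx (mat_of_unit h) v) Bv mulmx0.
by rewrite pglM ?mat_of_unit// !pactE ?unitmx_mul ?mat_of_unit// mulmxA.
Qed.

Lemma pact1 p : pact (1%g : PGL R n.+1) p = p.
Proof.
elim/RP_ind: p => v v0; have -> : (1%g : PGL R n.+1) = pgl 1%:M by [].
by rewrite pactE ?unitmx1// mul1mx.
Qed.

Lemma pactK (g : PGL R n.+1) : cancel (pact g) (pact g^-1%g).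
Proof. by move=> p; rewrite -pactM mulVg pact1. Qed.

Lemma pactVK (g : PGL R n.+1) : cancel (pact g^-1%g) (pact g).
Proof. by move=> p; rewrite -pactM mulgV pact1. Qed.

Lemma mulmx_neq0 (A : 'M[R]_n.+1) v : A \in unitmx -> v != 0 -> A *m v != 0.
Proof. by move=> uA; apply: contra => /eqP Av; rewrite -(mulKmx uA v) Av mulmx0. Qed.

Lemma pact_preimage_open (g : PGL R n.+1) U : open U -> open (pact g @^-1` U).
Proof.
move=> /open_cone oU; apply/open_cone.
have -> : cone (pact g @^-1` U) = mulmx (mat_of g) @^-1` cone U.
  apply/seteqP; split=> v [v0 /= Uv].
    split; first by apply: mulmx_neq0 => //; exact: mat_of_unit.
    by move: Uv; rewrite -{1}(mat_ofK g) pactE ?mat_of_unit.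
  have vn0 : v != 0 by apply: contraNneq v0 => ->; rewrite mulmx0.
  by split=> //=; rewrite -{1}(mat_ofK g) pactE ?mat_of_unit.
by apply: open_comp => // v _; exact: mulmxl_continuous.
Qed.

Lemma pact_continuous (g : PGL R n.+1) : continuous (pact g).
Proof. by apply/continuousP => U; exact: pact_preimage_open. Qed.

Lemma pact_image (g : PGL R n.+1) U : pact g @` U = pact g^-1%g @^-1` U.
Proof.
apply/seteqP; split=> [_ [p Up <-]|p Up] /=; first by rewrite pactK.
by exists (pact g^-1%g p) => //; rewrite pactVK.
Qed.

Lemma pact_image_open (g : PGL R n.+1) U : open U -> open (pact g @` U).
Proof. by rewrite pact_image; exact: pact_preimage_open. Qed.

End ProjectiveTopology.

Section OrbitSpace.
Context {R : realType} {n : nat} (Gamma : set (PGL R n.+1)).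

Lemma open_orbit_space (U : set (orbit_space Gamma)) :
  open U <-> open (oproj Gamma @^-1` U).
Proof. by []. Qed.

Lemma oproj_continuous : continuous (oproj Gamma).
Proof. exact: pi_continuous. Qed.

Context (gG : is_subgroup Gamma).

Lemma oprojP p q : oproj Gamma p = oproj Gamma q <-> exists2 g, Gamma g & q = pact g p.
Proof.
have [G1 GM GV] := gG; split.
  move/eqmodP => /= /asboolP E.
  have : Defs.orbit Gamma q q by exists 1%g => //; exact: pact1.
  by rewrite -E => -[g Gg <-]; exists g.
move=> [g Gg ->]; apply/eqmodP => /=; apply/asboolP; apply/seteqP; split.
  move=> _ [h Gh <-]; exists (h * g^-1)%g; first by apply: GM => //; exact: GV.
  by rewrite -pactM -mulgA mulVg mulg1.
by move=> _ [h Gh <-]; exists (h * g)%g; [exact: GM|rewrite pactM].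
Qed.

Lemma oproj_pact g p : Gamma g -> oproj Gamma (pact g p) = oproj Gamma p.
Proof. by move=> Gg; apply/esym/oprojP; exists g. Qed.

Lemma oproj_open (U : set (RP R n)) : open U -> open (oproj Gamma @` U).
Proof.
move=> oU; apply/open_orbit_space.
have -> : oproj Gamma @^-1` (oproj Gamma @` U) = \bigcup_(g in Gamma) (pact g @` U).
  apply/seteqP; split=> p.
    by move=> [q Uq /oprojP[g Gg ->]]; exists g => //; exists q.
  by move=> [g Gg [q Uq <-]]; exists q => //; rewrite oproj_pact.
by apply: bigcup_open => g _; exact: pact_image_open.
Qed.

End OrbitSpace.

(** * Lifting a convex set to a cone *)

Section Independence.
Context {R : realType} {n : nat}.
Local Notation V := 'cV[R]_n.+1.
Implicit Types v w u : V.

Lemma row_mx_comb v w (c : 'cV[R]_(1 + 1)) :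
  row_mx v w *m c = (usubmx c) ord0 ord0 *: v + (dsubmx c) ord0 ord0 *: w.
Proof.
rewrite -{1}[c]vsubmxK mul_row_col [usubmx c]mx11_scalar [dsubmx c]mx11_scalar.
by rewrite !mul_mx_scalar !mxE !mulr1n.
Qed.

Lemma col2_eq0 (c : 'cV[R]_(1 + 1)) :
  (usubmx c) ord0 ord0 = 0 -> (dsubmx c) ord0 ord0 = 0 -> c = 0.
Proof.
move=> x0 y0; rewrite -[c]vsubmxK [usubmx _]mx11_scalar [dsubmx _]mx11_scalar x0 y0.
by rewrite !raddf0 col_mx0.
Qed.

Lemma independentP v w : v != 0 -> (forall c, w <> c *: v) -> independent v w.
Proof.
move=> v0 wv; apply/eqP; rewrite -mxrank_tr; apply/inj_row_free => u.
move=> h; have : row_mx v w *m u^T = 0.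
  by rewrite -[LHS]trmxK trmx_mul trmxK h trmx0.
rewrite row_mx_comb.
set x := usubmx _ _ _; set y := dsubmx _ _ _ => E.
have y0 : y = 0.
  apply: contrapT => /eqP y0; apply: (wv (- x / y)).
  have -> : w = y^-1 *: (y *: w) by rewrite scalerA mulVf// scale1r.
  by move/eqP: E; rewrite addrC addr_eq0 => /eqP ->; rewrite -scaleNr scalerA mulrC.
have x0 : x = 0.
  move/eqP: E; rewrite y0 scale0r addr0 scaler_eq0 (negPf v0) orbF => /eqP.
  by [].
have : u^T = 0 by apply: col2_eq0.
by move=> /(congr1 trmx); rewrite trmxK trmx0.
Qed.

(** The coordinates come from a left inverse of the matrix with columns [v] and [w], so they are
    linear on the whole space and can cut out open sets there. *)
Lemma independent_coord v w : independent v w ->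
  exists f g : V -> R, [/\ continuous f, continuous g,
    forall x y, f (x *: v + y *: w) = x /\ g (x *: v + y *: w) = y &
    forall c u, f (c *: u) = c * f u /\ g (c *: u) = c * g u].
Proof.
move=> rk; have /row_freeP[D DE] : row_free (row_mx v w)^T.
  by rewrite -row_leq_rank mxrank_tr rk.
have GE : D^T *m row_mx v w = 1%:M by rewrite -[LHS]trmxK trmx_mul trmxK DE trmx1.
pose c (u : V) : 'cV[R]_(1 + 1) := D^T *m u.
have cE (i : 'I_(1 + 1)) : continuous (fun u => c u i ord0).
  move=> u; apply: (@cvg_mx_entry _ _ _ _ (nbhs u) _ c).
  exact: mulmxl_continuous.
exists (fun u => c u (lshift 1 ord0) ord0), (fun u => c u (rshift 1 ord0) ord0).
split; [exact: cE|exact: cE| |].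
- move=> x y; have -> : x *: v + y *: w = row_mx v w *m col_mx x%:M y%:M.
    by rewrite mul_row_col !mul_mx_scalar.
  by rewrite /c mulmxA GE mul1mx col_mxEu col_mxEd !mxE !mulr1n.
- by move=> a u; rewrite /c -scalemxAr !mxE.
Qed.

Lemma independent_neq0 v w x y : independent v w -> x *: v + y *: w = 0 ->
  x = 0 /\ y = 0.
Proof.
move=> /independent_coord[f [g [_ _ fg h]]] E.
have [fx gy] := fg x y; have [] := h 0 0; rewrite scale0r !mul0r => f0 g0.
by split; [rewrite -fx E|rewrite -gy E].
Qed.

End Independence.

Section ConvexLift.
Context {R : realType} {n : nat} (Om : set (RP R n)).
Local Notation V := 'cV[R]_n.+1.
Implicit Types v w u : V.
Local Notation Q := (cone Om).

Lemma coneZ (c : R) v : c != 0 -> Q v -> Q (c *: v).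
Proof. by move=> c0 [v0 Ov]; split; rewrite ?scaler_eq0 ?negb_or ?c0// pt_scale. Qed.

Lemma coneN v : Q v -> Q (- v).
Proof. by move=> Qv; rewrite -scaleN1r; apply: coneZ => //; rewrite oppr_eq0 oner_neq0. Qed.

(** [cone Om] contains the negatives of its vectors but not 0; a segment inside it therefore singles
    out a sign of [w] relative to [v]. *)
Definition seg_in v w := forall t : R, 0 <= t <= 1 -> Q ((1 - t) *: v + t *: w).

Lemma seg_in0 v w : seg_in v w -> (forall t, 0 <= t <= 1 -> (1 - t) *: v + t *: w <> 0).
Proof. by move=> s t /s[/eqP]. Qed.

Lemma seg_in_sym v w : seg_in v w -> seg_in w v.
Proof.
move=> s t t01; have -> : (1 - t) *: w + t *: v = (1 - (1 - t)) *: v + (1 - t) *: w.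
  by rewrite subKr addrC.
by apply: s; lra.
Qed.

Lemma seg_in_pos (c : R) v : 0 < c -> Q v -> seg_in v (c *: v).
Proof.
move=> c0 Qv t t01; rewrite scalerA -scalerDl; apply: coneZ => //.
by rewrite gt_eqF//; nra.
Qed.

Lemma seg_in_neg (c : R) v : c <= 0 -> ~ seg_in v (c *: v).
Proof.
move=> c0 /seg_in0 /(_ (1 - c)^-1); apply.
  by rewrite invr_ge0 invf_le1 ?subr_gt0; lra.
rewrite scalerA -scalerDl [X in X *: _](_ : _ = 0) ?scale0r//.
by field; rewrite subr_eq0 eq_sym lt_eqF//; lra.
Qed.

Context (pc : properly_convex Om).

(** If both segments left the cone, the two missing points would cut the projective line through [v]
    and [w] into two arcs separating [pt v] from [pt w], against connectedness. *)
Lemma seg_or v w : Q v -> Q w -> seg_in v w \/ seg_in v (- w).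
Proof.
move=> Qv Qw; have v0 : v != 0 by case: Qv. have w0 : w != 0 by case: Qw.
have [[c wE]|nc] := pselect (exists c : R, w = c *: v).
  have [c0|c0|c0] := ltgtP c 0.
  - by right; rewrite wE -scaleNr; apply: seg_in_pos => //; rewrite oppr_gt0.
  - by left; rewrite wE; exact: seg_in_pos.
  - by move: w0; rewrite wE c0 scale0r eqxx.
have ind : independent v w by apply: independentP => // c h; apply: nc; exists c.
apply: contrapT => /not_orP[/existsNP[t /not_implyP[t01 nQa]] /existsNP[s /not_implyP[s01 nQb]]].
have {}t01 : 0 < t < 1.
  rewrite !lt_neqAle; case/andP: t01 => -> ->; rewrite !andbT; apply/andP; split.
    by apply/eqP => t0; apply: nQa; rewrite -t0 subr0 scale1r scale0r addr0.
  by apply/eqP => t1; apply: nQa; rewrite t1 subrr scale1r scale0r add0r.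
have {}s01 : 0 < s < 1.
  rewrite !lt_neqAle; case/andP: s01 => -> ->; rewrite !andbT; apply/andP; split.
    by apply/eqP => t0; apply: nQb; rewrite -t0 subr0 scale1r scale0r addr0.
  apply/eqP => t1; apply: nQb; rewrite t1 subrr scale1r scale0r add0r.
  exact: coneN.
have [f [g [cf cg fg fgZ]]] := independent_coord ind.
(* The factors vanish at the two missing points. As [phi] is quadratic, its sign makes sense on
   projective points; it is negative at [v] and positive at [w]. *)
pose phi u := ((1 - t) * g u - t * f u) * ((1 - s) * g u + s * f u).
have cphi : continuous phi.
  have lin (a b : R) : continuous (fun u => a * g u + b * f u).
    move=> u; apply: (@continuousD R R^o V (fun u => a * g u) (fun u => b * f u)).
      by apply: (@continuousM R V (fun=> a) g); [exact: cst_continuous|exact: cg].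
    by apply: (@continuousM R V (fun=> b) f); [exact: cst_continuous|exact: cf].
  have -> : phi = (fun u => ((1 - t) * g u + (- t) * f u) * ((1 - s) * g u + s * f u)).
    by apply/funext => u; rewrite /phi mulNr.
  move=> u; apply: (@continuousM R V (fun u => (1 - t) * g u + (- t) * f u)); exact: lin.
have phiZ (c : R) u : phi (c *: u) = c ^+ 2 * phi u.
  by rewrite /phi; have [-> ->] := fgZ c u; ring.
have phiE x y : phi (x *: v + y *: w) = ((1 - t) * y - t * x) * ((1 - s) * y + s * x).
  by rewrite /phi; have [-> ->] := fg x y.
pose L : set (RP R n) := [set pt (row_mx v w *m c) | c in [set c : 'cV[R]_2 | c != 0]].
have LL : projective_line L by exists (row_mx v w).
have [conL _] := pc LL.
have Lxy p : L p -> exists x y : R, x *: v + y *: w != 0 /\ p = pt (x *: v + y *: w).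
  move=> [c /= c0 <-]; rewrite row_mx_comb.
  set x := usubmx _ _ _; set y := dsubmx _ _ _; exists x, y; split=> //.
  apply/eqP => /(independent_neq0 ind)[x0 y0]; case/eqP: c0.
  exact: (col2_eq0 x0 y0).
have LxyI x y : x *: v + y *: w != 0 -> L (pt (x *: v + y *: w)).
  pose c : 'cV[R]_(1 + 1) := col_mx x%:M y%:M.
  have cE : row_mx v w *m c = x *: v + y *: w by rewrite mul_row_col !mul_mx_scalar.
  move=> xy0; exists c; last by rewrite cE.
  by apply: contraNneq xy0 => c0; rewrite -cE c0 mulmx0.
pose Op : set (RP R n) := [set pt u | u in [set u | 0 < phi u] `&` [set u | u != 0]].
pose On : set (RP R n) := [set pt u | u in [set u | phi u < 0] `&` [set u | u != 0]].
have oOp : open Op.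
  by apply: pt_open; apply: (@open_comp _ _ phi [set x | 0 < x]) => [u _|]; [exact: cphi|exact: open_gt].
have oOn : open On.
  by apply: pt_open; apply: (@open_comp _ _ phi [set x | x < 0]) => [u _|]; [exact: cphi|exact: open_lt].
have OpP u : u != 0 -> Op (pt u) <-> 0 < phi u.
  move=> u0; split=> [[u' [/= h u'0] /pt_eq[]// c c0 ->]|h]; last by exists u.
  by rewrite phiZ mulr_gt0// exprn_even_gt0//= c0.
have OnP u : u != 0 -> On (pt u) <-> phi u < 0.
  move=> u0; split=> [[u' [/= h u'0] /pt_eq[]// c c0 ->]|h]; last by exists u.
  by rewrite phiZ pmulr_rlt0// exprn_even_gt0//= c0.
have phi0 x y : Q (x *: v + y *: w) -> phi (x *: v + y *: w) != 0.
  move=> Qxy; have xy0 := Qxy.1; rewrite phiE mulf_eq0 negb_or.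
  have [t0 s0] : (1 - t != 0) /\ (1 - s != 0) by split; rewrite gt_eqF//; lra.
  have x0 z : y = z * x -> x != 0.
    by move=> yE; apply: contraNneq xy0 => x0; rewrite yE x0 mulr0 !scale0r addr0.
  apply/andP; split; apply/eqP => h.
  - have yE : y = t / (1 - t) * x by apply: (mulfI t0); rewrite mulrA (mulrCA (1 - t)) mulfV// mulr1; lra.
    apply: nQa; have -> : (1 - t) *: v + t *: w = ((1 - t) / x) *: (x *: v + y *: w).
      rewrite scalerDr !scalerA yE divfK ?(x0 _ yE)//; congr (_ + _ *: _).
      by field; rewrite (x0 _ yE) t0.
    by apply: coneZ => //; rewrite mulf_neq0 ?invr_eq0 ?(x0 _ yE).
  - have yE : y = - (s / (1 - s)) * x by apply: (mulfI s0); rewrite mulrA mulrN (mulrCA (1 - s)) mulfV// mulr1; lra.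
    apply: nQb; have -> : (1 - s) *: v + s *: (- w) = ((1 - s) / x) *: (x *: v + y *: w).
      rewrite scalerDr !scalerA yE divfK ?(x0 _ yE)// scalerN -scaleNr; congr (_ + _ *: _).
      by field; rewrite (x0 _ yE) s0.
    by apply: coneZ => //; rewrite mulf_neq0 ?invr_eq0 ?(x0 _ yE).
have phiv : phi v < 0.
  have := phiE 1 0; rewrite scale1r scale0r addr0 => ->; nra.
have phiw : 0 < phi w.
  have := phiE 0 1; rewrite scale1r scale0r add0r => ->; nra.
have vL : L (pt v) by have := LxyI 1 0; rewrite scale1r scale0r addr0; apply.
have wL : L (pt w) by have := LxyI 0 1; rewrite scale1r scale0r add0r; apply.
have E : (Om `&` L) `&` Op = Om `&` L.
  apply: conL.
  - by exists (pt w); split; [split=> //; exact: Qw.2|exact/OpP].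
  - by exists Op.
  - exists (~` On); first exact: open_closedC.
    apply/seteqP; split=> p [[Op_ Lp] h]; split=> //;
      have [x [y [xy0 pE]]] := Lxy _ Lp; move: h; rewrite pE.
    + by move=> /OpP h /OnP h'; have := lt_trans (h xy0) (h' xy0); rewrite ltxx.
    + have : phi (x *: v + y *: w) != 0 by apply: phi0; split=> //; rewrite -pE.
      move=> ph0 h; apply/OpP => //; rewrite lt_neqAle eq_sym ph0/= leNgt.
      by apply/negP => h'; apply: h; apply/OnP.
have : (Om `&` L) (pt v) by split=> //; exact: Qv.2.
by rewrite -E => -[_ /OpP h]; have := lt_trans phiv (h v0); rewrite ltxx.
Qed.

End ConvexLift.

Section ConeOverConvex.
Context {R : realType} {n : nat} (Om : set (RP R n)).
Local Notation V := 'cV[R]_n.+1.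
Implicit Types v w u : V.
Local Notation Q := (cone Om).
Context (pc : properly_convex Om) (oOm : open Om).

(** Two segments inside the cone would together cover the whole projective line, which must have
    points outside [Om]. *)
Lemma seg_nand v w : Q v -> Q w -> seg_in Om v w -> seg_in Om v (- w) -> False.
Proof.
move=> Qv Qw s1 s2; have v0 := Qv.1; have w0 := Qw.1.
have [[c wE]|nc] := pselect (exists c : R, w = c *: v).
  have [c0|c0] := leP c 0; first by move: s1; rewrite wE; exact: seg_in_neg.
  by move: s2; rewrite wE -scaleNr; apply: seg_in_neg; rewrite oppr_le0 ltW.
have ind : independent v w by apply: independentP => // c h; apply: nc; exists c.
pose L : set (RP R n) := [set pt (row_mx v w *m c) | c in [set c : 'cV[R]_2 | c != 0]].
have LL : projective_line L by exists (row_mx v w).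
have [_ [p [_ [_ [Lp nOp] _]]]] := pc LL.
have H x y : 0 <= x -> x *: v + y *: w != 0 -> Q (x *: v + y *: w).
  move=> x0 xy0.
  have gen (z : R) w' : 0 <= z -> seg_in Om v w' -> x *: v + z *: w' != 0 ->
      Q (x *: v + z *: w').
    move=> z0 s xz0.
    have xz : x + z != 0.
      apply: contraNneq xz0 => /eqP; rewrite paddr_eq0// => /andP[/eqP -> /eqP ->].
      by rewrite !scale0r addr0.
    have -> : x *: v + z *: w' = (x + z) *: ((1 - z / (x + z)) *: v + (z / (x + z)) *: w').
      by rewrite scalerDr !scalerA; congr (_ *: _ + _ *: _); field.
    apply: coneZ => //; apply: s; have xz' : 0 < x + z by rewrite lt_def xz addr_ge0.
    by rewrite divr_ge0 ?(ltW xz')//= ler_pdivrMr// mul1r lerDr.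
  have [y0|y0] := leP 0 y; first exact: gen.
  have -> : y *: w = (- y) *: (- w) by rewrite scaleNr scalerN opprK.
  apply: gen => //; first by rewrite oppr_ge0 ltW.
  by rewrite scaleNr scalerN opprK.
move: Lp => [c /= c0 pE]; apply: nOp; rewrite -pE row_mx_comb.
set x := usubmx _ _ _; set y := dsubmx _ _ _.
have xy0 : x *: v + y *: w != 0.
  by apply/eqP => /(independent_neq0 ind)[x0 y0]; case/eqP: c0; exact: (col2_eq0 x0 y0).
have [x0|x0] := leP 0 x; first by have [] := H _ _ x0 xy0.
have x0' : 0 <= - x by rewrite oppr_ge0 ltW.
have xy0' : (- x) *: v + (- y) *: w != 0 by rewrite !scaleNr -opprD oppr_eq0.
have [_] := H _ _ x0' xy0'; rewrite !scaleNr -opprD -scaleN1r pt_scale// oppr_eq0 oner_neq0.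
Qed.

(** The tube lemma along the compact parameter interval. *)
Lemma seg_in_open v w : seg_in Om v w -> \forall u \near w, seg_in Om v u.
Proof.
move=> s; have oQ : open Q by apply/open_cone.
have c01 : compact `[0%R : R, 1%R] by exact: segment_compact.
have /compact_near_coveringP nc := c01.
have Hcov (t : R) : `[0%R : R, 1%R]%classic t ->
    \forall t' \near t & u \near w, Q ((1 - t') *: v + t' *: u).
  rewrite /= in_itv/= => /s Qt.
  have cf : {for (t, w), continuous (fun x : R * V => (1 - x.1) *: v + x.1 *: x.2)}.
    apply: (@continuousD R V (R * V)%type (fun x => (1 - x.1) *: v) (fun x => x.1 *: x.2)).
      apply: (@continuous_comp _ _ _ (fun x : R * V => 1 - x.1) (fun a : R => a *: v)).
        apply: (@continuousB R R^o (R * V)%type (fun=> 1) fst); first exact: cst_continuous.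
        exact: cvg_fst.
      exact: scalel_continuous.
    exact: (@scale_continuous R V (t, w)).
  have /cf [[A B] /= [nA nB] AB] : nbhs ((1 - t) *: v + t *: w) Q by exact: open_nbhs_nbhs.
  by exists (A, B) => //= -[a b] /= [Aa Bb]; apply: (AB (a, b)).
have h0 := nc _ (nbhs w) (fun u t => Q ((1 - t) *: v + t *: u)) (nbhs_filter w) Hcov.
apply: filterS h0 => u h t t01; apply: h.
by rewrite /= in_itv/=.
Qed.

(** [K] consists of the vectors joined to a base vector [v0] inside [cone Om]. That any two of them
    are joined, whence convexity, follows by moving one end of a segment along another segment. *)
Theorem convex_lift : Om !=set0 -> exists K : set V,
  [/\ open K, K !=set0, forall u v, K u -> K v -> K (u + v),
      forall (c : R) u, 0 < c -> K u -> K (c *: u) &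
      [/\ forall v, Q v <-> K v \/ K (- v), forall v, K v -> K (- v) -> False &
        forall v, closure K v -> closure K (- v) -> v = 0]].
Proof.
move=> [p0 Op0]; have [v0 v0n0 v0E] : exists2 v, v != 0 & p0 = pt v.
  by exists (vec_of p0); rewrite ?vec_of_neq0 ?vec_ofK.
have Qv0 : Q v0 by split=> //; rewrite -v0E.
pose K := [set v | Q v /\ seg_in Om v0 v].
have oQ : open Q by apply/open_cone.
have QK v : Q v -> K v \/ K (- v).
  move=> Qv; have [h|h] := seg_or pc Qv0 Qv; [left|right]; split=> //.
  exact: coneN.
have KN v : K v -> K (- v) -> False.
  by move=> [Qv s1] [_ s2]; exact: (seg_nand Qv0 Qv).
have oK : open K.
  rewrite openE => v [Qv s].
  have h1 : \forall u \near v, Q u by exact: open_nbhs_nbhs.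
  have h2 := seg_in_open s.
  by near=> u; split; near: u.
have Kv0 : K v0.
  by split=> //; have := @seg_in_pos _ _ Om 1 v0 ltr01 Qv0; rewrite scale1r.
have segK v w : K v -> K w -> seg_in Om v w.
  move=> [Qv sv] [Qw sw].
  pose p t := (1 - t) *: v0 + t *: w.
  have cp : continuous p by exact: segment_continuous.
  have p0E : p 0 = v0 by rewrite /p subr0 scale1r scale0r addr0.
  have p1E : p 1 = w by rewrite /p subrr scale0r scale1r add0r.
  rewrite -p1E.
  (* While the end point moves from [v0] to [w], the sign for which the segment from [v] stays
     inside cannot change. *)
  apply: (@real_segment_connected R (fun t => seg_in Om v (p t)) (fun t => seg_in Om v (- p t))).
  - by rewrite p0E; exact: seg_in_sym.
  - by move=> t /sw; exact: seg_or.
  - move=> t s1 s2; have Qp : Q (p t).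
      by have := s1 1; rewrite subrr scale0r scale1r add0r; apply; rewrite ler01 lexx.
    exact: (seg_nand Qv Qp).
  - move=> t _ s.
    have h0 : \forall u \near t, seg_in Om v (p u) by exact: (cp t _ (seg_in_open s)).
    by apply: filterS h0.
  - move=> t _ s.
    have cNp : {for t, continuous (fun t => - p t)} by apply: continuousN; exact: cp.
    have h0 : \forall u \near t, seg_in Om v (- p u) by exact: (cNp _ (seg_in_open s)).
    by apply: filterS h0.
have segKK v w t : K v -> K w -> 0 <= t <= 1 -> K ((1 - t) *: v + t *: w).
  move=> Kv Kw t01; have s := segK _ _ Kv Kw; have Qu := s _ t01.
  have [//|KNu] := QK _ Qu; exfalso.
  apply: (seg_nand Kv.1 Qu); last by apply: segK.
  move=> r r01; have -> : (1 - r) *: v + r *: ((1 - t) *: v + t *: w) =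
      (1 - r * t) *: v + (r * t) *: w.
    by rewrite scalerDr !scalerA addrA -scalerDl; congr (_ *: _ + _); ring.
  case/andP: t01 => t0 t1; case/andP: r01 => r0 r1.
  by apply: s; rewrite mulr_ge0//= mulr_ile1.
have KZ (c : R) u : 0 < c -> K u -> K (c *: u).
  move=> c0 Ku; have Qcu : Q (c *: u) by apply: coneZ; [rewrite gt_eqF|exact: Ku.1].
  have [//|KNcu] := QK _ Qcu; have := segK _ _ Ku KNcu.
  by rewrite -scaleNr => /seg_in_neg []; rewrite oppr_le0 ltW.
have KD u v : K u -> K v -> K (u + v).
  move=> Ku Kv; have -> : u + v = 2 *: ((1 - 2^-1) *: u + 2^-1 *: v).
    rewrite scalerDr !scalerA; have -> : 2 * (1 - 2^-1) = 1 :> R by field.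
    by rewrite mulfV// !scale1r.
  by apply: KZ => //; apply: segKK => //; rewrite invr_ge0 invf_le1// ler0n ler1n.
exists K; split=> //; first by exists v0.
split=> //.
  move=> v; split; first exact: QK.
  by move=> [[]//|[/coneN + _]]; rewrite opprK.
have KcK u k : K u -> closure K k -> K (u + k).
  move=> Ku clk.
  have /nbhs_ballP[e e0 he] : nbhs u K by exact: open_nbhs_nbhs.
  have [k' [Kk' kk']] := clk _ (nbhsx_ballx k e e0).
  have -> : u + k = (u + (k - k')) + k' by rewrite -addrA subrK.
  apply: KD => //; apply: he; rewrite -ball_normE /ball_/= opprD addrA subrr sub0r normrN.
  by move: kk'; rewrite -ball_normE.
have clZ (c : R) k : 0 < c -> closure K k -> closure K (c *: k).
  move=> c0 clk B /(@scaler_continuous R V c k) nB.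
  by have [k' [Kk' Bk']] := clk _ nB; exists (c *: k'); split=> //; exact: KZ.
move=> z cz cNz; apply: contrapT => /eqP z0.
(* If [z] and [- z] are both limits of [K], the whole affine line through [v0] in the direction [z]
   lies in [K], so the projective line through them misses at most the point [pt z] of [Om], where
   two missing points are required. *)
have Kline (t : R) : K (v0 + t *: z).
  have [t0|t0|->] := ltgtP t 0; last by rewrite scale0r addr0.
    have -> : t *: z = (- t) *: (- z) by rewrite scaleNr scalerN opprK.
    by apply: KcK => //; apply: clZ => //; rewrite oppr_gt0.
  by apply: KcK => //; exact: clZ.
have [[c zE]|nc] := pselect (exists c : R, v0 = c *: z).
  by have [[]] := Kline (- c); rewrite {1}zE scaleNr subrr eqxx.
have ind : independent z v0 by apply: independentP => // c h; apply: nc; exists c.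
pose L : set (RP R n) := [set pt (row_mx z v0 *m c) | c in [set c : 'cV[R]_2 | c != 0]].
have LL : projective_line L by exists (row_mx z v0).
have [_ [p [q [pq [Lp nOp] [Lq nOq]]]]] := pc LL.
have H r : L r -> ~ Om r -> r = pt z.
  move=> [c /= c0 <-]; rewrite row_mx_comb.
  set x := usubmx _ _ _; set y := dsubmx _ _ _ => nO.
  have y0 : y = 0.
    apply: contrapT => /eqP y0; apply: nO.
    have -> : x *: z + y *: v0 = y *: (v0 + (x / y) *: z).
      by rewrite scalerDr scalerA mulrC divfK// addrC.
    by have [/(coneZ y0)[]] := Kline (x / y).
  have x0 : x != 0.
    by apply: contraNneq c0 => x0; apply/eqP; exact: (col2_eq0 x0 y0).
  by rewrite y0 scale0r addr0 pt_scale.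
exact: (pq (etrans (H p Lp nOp) (esym (H q Lq nOq)))).
Unshelve. all: by end_near.
Qed.

End ConeOverConvex.

(** * Normality of closed pointed cones *)

Section NormalCone.
Context {R : realType} {n : nat}.
Local Notation V := 'cV[R]_n.+1.

(** For [a] in [C] of norm 1 and [k] in [C], the norm of [a + k] is bounded below: near each [a]
    this holds because [- a] is outside the closed set [C], and the unit ball is compact. Then
    [b = a + (b - a)] is rescaled. *)
Lemma cone_normal (C : set V) : closed C -> convex_cone C -> pointed_cone C ->
  exists2 c : R, 0 < c & forall a b : V, C a -> C (b - a) -> `|a| <= c * `|b|.
Proof.
move=> clC [K0 KD KZ] pC.
pose P (A : set V) := exists2 d : R, 0 < d &
  forall a k, A a -> `|a| = 1 -> C a -> C k -> d <= `|a + k|.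
have [d d0 hd] : P [set a : V | `|a| <= 1].
  apply: compact_ind.
  - apply: (@mx_bounded_closed_compact _ _ _ _ 1) => //.
    apply: (@closed_comp _ _ (fun X : V => `|X|) [set x : R | x <= 1]).
      by move=> X _; exact: norm_continuous.
    exact: closed_le.
  - by exists 1.
  - move=> A B [d d0 hA] [e e0 hB]; exists (Num.min d e); first by rewrite lt_min d0.
    by move=> a k [Aa|Ba] a1 ca ck; rewrite ge_min; apply/orP; [left; exact: hA|right; exact: hB].
  - by move=> A B AB [d d0 hB]; exists d => // a k /AB; exact: hB.
  - move=> a _.
    have [Na|Na] := pselect (C (- a)).
      have [ca|nca] := pselect (C a).
        have a0 : a = 0 by exact: pC.
        exists (ball a 1); first exact: nbhsx_ballx.
        exists 1 => // b k; rewrite a0 -ball_normE /ball_/= sub0r normrN => + b1.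
        by rewrite b1 ltxx.
      have /nbhs_ballP[e e0 he] : nbhs a (~` C).
        by apply: open_nbhs_nbhs; split=> //; exact: closed_openC.
      exists (ball a e); first exact: nbhsx_ballx.
      by exists 1 => // b k /he.
    have /nbhs_ballP[e e0 he] : nbhs (- a) (~` C).
      by apply: open_nbhs_nbhs; split=> //; exact: closed_openC.
    exists (ball a (e / 2)); first by apply: nbhsx_ballx; rewrite divr_gt0.
    exists (e / 2) => [|b k]; first by rewrite divr_gt0.
    rewrite -ball_normE /ball_/= => ab _ _ ck; rewrite leNgt; apply/negP => bk.
    apply: (he k) => //; rewrite -ball_normE /ball_/=.
    have -> : - a - k = (b - a) - (b + k) by rewrite opprD addrACA subrr add0r.
    apply: le_lt_trans (ler_normB _ _) _; rewrite distrC (splitr e).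
    exact: ltrD.
exists d^-1; first by rewrite invr_gt0.
move=> a b ca cba; have [a0|a0] := eqVneq a 0.
  by rewrite a0 normr0 mulr_ge0// invr_ge0 ltW.
have a0' : 0 < `|a| by rewrite normr_gt0.
have a1 : `| `|a|^-1 *: a| = 1.
  by rewrite normrZ ger0_norm ?invr_ge0// mulVf// gt_eqF.
have := hd (`|a|^-1 *: a) (`|a|^-1 *: (b - a)).
rewrite /= a1 lexx -scalerDr [a + _]addrC subrK normrZ ger0_norm ?invr_ge0// => h.
have : d <= `|a|^-1 * `|b| by apply: h => //; apply: KZ; rewrite ?invr_ge0.
by rewrite ler_pdivlMl// mulrC -ler_pdivlMl// mulrC.
Qed.

End NormalCone.

Section LiftedCone.
Context {R : realType} {n : nat}.
Local Notation V := 'cV[R]_n.+1.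
Local Notation M := 'M[R]_n.+1.
Implicit Types u v w : V.

(** One of the two opposite nappes of [cone Om], with the properties obtained in [convex_lift]. *)
Definition is_lift (Om : set (RP R n)) (K : set V) :=
  [/\ open K, K !=set0, forall u v, K u -> K v -> K (u + v),
      forall (c : R) u, 0 < c -> K u -> K (c *: u) &
      [/\ forall v, cone Om v <-> K v \/ K (- v), forall v, K v -> K (- v) -> False &
        forall v, closure K v -> closure K (- v) -> v = 0]].

Context (Om : set (RP R n)) (K : set V) (hK : is_lift Om K).
Local Notation Kc := (closure K).

Lemma liftN0 : ~ K 0.
Proof. by have [_ _ _ _ [_ KN _]] := hK => K0; apply: (KN 0); rewrite ?oppr0. Qed.

Lemma lift_neq0 v : K v -> v != 0.
Proof. by move=> Kv; apply/eqP => v0; apply: liftN0; rewrite -v0. Qed.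

Lemma lift_clD u k : K u -> Kc k -> K (u + k).
Proof.
have [oK _ KD _ _] := hK => Ku clk.
have /nbhs_ballP[e e0 he] : nbhs u K by exact: open_nbhs_nbhs.
have [k' [Kk' kk']] := clk _ (nbhsx_ballx k e e0).
have -> : u + k = (u + (k - k')) + k' by rewrite -addrA subrK.
apply: KD => //; apply: he; rewrite -ball_normE /ball_/= opprD addrA subrr sub0r normrN.
by move: kk'; rewrite -ball_normE.
Qed.

Lemma lift_limit u w : K w -> (forall e : R, 0 < e -> K (u + e *: w)) -> Kc u.
Proof.
move=> Kw h; apply: (@closed_approx_ray R V Kc u w); first exact: closed_closure.
by move=> k; apply: subset_closure; apply: h; rewrite invr_gt0.
Qed.

Lemma lift_cl_cone : convex_cone Kc.
Proof.
have [oK [w Kw] KD KZ _] := hK; split.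
- by apply: (lift_limit Kw) => e e0; rewrite add0r; exact: KZ.
- move=> u v cu cv; apply: (lift_limit Kw) => e e0.
  have -> : u + v + e *: w = e *: w + u + v by rewrite [e *: w + u]addrC addrAC.
  by apply: lift_clD => //; apply: lift_clD => //; exact: KZ.
- move=> c u; rewrite le_eqVlt => /predU1P[<- _|c0 cu].
    by rewrite scale0r; apply: (lift_limit Kw) => e e0; rewrite add0r; exact: KZ.
  move=> B /(@scaler_continuous R V c u) nB.
  by have [k' [Kk' Bk']] := cu _ nB; exists (c *: k'); split=> //; exact: KZ.
Qed.

Lemma lift_pointed : pointed_cone Kc.
Proof. by have [_ _ _ _ [_ _ h]] := hK => v; exact: h. Qed.

Lemma lift_normal : exists2 C : R, 0 < C &
  forall a b : V, Kc a -> Kc (b - a) -> `|a| <= C * `|b|.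
Proof. exact: cone_normal (@closed_closure _ K) lift_cl_cone lift_pointed. Qed.

Lemma lift_pt v : K v -> Om (pt v).
Proof. by have [_ _ _ _ [Q _ _]] := hK => Kv; have [] : cone Om v by apply/Q; left. Qed.

Lemma lift_rep p : Om p -> exists2 v, K v & p = pt v.
Proof.
have [_ _ _ _ [Q _ _]] := hK => Op.
have : cone Om (vec_of p) by split; rewrite ?vec_of_neq0 ?vec_ofK.
move=> /Q[h|h]; first by exists (vec_of p); rewrite ?vec_ofK.
exists (- vec_of p) => //.
by rewrite -scaleN1r pt_scale ?vec_ofK ?vec_of_neq0// oppr_eq0 oner_neq0.
Qed.

Lemma lift_pt_eq v w : K v -> K w -> pt v = pt w -> exists2 c : R, 0 < c & w = c *: v.
Proof.
have [_ _ _ KZ [_ KN _]] := hK => Kv Kw /pt_eq[]; try exact: lift_neq0.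
move=> c c0 wE; exists c => //; rewrite lt_neqAle eq_sym c0 leNgt; apply/negP => c1.
apply: (KN w) => //; rewrite wE -scaleNr; apply: KZ => //.
by rewrite oppr_gt0.
Qed.

Lemma lift_seg v w t : K v -> K w -> 0 <= t <= 1 -> K ((1 - t) *: v + t *: w).
Proof.
have [_ _ KD KZ _] := hK => Kv Kw /andP[t0 t1].
move: t0; rewrite le_eqVlt => /predU1P[<-|t0].
  by rewrite subr0 scale1r scale0r addr0.
move: t1; rewrite le_eqVlt => /predU1P[->|t1].
  by rewrite subrr scale0r scale1r add0r.
by apply: KD; apply: KZ => //; rewrite subr_gt0.
Qed.

Lemma lift_conn (v w : V) :
  K v -> (forall t, 0 <= t <= 1 -> cone Om ((1 - t) *: v + t *: w)) -> K w.
Proof.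
have [oK _ KD KZ [Q KN _]] := hK => Kv s.
pose p t : V := (1 - t) *: v + t *: w.
have cp : continuous p by exact: segment_continuous.
have -> : w = p 1 by rewrite /p subrr scale0r scale1r add0r.
apply: (@real_segment_connected R (fun t => K (p t)) (fun t => K (- p t))).
- by rewrite /p subr0 scale1r scale0r addr0.
- by move=> t /s /Q.
- by move=> t; exact: KN.
- move=> t _ Kp; have h0 : \forall u \near t, K (p u).
    by apply: (cp t); exact: open_nbhs_nbhs.
  by apply: filterS h0.
- move=> t _ Kp.
  have cNp : {for t, continuous (fun t => - p t)} by apply: continuousN; exact: cp.
  have h0 : \forall u \near t, K (- p u) by apply: cNp; exact: open_nbhs_nbhs.
  by apply: filterS h0.
Qed.

(** Preserving [K], instead of exchanging it with its opposite, fixes the sign of the matrix; a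
    positive factor remains free. *)
Definition lifts (g : PGL R n.+1) (A : M) :=
  [/\ A \in unitmx, g = pgl A, forall v, K v -> K (A *m v) &
      forall v, K v -> K (invmx A *m v)].

(** The sign is chosen at a single vector [v0]; along segments from [v0] the image cannot pass to
    the other nappe. *)
Lemma lift_exists g : (pact g @` Om = Om) -> exists A, lifts g A.
Proof.
have [oK [v0 Kv0] KD KZ [Q KN _]] := hK => gOm.
pose A0 := mat_of g; have uA0 : A0 \in unitmx := mat_of_unit g.
have gE : g = pgl A0 by rewrite mat_ofK.
have QA v : cone Om v -> cone Om (A0 *m v).
  move=> [v0' Ov]; split; first exact: mulmx_neq0.
  by rewrite -pactE// -gE -gOm; exists (pt v).
have QAV v : cone Om v -> cone Om (invmx A0 *m v).
  move=> [v0' Ov]; split; first by apply: mulmx_neq0 => //; rewrite unitmx_inv.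
  have [q Oq] : (pact g @` Om) (pt v) by rewrite gOm.
  rewrite gE; move: Oq; rewrite -(vec_ofK q); move: (vec_of q) (vec_of_neq0 q) => w w0 Ow; rewrite pactE// => /pt_eq[||c c0 ->]//; first exact: mulmx_neq0.
  by rewrite -scalemxAr mulKmx// pt_scale.
have QK v : K v -> cone Om v by move=> Kv; apply/Q; left.
have [A [uA AE KA0 QA' QAV']] : exists A : M, [/\ A \in unitmx, g = pgl A, K (A *m v0),
    forall v, cone Om v -> cone Om (A *m v) &
    forall v, cone Om v -> cone Om (invmx A *m v)].
  have /Q[h|h] := QA _ (QK _ Kv0); first by exists A0.
  exists (- A0); split.
  - by rewrite -scaleN1r unitmxZ// unitrN1.
  - rewrite gE; apply/pgl_eq => //; first by rewrite -scaleN1r unitmxZ// unitrN1.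
    by exists (-1); rewrite ?oppr_eq0 ?oner_neq0// scaleN1r.
  - by rewrite mulNmx.
  - by move=> v /QA /coneN; rewrite mulNmx.
  - have -> : invmx (- A0) = - invmx A0.
      by rewrite -[- A0]scaleN1r invmxZ ?unitmxZ ?unitrN1// invrN1 scaleN1r.
    by move=> v /QAV /coneN; rewrite mulNmx.
have KA v : K v -> K (A *m v).
  move=> Kv; apply: (lift_conn KA0) => t t01.
  by rewrite !scalemxAr -mulmxDr; apply/QA'/QK; exact: lift_seg.
exists A; split=> // v Kv.
have /Q[//|h] := QAV' _ (QK _ Kv).
by have := KA _ h; rewrite mulmxN mulKVmx// => /(KN v Kv).
Qed.

Lemma lifts_cl g A v : lifts g A -> Kc v -> Kc (A *m v).
Proof.
move=> [_ _ KA _] cv B nB.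
have [k [Kk Bk]] := cv _ (@mulmxl_continuous R n.+1 n.+1 1 A v B nB).
by exists (A *m k); split=> //; exact: KA.
Qed.

Lemma liftsM g h A B : lifts g A -> lifts h B -> lifts (g * h)%g (A *m B).
Proof.
move=> [uA -> KA KAV] [uB -> KB KBV]; split.
- by rewrite unitmx_mul uA.
- by rewrite pglM.
- by move=> v Kv; rewrite -mulmxA; apply/KA/KB.
- move=> v Kv; have -> : invmx (A *m B) = invmx B *m invmx A.
    have uAB : A *m B \in unitmx by rewrite unitmx_mul uA.
    by rewrite -[RHS](mulKmx uAB) -!mulmxA mulKVmx// mulmxV// mulmx1.
  by rewrite -mulmxA; apply/KBV/KAV.
Qed.

Lemma liftsV g A : lifts g A -> lifts g^-1%g (invmx A).
Proof.
by move=> [uA -> KA KAV]; split; rewrite ?unitmx_inv ?pglV// invmxK.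
Qed.

Lemma liftsZ (c : R) g A : 0 < c -> lifts g A -> lifts g (c *: A).
Proof.
have [_ _ _ KZ _] := hK => c0 [uA gE KA KAV]; have cu : c \is a GRing.unit.
  by rewrite unitfE gt_eqF.
split.
- by rewrite unitmxZ.
- rewrite gE; apply/pgl_eq; rewrite ?unitmxZ//.
  by exists c => //; rewrite gt_eqF.
- by move=> v Kv; rewrite -scalemxAl; apply/KZ/KA.
- by move=> v Kv; rewrite invmxZ ?unitmxZ// -scalemxAl; apply: KZ; rewrite ?invr_gt0//; exact: KAV.
Qed.

Lemma lifts_pact g A v : lifts g A -> K v -> pact g (pt v) = pt (A *m v).
Proof. by move=> [uA -> _ _] /lift_neq0 v0; rewrite pactE. Qed.

End LiftedCone.

(** * The Hilbert metric *)

Section ClosedLift.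
Context {R : realType} {n : nat}.
Local Notation V := 'cV[R]_n.+1.
Local Notation M := 'M[R]_n.+1.

Fact ccl_key : unit. Proof. exact: tt. Qed.
(* Locked, so that unification never unfolds the closure. *)
Definition ccl (K : set V) : set V := locked_with ccl_key (closure K).

Lemma cclE K : ccl K = closure K. Proof. by rewrite /ccl unlock. Qed.

Context (Om : set (RP R n)) (K : set V) (hK : is_lift Om K).

Lemma ccl_closed : closed (ccl K).
Proof. rewrite cclE; exact: closed_closure. Qed.

Lemma ccl_cone : convex_cone (ccl K).
Proof. rewrite cclE; exact: lift_cl_cone hK. Qed.

Lemma ccl0 : ccl K 0. Proof. by have [] := ccl_cone. Qed.
Lemma cclD u v : ccl K u -> ccl K v -> ccl K (u + v).
Proof. by have [_ h _] := ccl_cone; exact: h. Qed.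
Lemma cclZ (c : R) u : 0 <= c -> ccl K u -> ccl K (c *: u).
Proof. by have [_ _ h] := ccl_cone; exact: h. Qed.

Lemma ccl_pointed v : ccl K v -> ccl K (- v) -> v = 0.
Proof. rewrite cclE; exact: (lift_pointed hK). Qed.

Lemma ccl_normal : exists2 C : R, 0 < C &
  forall a b : V, ccl K a -> ccl K (b - a) -> `|a| <= C * `|b|.
Proof. rewrite cclE; exact: (lift_normal hK). Qed.

Lemma ccl_sub u : K u -> ccl K u.
Proof. rewrite cclE; exact: subset_closure. Qed.

Lemma liftD_ccl u k : K u -> ccl K k -> K (u + k).
Proof. rewrite cclE; exact: (lift_clD hK). Qed.

Lemma ccl_limit u w : K w -> (forall e : R, 0 < e -> K (u + e *: w)) -> ccl K u.
Proof. rewrite cclE; exact: lift_limit. Qed.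

Lemma lifts_ccl g A v : lifts K g A -> ccl K v -> ccl K (A *m v).
Proof. rewrite cclE; exact: lifts_cl. Qed.

End ClosedLift.

Section HilbertComparison.
Context {R : realType} {n : nat}.
Local Notation V := 'cV[R]_n.+1.
Local Notation M := 'M[R]_n.+1.
Context (Om : set (RP R n)) (K : set V) (hK : is_lift Om K).

(* For 0 < d, comparability of two lifts in the order of the cone is a Hilbert
   ball: the Hilbert distance is at most ln (1 + d) / 2. *)
Definition close (d : R) (p q : RP R n) := exists u v : V,
  [/\ K u, K v, p = pt u, q = pt v & ccl K (v - u) /\ ccl K ((1 + d) *: u - v)].

Lemma close_refl d p : 0 <= d -> Om p -> close d p p.
Proof.
move=> d0 /(lift_rep hK)[u Ku ->]; exists u, u; split=> //.
have [C0 CD CZ] := ccl_cone hK.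
rewrite subrr scalerDl scale1r addrC addKr; split=> //.
by apply: CZ => //; exact: (ccl_sub).
Qed.

Lemma close_mono d d' p q : d <= d' -> close d p q -> close d' p q.
Proof.
move=> dd [u [v [Ku Kv pE qE [c1 c2]]]]; exists u, v; split=> //; split=> //.
have [_ CD CZ] := ccl_cone hK.
have -> : (1 + d') *: u - v = ((1 + d) *: u - v) + (d' - d) *: u.
  by rewrite addrAC -scalerDl; congr (_ *: _ - _); ring.
apply: CD => //; apply: CZ; first by rewrite subr_ge0.
exact: (ccl_sub).
Qed.

Lemma close_pact d g A p q : lifts K g A -> close d p q ->
  close d (pact g p) (pact g q).
Proof.
move=> gA [u [v [Ku Kv -> -> [c1 c2]]]]; exists (A *m u), (A *m v).
have [_ _ KA _] := gA.
split; [exact: KA|exact: KA|exact: (lifts_pact hK gA Ku)|exact: (lifts_pact hK gA Kv)|].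
split; first by rewrite -mulmxBr; exact: (lifts_ccl gA c1).
by rewrite scalemxAr -mulmxBr; exact: (lifts_ccl gA c2).
Qed.

Lemma close_from d p q u : 0 <= d -> K u -> p = pt u -> close d p q ->
  exists v, [/\ K v, q = pt v, ccl K (v - u) & ccl K ((1 + d) *: u - v)].
Proof.
have [_ _ _ KZ _] := hK; have [_ _ CZ] := ccl_cone hK.
move=> d0 Ku -> [u' [v [Ku' Kv /esym pE qE [c1 c2]]]].
have [c c0 uE] := lift_pt_eq hK Ku' Ku pE.
exists (c *: v); split; first exact: KZ.
- by rewrite qE pt_scale ?(lift_neq0 hK Kv)// gt_eqF.
- by rewrite uE -scalerBr; apply: CZ => //; exact: ltW.
- rewrite uE scalerA mulrC -scalerA -scalerBr; apply: CZ => //; exact: ltW.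
Qed.

Lemma close_from_r d p q v : 0 <= d -> K v -> q = pt v -> close d p q ->
  exists u, [/\ K u, p = pt u, ccl K (v - u) & ccl K ((1 + d) *: u - v)].
Proof.
have [_ _ _ KZ _] := hK; have [_ _ CZ] := ccl_cone hK.
move=> d0 Kv -> [u [v' [Ku Kv' pE /esym qE [c1 c2]]]].
have [c c0 vE] := lift_pt_eq hK Kv' Kv qE.
exists (c *: u); split; first exact: KZ.
- by rewrite pE pt_scale ?(lift_neq0 hK Ku)// gt_eqF.
- by rewrite vE -scalerBr; apply: CZ => //; exact: ltW.
- rewrite vE scalerA mulrC -scalerA -scalerBr; apply: CZ => //; exact: ltW.
Qed.

(** Small Hilbert balls are small in projective space: by normality of the cone, a vector comparable
    to [u] within the factor [1 + d] differs from it by a multiple of [d] times the norm of [u]. *)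
Lemma close_nbhs x (U : set (RP R n)) : Om x -> nbhs x U ->
  exists2 W : set (RP R n), open W /\ W x &
  exists2 d : R, 0 < d & forall y z, close d y z -> (W y -> U z) /\ (W z -> U y).
Proof.
move=> Ox nU; have [v Kv xE] := lift_rep hK Ox.
have v0 := lift_neq0 hK Kv.
have : nbhs v (pt @^-1` U) by apply: (pt_continuous v0); rewrite -xE.
move=> /nbhs_ballP[r r0 hr].
have [C C0 hC] := ccl_normal hK.
have [oK _ _ _ _] := hK.
have /nbhs_ballP[s /= s0 hs] : nbhs v K by apply: open_nbhs_nbhs; split.
pose t := Num.min s (r / 2).
have t0 : 0 < t by rewrite lt_min s0 divr_gt0.
exists [set pt u | u in ball v t `&` [set u | u != 0]].
  split; first exact/pt_open/ball_open.
  by exists v => //; split=> //; exact: ballxx.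
pose B := `|v| + t.
have B0 : 0 < B by rewrite ltr_wpDl.
(* [B] bounds the norm of the representatives near [v]. Moving from the smaller vector to the larger
   costs [C * d * B], the converse [C * C * d * B]; the factor [C * (1 + C)] covers both. *)
pose d := r / 2 / ((C * (1 + C)) * B + 1).
have den0 : 0 < (C * (1 + C)) * B + 1.
  by have := mulr_gt0 (mulr_gt0 C0 (addr_gt0 ltr01 C0)) B0; lra.
have d0 : 0 < d by apply: divr_gt0 => //; apply: divr_gt0.
have dB : C * (1 + C) * d * B < r / 2.
  have -> : C * (1 + C) * d * B = (C * (1 + C) * B) * (r / 2) / (C * (1 + C) * B + 1).
    by rewrite /d; field; rewrite gt_eqF.
  by rewrite ltr_pdivrMr// [ltRHS]mulrC ltr_pM2r ?divr_gt0// ltrDl ltr01.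
have near_v u : ball v t u -> [/\ K u, `|u| <= B & `|v - u| < r / 2].
  move=> bu; split.
  - apply: hs; move: bu; rewrite -!ball_normE /ball_/= /t lt_min => /andP[].
    by [].
  - rewrite /B -lerBlDl; apply: le_trans (lerB_dist _ _) _; rewrite distrC.
    by apply: ltW; move: bu; rewrite -ball_normE.
  - by move: bu; rewrite -ball_normE /ball_/= /t lt_min => /andP[].
have fin u w : ball v t u -> `|u - w| <= C * (1 + C) * d * B -> ball v r w.
  move=> /near_v[_ _ vu] uw; rewrite -ball_normE /ball_/=.
  have -> : v - w = (v - u) + (u - w) by rewrite addrA subrK.
  apply: le_lt_trans (ler_normD _ _) _; rewrite (splitr r); apply: ltrD => //.
  exact: le_lt_trans uw dB.
exists d => // y z yz; split=> -[u [bu u0] E].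
- have [Ku uB _] := near_v u bu.
  have [w [Kw -> c1 c2]] := close_from (ltW d0) Ku (esym E) yz.
  apply: hr; apply: (fin u) => //; rewrite distrC.
  have h := hC (w - u) (d *: u) c1; rewrite opprB addrCA in h.
  have : `|w - u| <= C * `|d *: u|.
    by apply: h; move: c2; rewrite scalerDl scale1r -addrA.
  move/le_trans; apply; rewrite normrZ ger0_norm ?(ltW d0)//.
  have : C * (d * `|u|) <= C * (d * B) by apply: ler_wpM2l; rewrite ?(ltW C0)//; apply: ler_wpM2l; rewrite ?(ltW d0).
  move/le_trans; apply.
  have : 0 <= C * C * (d * B) by apply: mulr_ge0; apply: mulr_ge0; apply: ltW.
  by move: (B) (d) => B' d'; lra.
- have [Ku uB _] := near_v u bu.
  have [w [Kw -> c1 c2]] := close_from_r (ltW d0) Ku (esym E) yz.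
  apply: hr; apply: (fin u) => //.
  have h : `|u - w| <= C * `|d *: w|.
    apply: hC => //; rewrite opprB addrCA.
    by move: c2; rewrite scalerDl scale1r -addrA.
  have hw : `|w| <= C * `|u| by apply: hC => //; exact: (ccl_sub).
  apply: le_trans h _; rewrite normrZ ger0_norm ?(ltW d0)//.
  have : C * (d * `|w|) <= C * (d * (C * B)).
    apply: ler_wpM2l; rewrite ?(ltW C0)//; apply: ler_wpM2l; rewrite ?(ltW d0)//.
    by apply: le_trans hw _; apply: ler_wpM2l; rewrite ?(ltW C0).
  move/le_trans; apply.
  have : 0 <= C * (d * B) by do 2?apply: mulr_ge0; apply: ltW.
  by move: (B) (d) => B' d'; lra.
Qed.

End HilbertComparison.

Section HilbertBound.
Context {R : realType} {n : nat}.
Local Notation V := 'cV[R]_n.+1.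
Context (Om : set (RP R n)) (K : set V) (hK : is_lift Om K).
Implicit Types u v w : V.

Lemma ptN v : pt (- v) = pt v.
Proof.
have [->|v0] := eqVneq v 0; first by rewrite oppr0.
by rewrite -scaleN1r pt_scale// oppr_eq0 oner_neq0.
Qed.

Lemma itv_convex (a b x z t : R) : a < x < b -> a < z < b -> 0 <= t <= 1 ->
  a < (1 - t) * x + t * z < b.
Proof.
move=> /andP[ax xb] /andP[az zb] /andP[t0 t1].
have [th|th] := leP t (1 / 2).
  have h1 : 0 < (1 - t) * (x - a) by rewrite mulr_gt0//; lra.
  have h2 : 0 < (1 - t) * (b - x) by rewrite mulr_gt0//; lra.
  have h3 : 0 <= t * (z - a) by rewrite mulr_ge0//; lra.
  have h4 : 0 <= t * (b - z) by rewrite mulr_ge0//; lra.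
  lra.
have h1 : 0 <= (1 - t) * (x - a) by rewrite mulr_ge0//; lra.
have h2 : 0 <= (1 - t) * (b - x) by rewrite mulr_ge0//; lra.
have h3 : 0 < t * (z - a) by rewrite mulr_gt0//; lra.
have h4 : 0 < t * (b - z) by rewrite mulr_gt0//; lra.
lra.
Qed.

Lemma lift_perturb v z : K v -> exists2 e : R, 0 < e & K (v + e *: z) /\ K (v - e *: z).
Proof.
have [oK _ _ _ _] := hK => Kv; apply: interior_perturb.
by move/interior_id: (oK) => ->.
Qed.

Lemma close_sym (d : R) p q : 0 <= d -> close K d p q -> close K d q p.
Proof.
have [_ _ _ KZ _] := hK => d0 [u [v [Ku Kv -> -> [c1 c2]]]].
have d1 : 0 < 1 + d by rewrite ltr_wpDr.
exists v, ((1 + d) *: u); split=> //; first exact: KZ.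
  by rewrite pt_scale ?gt_eqF//; exact: (lift_neq0 hK Ku).
split=> //; rewrite -scalerBr; apply: (cclZ hK) => //; exact: ltW.
Qed.

(** Scaled by [(b - y) / (b - x)], the first vector differs from the second by a positive multiple
    of the end point at [b]; the cross-ratio is the factor for which the opposite difference is a
    multiple of the end point at [a]. *)
Lemma line_close u w (a b x y : R) :
  (forall s, a < s < b -> K (u + s *: w)) -> a < x -> x <= y -> y < b ->
  close K ((b - x) * (y - a) / ((b - y) * (x - a)) - 1)
    (line_pt u w x) (line_pt u w y).
Proof.
have [_ _ _ KZ _] := hK => h ax xy yb.
have endpoint c : a <= c <= b -> ccl K (u + c *: w).
  move=> /andP[ac cb]; have Km : K (u + ((a + b) / 2) *: w) by apply: h; lra.
  apply: (ccl_limit Km) => e e0; have e1 : 0 < 1 + e by lra.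
  have -> : u + c *: w + e *: (u + ((a + b) / 2) *: w)
      = (1 + e) *: (u + ((c + e * ((a + b) / 2)) / (1 + e)) *: w).
    by apply/matrixP => i j; rewrite !mxE; field; lra.
  apply: KZ => //; apply: h; rewrite ltr_pdivlMr// ltr_pdivrMr//; nra.
have Kx : K (u + x *: w) by apply: h; lra.
have Ky : K (u + y *: w) by apply: h; lra.
have m0 : 0 < (b - y) / (b - x) by rewrite divr_gt0//; lra.
exists (((b - y) / (b - x)) *: (u + x *: w)), (u + y *: w); split=> //.
- exact: KZ.
- by rewrite pt_scale ?gt_eqF//; exact: (lift_neq0 hK Kx).
split.
  have -> : u + y *: w - ((b - y) / (b - x)) *: (u + x *: w)
      = ((y - x) / (b - x)) *: (u + b *: w).
    by apply/matrixP => i j; rewrite !mxE; field; lra.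
  by apply: (cclZ hK); [rewrite divr_ge0//; lra|apply: endpoint; lra].
have -> : (1 + ((b - x) * (y - a) / ((b - y) * (x - a)) - 1)) *:
     (((b - y) / (b - x)) *: (u + x *: w)) - (u + y *: w)
      = ((y - x) / (x - a)) *: (u + a *: w).
  by apply/matrixP => i j; rewrite !mxE; field; lra.
by apply: (cclZ hK); [rewrite divr_ge0//; lra|apply: endpoint; lra].
Qed.

Lemma hilbert_value_close p q d : hilbert_value Om p q d ->
  close K (expR (2 * d) - 1) p q.
Proof.
have [_ _ _ _ [QK KN _]] := hK.
move=> [u [w [a [b [x [y [ind ab [_ _ s] [ax ay -> ->] ->]]]]]]].
(* The open chord lies in [cone Om], hence entirely in [K] or entirely in its opposite; changing the
   signs of [u] and [w] brings it into [K]. *)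
wlog h : u w {ind} s / forall s, a < s < b -> K (u + s *: w).
  move=> W; have cO z : a < z < b -> cone Om (u + z *: w).
    move=> zab; split; last exact: s.
    apply/eqP => E; have [] := @independent_neq0 _ _ u w 1 z ind.
      by rewrite scale1r.
    by move/eqP; rewrite oner_eq0.
  have gen u' w' : (forall z, a < z < b -> cone Om (u' + z *: w')) -> K (u' + x *: w') ->
      forall z, a < z < b -> K (u' + z *: w').
    move=> cO' Kx z zab; apply: (lift_conn hK Kx) => t t01.
    have -> : (1 - t) *: (u' + x *: w') + t *: (u' + z *: w')
        = u' + ((1 - t) * x + t * z) *: w'.
      by apply/matrixP => i j; rewrite !mxE; ring.
    by apply: cO'; exact: itv_convex.
  have /QK[Kx|Kx] := cO x ax; first by apply: W => //; exact: gen.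
  have plN z : line_pt (- u) (- w) z = line_pt u w z.
    by rewrite /line_pt scalerN -opprD ptN.
  have := W (- u) (- w); rewrite !plN//; apply.
    by move=> z zab; rewrite plN//; exact: s.
  apply: gen; last by rewrite scalerN -opprD.
  by move=> z /cO /coneN; rewrite scalerN -opprD.
have [bx ya bY xa] : [/\ 0 < b - x, 0 < y - a, 0 < b - y & 0 < x - a] by split; lra.
rewrite (gtr0_norm bx) (gtr0_norm ya) (gtr0_norm bY) (gtr0_norm xa) mulrA mulfV ?pnatr_eq0// mul1r.
set r := (_ * _ / _).
have r0 : 0 < r by rewrite divr_gt0// mulr_gt0.
have rE : r^-1 = (b - y) * (x - a) / ((b - x) * (y - a)) by rewrite /r; field; lra.
have [xy|yx] := leP x y.
  apply: (@close_mono _ _ _ _ hK (r - 1)).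
    by rewrite lerD2r -[leLHS]lnK ?posrE// ler_expR ler_norm.
  by apply: line_close => //; lra.
apply: (@close_mono _ _ _ _ hK (r^-1 - 1)).
  by rewrite lerD2r -[leLHS]lnK ?posrE ?invr_gt0// lnV ?posrE// ler_expR -normrN ler_norm.
apply: close_sym; last by rewrite rE; apply: line_close => //; lra.
rewrite rE subr_ge0 ler_pdivlMr ?mulr_gt0// mul1r; nra.
Qed.

(** The ray leaves [K] at the supremum [b] of its parameters in [K]: an unbounded set of parameters
    would put [w] into the closed cone. Independence of [P] and [w] keeps the exit vector nonzero,
    so that it defines a frontier point. *)
Lemma lift_exit P w : K P -> (forall c : R, w <> c *: P) -> ~ ccl K w -> exists2 b : R, 0 < b &
  [/\ forall s : R, 0 <= s -> (K (P + s *: w) <-> s < b), frontier Om (line_pt P w b) & ccl K (P + b *: w)].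
Proof.
have [oK _ _ KZ [QK KN _]] := hK => KP ind nw.
pose S := [set s : R | 0 <= s /\ K (P + s *: w)].
have convS (s t : R) : S s -> 0 <= t <= s -> K (P + t *: w).
  move=> [s0 Ks] /andP[t0]; rewrite le_eqVlt => /predU1P[->//|ts].
  have -> : P + t *: w = (1 - t / s) *: P + (t / s) *: (P + s *: w).
    by apply/matrixP => i j; rewrite !mxE; field; lra.
  apply: (lift_seg hK) => //; have s0' : 0 < s by lra.
  by rewrite divr_ge0//= ler_pdivrMr//; lra.
have [B hB] : exists B, forall s, S s -> s <= B.
  apply: contrapT => nB; apply: nw; apply: (ccl_limit KP) => e e0.
  have [s [Ss sB]] : exists s, S s /\ e^-1 < s.
    apply: contrapT => h; apply: nB; exists e^-1 => s Ss; rewrite leNgt; apply/negP => es.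
    by apply: h; exists s.
  have Ke : K (P + e^-1 *: w).
    by apply: (convS s) => //; rewrite invr_ge0 !ltW.
  have -> : w + e *: P = e *: (P + e^-1 *: w).
    by apply/matrixP => i j; rewrite !mxE; field; lra.
  exact: KZ.
have hS : has_sup S by split; [exists 0; split=> //; rewrite scale0r addr0|exists B].
pose b := sup S.
have Sb s : S s -> s < b.
  move=> Ss; have [s0 Ks] := Ss; have [e e0 [Ke _]] := lift_perturb w Ks.
  apply: (@lt_le_trans _ _ (s + e)); first by rewrite ltrDl.
  apply: (sup_upper_bound hS); split; first by rewrite addr_ge0// ltW.
  by rewrite scalerDl addrA.
have SE (s : R) : 0 <= s -> K (P + s *: w) <-> s < b.
  move=> s0; split=> [Ks|sb]; first exact: Sb.
  have bs0 : 0 < b - s by rewrite subr_gt0.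
  have [t St] := sup_adherent bs0 hS.
  by rewrite subKr => st; apply: (convS t) => //; rewrite s0 ltW.
have b0 : 0 < b by apply: Sb; split=> //; rewrite scale0r addr0.
exists b => //.
have clb : ccl K (P + b *: w).
  apply: (ccl_limit KP) => e e0; have e1 : 0 < 1 + e by lra.
  have -> : P + b *: w + e *: P = (1 + e) *: (P + (b / (1 + e)) *: w).
    by apply/matrixP => i j; rewrite !mxE; field; lra.
  apply: KZ => //; apply/SE; first by rewrite divr_ge0// ltW.
  by rewrite ltr_pdivrMr//; nra.
have nKb : ~ K (P + b *: w) by move=> /(SE _ (ltW b0)); rewrite ltxx.
have b0' : P + b *: w != 0.
  apply/eqP => /eqP; rewrite addr_eq0 => /eqP E; apply: (ind (- b^-1)).
  by rewrite E scaleNr scalerN opprK scalerA mulVf ?scale1r// gt_eqF.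
split=> //; split.
  move=> U nU.
  have cl : {for b, continuous (fun s : R => P + s *: w)}.
    apply: (@continuousD R V R (fun=> P) (fun s => s *: w)); first exact: cst_continuous.
    exact: scalel_continuous.
  have /cl /nbhs_ballP[e /= e0 he] : nbhs (P + b *: w) (pt @^-1` U).
    exact: (pt_continuous b0' nU).
  pose m := Num.min e b; have m0 : 0 < m by rewrite lt_min e0.
  have [me mb] : m <= e /\ m <= b by split; rewrite ge_min lexx ?orbT.
  exists (pt (P + (b - m / 2) *: w)); split.
    by apply: (lift_pt hK); apply/SE; lra.
  apply: he; rewrite -ball_normE /ball_/= opprB addrC subrK ger0_norm; lra.
move/interior_subset => Ob.
have /QK[//|KNb] : cone Om (P + b *: w) by split.
by have := liftD_ccl hK KNb clb; rewrite addNr; exact: (liftN0 hK).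
Qed.

(** The chord must reach the frontier at finite parameters on both sides. This needs a direction
    [w = Q - c *: P] such that neither [w] nor [- w] lies in the closed cone. *)
Lemma hilbert_value_exists p q : Om p -> Om q -> p <> q ->
  exists d, hilbert_value Om p q d.
Proof.
have [oK _ _ KZ [QK KN _]] := hK.
move=> /(lift_rep hK)[P KP ->] /(lift_rep hK)[Q KQ ->] PQ.
have P0 := lift_neq0 hK KP; have Q0 := lift_neq0 hK KQ.
have nQ c : Q <> c *: P.
  move=> E; apply: PQ; apply/pt_eq => //; exists c => //.
  by apply: contraNneq Q0 => c0; rewrite E c0 scale0r.
have nmP : ~ ccl K (- P).
  move=> h; have := liftD_ccl hK KP h; rewrite subrr; exact: liftN0 hK.
have nP c : - P <> c *: Q.
  have [->|c0] := eqVneq c 0; first by rewrite scale0r => /eqP; rewrite oppr_eq0 (negPf P0).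
  move=> E; apply: (nQ (- c^-1)); rewrite scaleNr -scalerN E scalerA mulVf ?scale1r//.
have [m m0 [mE _ clm]] := lift_exit KQ nP nmP.
have nclm : (~` ccl K) (m *: P - Q).
  rewrite -opprB => h; apply: (nQ m); apply/eqP; rewrite -subr_eq0; apply/eqP.
  by apply: (ccl_pointed hK) => //; move: clm; rewrite scalerN.
(* [m] is the parameter at which [Q - m *: P] leaves [K]. Any larger [c] puts [Q - c *: P] outside
   the closed cone; for [c] close to [m] the opposite vector stays outside as well, by openness. *)
have [c [mc nc1 nc2]] : exists c, [/\ m < c, ~ ccl K (c *: P - Q) & ~ ccl K (Q - c *: P)].
  have cl : {for m, continuous (fun s : R => s *: P - Q)}.
    apply: (@continuousB R V R (fun s => s *: P) (fun=> Q)); last exact: cst_continuous.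
    exact: scalel_continuous.
  have /cl /nbhs_ballP[e /= e0 he] : nbhs (m *: P - Q) (~` ccl K).
    by apply: open_nbhs_nbhs; split=> //; apply: closed_openC; exact: ccl_closed.
  exists (m + e / 2); split; first lra.
    apply: he; rewrite -ball_normE /ball_/= opprD addNKr normrN ger0_norm; lra.
  move=> h; have : K (Q + m *: (- P)).
    have -> : Q + m *: (- P) = (e / 2) *: P + (Q - (m + e / 2) *: P).
      by apply/matrixP => i j; rewrite !mxE; ring.
    by apply: (liftD_ccl hK) => //; apply: KZ => //; lra.
  by move=> /(mE _ (ltW m0)); rewrite ltxx.
have c0 : 0 < c by lra.
pose w := Q - c *: P.
have nw1 : ~ ccl K w by [].
have nw2 : ~ ccl K (- w) by rewrite /w opprB.
have indw d : w <> d *: P.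
  by move=> /eqP; rewrite subr_eq -scalerDl => /eqP; exact: nQ.
have [b b0 [bE bF _]] := lift_exit KP indw nw1.
have indN d : - w <> d *: P by move=> E; apply: (indw (- d)); rewrite scaleNr -E opprK.
have [a a0 [aE aF _]] := lift_exit KP indN nw2.
have QE : Q = c *: (P + c^-1 *: w).
  by apply/matrixP => i j; rewrite /w !mxE; field; rewrite gt_eqF.
have cb : c^-1 < b.
  apply/bE; first by rewrite invr_ge0 ltW.
  have -> : P + c^-1 *: w = c^-1 *: Q by rewrite QE scalerA mulVf ?scale1r// gt_eqF.
  by apply: KZ => //; rewrite invr_gt0.
have ci0 : 0 < c^-1 by rewrite invr_gt0.
eexists; exists P, w, (- a), b, 0, c^-1; split; last reflexivity.
- exact: independentP.
- by lra.
- split=> //; first by move: aF; rewrite /line_pt scalerN scaleNr.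
  move=> s sab; apply: (lift_pt hK); have [s0|s0] := leP 0 s.
    by apply/bE => //; lra.
  have -> : s *: w = (- s) *: (- w) by rewrite scaleNr scalerN opprK.
  by apply/aE; lra.
- split; [lra|lra|by rewrite /line_pt scale0r addr0|].
  rewrite /line_pt QE pt_scale ?gt_eqF//.
  by apply: (lift_neq0 hK); apply/bE => //; exact: ltW.
Qed.

(** A Hilbert value exists for distinct points, so [hilbert_dist] is never the default of [xget]
    there, and a distance below [ln (1 + d) / 2] means genuine closeness. *)
Lemma hilbert_inf_close (T : set (RP R n)) (f : RP R n -> RP R n) : T `<=` Om -> T !=set0 ->
  (forall x, T x -> Om (f x)) ->
  inf [set hilbert_dist Om x (f x) | x in T] = 0 ->
  forall d : R, 0 < d -> exists2 x, T x & close K d x (f x).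
Proof.
move=> TO [x0 Tx0] fO i0 d d0.
have hv x : hilbert_dist Om x (f x) < ln (1 + d) / 2 -> T x -> close K d x (f x).
  rewrite /hilbert_dist; case: eqP => [<- _ Tx|xf + Tx].
    by apply: (close_refl hK); [exact: ltW|exact: TO].
  have [e he] := hilbert_value_exists (TO _ Tx) (fO _ Tx) xf.
  have := @xgetPex _ 0 (hilbert_value Om x (f x)) (ex_intro _ e he).
  move: (xget _ _) => {he}e he elt.
  apply: (close_mono hK _ (hilbert_value_close he)).
  rewrite lerBlDl -[leRHS]lnK ?posrE; last lra.
  by rewrite ler_expR; lra.
have ge0 x : 0 <= hilbert_dist Om x (f x).
  rewrite /hilbert_dist; case: eqP => // _.
  case: xgetP => // e _ [u [w [a [b [y [z [_ _ _ _ ->]]]]]]].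
  by rewrite mulr_ge0// invr_ge0.
have l0 : 0 < ln (1 + d) / 2 by rewrite divr_gt0// ln_gt0//; lra.
have [] := @inf_adherent _ [set hilbert_dist Om x (f x) | x in T] _ l0.
  by split; [exists (hilbert_dist Om x0 (f x0)), x0|exists 0 => _ [x _ <-]].
by move=> _ [x Tx <-]; rewrite i0 add0r => h; exists x => //; exact: hv.
Qed.

End HilbertBound.

(** * Properness *)

Section DiscreteFinite.
Context {R : realType} {n : nat}.
Local Notation m := n.+1.
Local Notation M := 'M[R]_m.
Context (Gamma : set (PGL R m)) (gG : is_subgroup Gamma) (dG : discrete_subset Gamma).

Lemma is_subset1_finite T (A : set T) : is_subset1 A -> finite_set A.
Proof.
move=> A1; have [->|/set0P[x Ax]] := eqVneq A set0; first exact: finite_set0.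
by apply: (@sub_finite_set _ _ [set x]) => [y Ay|]; [exact: A1|exact: finite_set1].
Qed.

Lemma discrete_isolated1 : exists2 d : R, 0 < d &
  forall X : M, X \in unitmx -> Gamma (pgl X) -> `|1%:M - X| < d -> pgl X = 1%g.
Proof.
have [G1 _ _] := gG; have [_ [U nU UG]] := dG G1.
move: nU; rewrite nbhsE => -[U' [oU' U'1] U'U].
have [W oW WU] := open_proj_lift (exist (fun B => B \in @invmat R m) _ (invmat1 R m)) oU'.
have W1 : W 1%:M by apply/WU; [exact/invmat1|exact: U'1].
have /nbhs_ballP[d /= d0 hd] : nbhs (1%:M : M) W by exact: open_nbhs_nbhs.
exists d => // X uX GX Xd; suff : (U `&` Gamma) (pgl X) by rewrite UG.
split=> //; apply: U'U; apply/WU; first exact/mem_set.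
by apply: hd; rewrite -ball_normE.
Qed.

(** If [A] and [B] are close and the inverse of [A] is bounded, then [invmx A *m B] is close to 1
    and represents the trivial element. Each small ball thus contributes at most one element, and a
    bounded set of matrices is covered by finitely many balls. *)
Lemma discrete_finite (a : R) : finite_set [set g | Gamma g /\
  exists A : M, [/\ A \in unitmx, g = pgl A, `|A| <= a & `|invmx A| <= a]].
Proof.
have [G1 GM GV] := gG; have [d d0 hd] := discrete_isolated1.
pose S (B : set M) : set (PGL R m) := [set g | Gamma g /\
  exists A, [/\ B A, A \in unitmx, g = pgl A & `|invmx A| <= a]].
suff : finite_set (S [set A : M | `|A| <= a]).
  apply: sub_finite_set => g [Gg [A [uA gE Aa Aa']]]; split=> //.
  by exists A.
apply: (@compact_ind _ _ (fun B => finite_set (S B))).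
- apply: (@mx_bounded_closed_compact _ _ _ _ a) => //.
  apply: (@closed_comp _ _ (fun X : M => `|X|) [set x : R | x <= a]).
    by move=> X _; exact: norm_continuous.
  exact: closed_le.
- by apply: (@sub_finite_set _ _ set0) => // g [_ [A []]].
- move=> B C fB fC; apply: (@sub_finite_set _ _ (S B `|` S C)).
    move=> g [Gg [A [[BA|CA] uA gE Aa]]]; [left|right]; split=> //; by exists A.
  by rewrite finite_setU.
- move=> B C BC; apply: sub_finite_set => g [Gg [A [/BC CA uA gE Aa]]]; split=> //.
  by exists A.
- move=> X _; pose e := d / (2 * (m%:R * `|a| + 1)).
  have q0 : 0 < m%:R * `|a| + 1 :> R by rewrite ltr_wpDl// mulr_ge0.
  have e0 : 0 < e by rewrite divr_gt0// mulr_gt0.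
  exists (ball X e); first exact: nbhsx_ballx.
  apply: is_subset1_finite => g h [Gg [A [BA uA gE Aa]]] [Gh [B [BB uB hE Ba]]]; subst g h.
  have uAB : invmx A *m B \in unitmx by rewrite unitmx_mul unitmx_inv uA.
  have E : ((pgl A)^-1 * pgl B)%g = pgl (invmx A *m B) by rewrite pglV// pglM// unitmx_inv.
  have : pgl (invmx A *m B) = 1%g.
    apply: hd => //; first by rewrite -E; apply: GM => //; exact: GV.
    have -> : 1%:M - invmx A *m B = invmx A *m (A - B) by rewrite mulmxBr mulVmx.
    apply: le_lt_trans (mulmx_norm_le _ _) _.
    have AB : `|A - B| <= 2 * e.
      have -> : A - B = - (X - A) + (X - B) by rewrite opprB addrA subrK.
      apply: le_trans (ler_normD _ _) _; rewrite normrN mulrDl mul1r.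
      by move: BA BB; rewrite -!ball_normE => /ltW BA /ltW BB; apply: lerD.
    apply: (@le_lt_trans _ _ (m%:R * `|a| * (2 * e))).
      apply: ler_pM; [by apply: mulr_ge0|by []| |exact: AB].
      by apply: ler_wpM2l => //; apply: le_trans Aa (ler_norm _).
    have -> : m%:R * `|a| * (2 * e) = (m%:R * `|a|) * d / (m%:R * `|a| + 1).
      by rewrite /e; field; rewrite gt_eqF.
    by rewrite ltr_pdivrMr// [ltRHS]mulrC ltr_pM2r// ltrDl.
  by rewrite -E => /(congr1 (fun x => (pgl A * x)%g)); rewrite mulgA mulgV mul1g mulg1.
Qed.

End DiscreteFinite.

Section Properness.
Context {R : realType} {n : nat}.
Local Notation V := 'cV[R]_n.+1.
Local Notation M := 'M[R]_n.+1.
Context (Om : set (RP R n)) (K : set V) (hK : is_lift Om K).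
Context (Gamma : set (PGL R n.+1)) (gG : is_subgroup Gamma) (dG : discrete_subset Gamma)
  (GOm : forall g, Gamma g -> pact g @` Om = Om).

(** [Y] is an order unit: for each basis vector [b] and small [e], [e *: b] lies between [- Y] and
    [Y]. Its image lies between [- A Y] and [A Y], and [A Y] is at most [Z]; normality turns these
    order bounds into norm bounds. *)
Lemma preserving_norm_bound (Y : V) : K Y -> exists2 C : R, 0 <= C &
  forall (A : M) (Z : V), (forall v, ccl K v -> ccl K (A *m v)) -> ccl K (Z - A *m Y) ->
    `|A| <= C * `|Z|.
Proof.
have [oK _ _ _ _] := hK => KY; have [C C0 hC] := ccl_normal hK.
have /nbhs_ballP[r /= r0 hr] : nbhs Y K by exact: open_nbhs_nbhs.
pose e := r / 2; have e0 : 0 < e by rewrite divr_gt0.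
pose D := (C + C * C * 2) / e.
have D0 : 0 <= D by rewrite divr_ge0 ?(ltW e0)// addr_ge0 ?mulr_ge0 ?(ltW C0).
exists D => // A Z PA cZ; have AZ : `|A *m Y| <= C * `|Z|.
  by apply: hC => //; apply/PA/ccl_sub.
apply: mx_norm_le => [|i j]; first by rewrite mulr_ge0.
pose b : V := delta_mx j 0.
have -> : A i j = (A *m b) i 0 by rewrite -colE mxE.
apply: le_trans (mx_entry_le _ _ _) _.
have b1 : `|e *: b| < r.
  rewrite normrZ gtr0_norm//; apply: (@le_lt_trans _ _ (e * 1)); last by rewrite /e; lra.
  apply: ler_wpM2l; first exact: ltW.
  apply: mx_norm_le => // k l; rewrite mxE; case: (_ && _); rewrite ?normr1 ?normr0//.
have Kp : K (Y + e *: b).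
  by apply: hr; rewrite -ball_normE /ball_/= opprD addrA subrr add0r normrN.
have Km : K (Y - e *: b).
  by apply: hr; rewrite -ball_normE /ball_/= opprB addrC subrK.
have h : `|A *m (Y + e *: b)| <= C * `|2 *: (A *m Y)|.
  apply: hC; first by apply/PA/ccl_sub.
  have -> : 2 *: (A *m Y) - A *m (Y + e *: b) = A *m (Y - e *: b).
    by rewrite mulmxDr mulmxBr scaler_nat mulr2n opprD addrA addrK.
  by apply/PA/ccl_sub.
have E : A *m b = e^-1 *: (A *m (Y + e *: b) - A *m Y).
  by rewrite -mulmxBr addrAC subrr add0r -scalemxAr scalerA mulVf ?scale1r// gt_eqF.
rewrite E normrZ gtr0_norm ?invr_gt0// ler_pdivrMl//.
apply: le_trans (ler_normB _ _) _.
have -> : e * (D * `|Z|) = C * (2 * (C * `|Z|)) + C * `|Z|.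
  by rewrite /D; field; rewrite gt_eqF.
apply: lerD => //; apply: le_trans h _; rewrite normrZ ger0_norm//.
by do 2! (apply: ler_wpM2l; first by rewrite ?(ltW C0)).
Qed.

Lemma lift_order_nbhs (Y : V) : K Y -> exists2 U : set (RP R n), open U /\ U (pt Y) &
  forall p, U p -> exists u, [/\ K u, p = pt u, K (u - 2^-1 *: Y) & K (2 *: Y - u)].
Proof.
have [oK _ _ KZ _] := hK => KY.
pose W := (fun u : V => u - 2^-1 *: Y) @^-1` K `&` (fun u => 2 *: Y - u) @^-1` K.
have oW : open W.
  apply: openI; apply: open_comp => // u _.
    apply: (@continuousB R V V id (fun=> 2^-1 *: Y)); first exact: cvg_id.
    exact: cst_continuous.
  apply: (@continuousB R V V (fun=> 2 *: Y) id); first exact: cst_continuous.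
  exact: cvg_id.
exists [set pt v | v in W `&` [set v | v != 0]].
  split; first exact: pt_open.
  exists Y => //; split; last exact: (lift_neq0 hK).
  split=> /=.
    have -> : Y - 2^-1 *: Y = 2^-1 *: Y by apply/matrixP => i j; rewrite !mxE; field.
    by apply: KZ.
  by have -> : 2 *: Y - Y = Y by rewrite scaler_nat mulr2n addrK.
move=> p [u [[h1 h2] u0] <-]; exists u; split=> //.
rewrite -[u](subrK (2^-1 *: Y)); have [_ _ KD _ _] := hK; apply: KD => //.
exact: KZ.
Qed.

(* If g maps a point comparable with Y to a point comparable with Z, then the
   lift of g and its inverse are bounded in terms of Y and Z, whence finiteness. *)
Lemma proper (y z : RP R n) : Om y -> Om z -> exists U W : set (RP R n),
  [/\ open U, open W, U y, W z &
    finite_set [set g | Gamma g /\ exists2 p, U p & W (pact g p)]].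
Proof.
have [_ _ KD KZ _] := hK.
move=> /(lift_rep hK)[Y KY ->] /(lift_rep hK)[Z KZz ->].
have [U [oU UY] hU] := lift_order_nbhs KY; have [W [oW WZ] hW] := lift_order_nbhs KZz.
have [C C0 hC] := preserving_norm_bound KY; have [D D0 hD] := preserving_norm_bound KZz.
exists U, W; split=> //.
apply: sub_finite_set (discrete_finite gG dG (C * `|4 *: Z| + D * `|4 *: Y|)).
move=> g [Gg [p /hU[u [Ku -> u1 u2]] /hW[w [Kw wE w1 w2]]]]; split=> //.
have [A0 gA0] := lift_exists hK (GOm Gg).
have [_ _ KA0 _] := gA0.
have [c c0 wA0] : exists2 c : R, 0 < c & w = c *: (A0 *m u).
  apply: (lift_pt_eq hK) => //; first exact: KA0.
  by rewrite -wE; apply/esym/(lifts_pact hK gA0).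
pose A := c *: A0; have gA : lifts K g A by exact: (liftsZ hK).
have wA : w = A *m u by rewrite wA0 /A scalemxAl.
have gAV := liftsV gA; have [uA gE KA KAV] := gA.
have uwA : invmx A *m w = u by rewrite wA mulKmx.
exists A; split=> //.
  apply: (@le_trans _ _ (C * `|4 *: Z|)); last by rewrite lerDl mulr_ge0.
  apply: hC => [v|]; first exact: (lifts_ccl gA).
  have -> : 4 *: Z - A *m Y = 2 *: ((2 *: Z - w) + A *m (u - 2^-1 *: Y)).
    by rewrite mulmxBr -wA addrA subrK scalerBr -!scalemxAr !scalerA mulfV// scale1r -natrM.
  by apply: (ccl_sub); apply: KZ => //; apply: KD => //; exact: KA.
apply: (@le_trans _ _ (D * `|4 *: Y|)); last by rewrite lerDr mulr_ge0.
apply: hD => [v|]; first exact: (lifts_ccl gAV).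
have -> : 4 *: Y - invmx A *m Z = 2 *: ((2 *: Y - u) + invmx A *m (w - 2^-1 *: Z)).
  by rewrite mulmxBr uwA addrA subrK scalerBr -!scalemxAr !scalerA mulfV// scale1r -natrM.
by apply: (ccl_sub); apply: KZ => //; apply: KD => //; exact: KAV.
Qed.

Lemma RP_separated (p q : RP R n) : p <> q -> exists A B : set (RP R n),
  [/\ open A, open B, A p, B q & forall x, A x -> B x -> False].
Proof.
rewrite -(vec_ofK p) -(vec_ofK q).
move: (vec_of p) (vec_of q) (vec_of_neq0 p) (vec_of_neq0 q) => v w v0 w0 vw.
have [A [B [oA oB Av Bw h]]] := pt_separated v0 w0 vw.
exists [set pt v | v in A `&` [set v | v != 0]], [set pt v | v in B `&` [set v | v != 0]].
split; [exact: pt_open|exact: pt_open|by exists v|by exists w|].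
by move=> x [v' [Av' v'0] <-] [w' [Bw' w'0]] /esym; exact: h.
Qed.

(** Only finitely many elements matter, and each is excluded by shrinking the neighbourhoods. With
    [G0 = Gamma] this separates orbits; with the nontrivial elements and [y = z] it says that the
    action is properly discontinuous. *)
Lemma proper_sep (G0 : set (PGL R n.+1)) (y z : RP R n) : Om y -> Om z -> G0 `<=` Gamma ->
  (forall g, G0 g -> pact g y <> z) -> exists U W : set (RP R n),
  [/\ open U, open W, U y, W z & forall g p, G0 g -> U p -> W (pact g p) -> False].
Proof.
move=> Oy Oz G0G hyz; have [U [W [oU oW Uy Wz]]] := proper Oy Oz.
move=> /finite_seqP[s sE].
have [U' [W' [oU' oW' U'y W'z h]]] : exists U' W' : set (RP R n),
    [/\ open U', open W', U' y, W' z &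
      forall g p, g \in s -> G0 g -> U' p -> W' (pact g p) -> False].
  elim: s {sE} => [|g s [U1 [W1 [oU1 oW1 U1y W1z h]]]].
    by exists setT, setT; split=> //; exact: openT.
  have [Gg|nGg] := pselect (G0 g); last first.
    exists U1, W1; split=> // k p; rewrite inE => /predU1P[->//|]; exact: h.
  have [A [B [oA oB Ag Bz AB]]] := RP_separated (hyz _ Gg).
  exists (U1 `&` pact g @^-1` A), (W1 `&` B); split.
  - by apply: openI => //; exact: pact_preimage_open.
  - exact: openI.
  - by [].
  - by [].
  - move=> k p; rewrite inE => /predU1P[-> _ [_ Ap] [_ Bp]|ks Gk [Up _] [Wp _]].
      exact: (AB _ Ap Bp).
    exact: (h k p).
exists (U `&` U'), (W `&` W'); split; [exact: openI|exact: openI|by []|by []|].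
move=> g p Gg [Up U'p] [Wp W'p]; apply: (h g p) => //.
have : [set` s] g by rewrite -sE; split; [exact: G0G|exists p].
by [].
Qed.

End Properness.

(** * Ends *)

Section UltraEnd.
Context {X : topologicalType} (M : set X) (F : set_system X).
Context (oM : open M) (cM : connected M)
  (hM : forall p q, M p -> M q -> p <> q -> exists A B : set X,
     [/\ nbhs p A, nbhs q B & forall x, A x -> B x -> False])
  (lcM : forall x, M x -> exists N, [/\ compact N, N `<=` M & nbhs x N])
  (lnM : forall x (U : set X), M x -> nbhs x U ->
     exists N, [/\ connected N, N `<=` U & nbhs x N])
  (uF : UltraFilter F) (FM : F M)
  (Fcompact : forall C, compact C -> C `<=` M -> F (~` C)).
Local Notation comp C := (connected_component (M `\` C)).

Lemma compact_separated C x : compact C -> C `<=` M -> M x -> ~ C x ->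
  exists2 U, nbhs x U & forall y, U y -> C y -> False.
Proof.
move=> cC CM Mx nCx.
apply: (@compact_ind X C (fun A => exists2 U, nbhs x U & forall y, U y -> A y -> False)) => //.
- by exists setT => //; exact: filterT.
- move=> A B [U nU hU] [W nW hW]; exists (U `&` W); first exact: filterI.
  by move=> y [Uy Wy] [/(hU y Uy)|/(hW y Wy)].
- by move=> A B AB [U nU hU]; exists U => // y Uy /AB; exact: hU.
- move=> y Cy; have xy : x <> y by move=> xy; apply: nCx; rewrite xy.
  have [A [B [nA nB AB]]] := hM Mx (CM _ Cy) xy.
  by exists B => //; exists A.
Qed.

Lemma component_nbhs C x z : compact C -> C `<=` M -> comp C x z -> nbhs z (comp C x).
Proof.
move=> cC CM xz; have [Mz nCz] := connected_component_sub xz.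
have [U nU hU] := compact_separated cC CM Mz nCz.
have nUM : nbhs z (U `&` M) by apply: filterI => //; exact: open_nbhs_nbhs.
have [N [cN NUM nN]] := lnM Mz nUM.
rewrite (same_connected_component xz); apply: (filterS _ nN).
apply: connected_component_max => //; first exact: nbhs_singleton.
by move=> y /NUM[Uy My]; split=> // Cy; exact: (hU y Uy Cy).
Qed.

Lemma component_eq C x y z : comp C x z -> comp C y z -> comp C x = comp C y.
Proof. by move=> /same_connected_component -> /same_connected_component ->. Qed.

Lemma compact_thickening C : compact C -> C `<=` M ->
  exists C', [/\ compact C', C' `<=` M & C `<=` C'°].
Proof.
move=> cC CM.
apply: (@compact_ind X C (fun A => exists C', [/\ compact C', C' `<=` M & A `<=` C'°])) => //.
- by exists set0; split=> //; exact: compact0.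
- move=> A B [A' [cA' A'M AA']] [B' [cB' B'M BB']]; exists (A' `|` B'); split.
  + exact: compactU.
  + by move=> x [/A'M|/B'M].
  + move=> x [/AA'|/BB']; apply: filterS => y; [by left|by right].
- by move=> A B AB [C' [c1 c2 c3]]; exists C'; split=> // x /AB/c3.
- move=> x Cx; have [N [cN NM nN]] := lcM (CM _ Cx).
  exists N°; first exact: nbhs_interior.
  by exists N; split.
Qed.

(* If no component were large for F, then F would avoid every component meeting
   the frontier of a compact neighbourhood C' of C; a component meeting the
   complement of C' but not this frontier is open and closed in M. *)
Lemma ultra_component C : compact C -> C `<=` M ->
  exists2 x, (M `\` C) x & F (comp C x).
Proof.
move=> cC CM; apply: contrapT => nex.
have Fn x : (M `\` C) x -> F (~` comp C x).
  move=> Mx; have [h|//] := in_ultra_setVsetC (comp C x) uF.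
  by exfalso; apply: nex; exists x.
have [C' [cC' C'M CC']] := compact_thickening cC CM.
pose Fr := C' `&` ~` C'°.
pose S A := \bigcup_(z in A `&` (M `\` C)) comp C z.
have FFr : F (~` S Fr).
  apply: (@compact_ind X Fr (fun A => F (~` S A))).
  - by apply: compact_closedI => //; apply: open_closedC; exact: open_interior.
  - by apply: filterS filterT => x _ [z [[]]].
  - move=> A B FA FB; apply: filterS (filterI FA FB) => x [nA nB] [z [[Az|Bz] Mz]].
      by move=> h; apply: nA; exists z.
    by move=> h; apply: nB; exists z.
  - by move=> A B AB; apply: filterS => x nB [z [Az Mz] h]; apply: nB; exists z => //; split=> //; exact: AB.
  - move=> x [C'x nC'x]; have Mx : (M `\` C) x by split; [exact: C'M|move/CC'].
    exists (comp C x); first exact/component_nbhs/connected_component_refl.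
    apply: filterS (Fn _ Mx) => y nxy [z [xz _] zy]; apply: nxy.
    by rewrite (same_connected_component xz).
have [z [[nC'z Mz] nSz]] := filter_ex (filterI (filterI (Fcompact cC' C'M) FM) FFr).
have Cz : (M `\` C) z by split=> // /CC'/interior_subset.
pose Z := comp C z; have Zz : Z z by exact: connected_component_refl.
have ZFr y : Z y -> Fr y -> False.
  move=> Zy Fy; apply: nSz; exists y.
    by split=> //; exact: connected_component_sub Zy.
  exact: connected_component_sym.
have oMC' : open (M `&` ~` C').
  rewrite openE => y [My nC'y]; have [U nU hU] := compact_separated cC' C'M My nC'y.
  apply: filterS (filterI nU (open_nbhs_nbhs (conj oM My))) => w [Uw Mw].
  by split=> // C'w; exact: (hU w Uw C'w).
have ZM : Z `<=` M by move=> y /connected_component_sub[].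
have ZC' : Z `&` ~` C' = Z.
  apply: (component_connected (A := M `\` C) (x := z)); first by exists z.
    exists (M `&` ~` C') => //; apply/seteqP; split=> y; last by move=> [Zy []].
    by move=> [Zy nC'y]; split=> //; split=> //; exact: ZM.
  exists (~` C'°); first exact: open_closedC (@open_interior _ _).
  apply/seteqP; split=> y [Zy nC'y]; split=> //; first by move/interior_subset.
  by move=> C'y; exact: (ZFr y Zy (conj C'y nC'y)).
have nZC' y : Z y -> ~ C' y by rewrite -ZC' => -[].
(* [Z] is open, and also closed in [M]: a limit of points of [Z], all outside [C'], lies outside [C]
   and hence has a component of its own, which meets [Z]. *)
have ZEM : Z = M.
  apply: cM; first by exists z.
    exists Z; last by apply/seteqP; split=> y; [move=> Zy; split=> //; exact: ZM|case].
    by rewrite openE => y Zy; exact: component_nbhs.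
  exists (closure Z); first exact: closed_closure.
  apply/seteqP; split=> y; first by move=> Zy; split; [exact: ZM|exact: subset_closure].
  move=> [My cly]; have nC'y : ~ C'° y.
    by move=> /nbhs_interior /cly[w [/nZC' + /interior_subset]].
  have Cy : (M `\` C) y by split=> // /CC'.
  have /cly[w [Zw yw]] := component_nbhs cC CM (connected_component_refl Cy).
  by rewrite /Z (component_eq Zw yw); exact: connected_component_refl.
have [w [Zw nZw]] := filter_ex (filterI FM (Fn z Cz)).
by apply: nZw; rewrite -/Z ZEM.
Qed.

(** For each compact set the component belonging to [F] is chosen. The choices are compatible
    because two sets of [F] always meet. *)
Lemma ultra_end : exists e, is_end M e /\
  forall C, compact C -> C `<=` M -> F (e C).
Proof.
pose Q C x := (M `\` C) x /\ F (comp C x).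
have [e he] : exists e : set X -> set X, forall C, compact C -> C `<=` M ->
    exists2 x, Q C x & e C = comp C x.
  have : forall C : set X, exists B : set X, compact C -> C `<=` M -> exists2 x, Q C x & B = comp C x.
    move=> C; have [cC|] := pselect (compact C); last by exists set0.
    have [CM|] := pselect (C `<=` M); last by exists set0.
    have [x Mx Fx] := ultra_component cC CM.
    by exists (comp C x) => _ _; exists x.
  by move=> /choice[e he]; exists e.
exists e; split; last by move=> C cC CM; have [x [_ Fx] ->] := he C cC CM.
split=> [C cC CM|C C' cC cC' CC' C'M].
  by have [x [Mx _] ->] := he C cC CM; exists x.
have CM : C `<=` M by move=> x /CC'/C'M.
have [x [Mx Fx] ->] := he C cC CM; have [x' [Mx' Fx'] ->] := he C' cC' C'M.
have [z [xz x'z]] := filter_ex (filterI Fx Fx').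
rewrite (same_connected_component xz); apply: connected_component_max => //.
  by move=> y /connected_component_sub[My nC'y]; split=> // /CC'.
exact: component_connected.
Qed.

End UltraEnd.

(** * Topology of the quotient manifold *)

Section QuotientTopology.
Context {R : realType} {n : nat}.
Local Notation V := 'cV[R]_n.+1.
Local Notation M := 'M[R]_n.+1.

Lemma convex_set_connected (A : set V) :
  (forall u v (t : R), A u -> A v -> 0 <= t <= 1 -> A ((1 - t) *: u + t *: v)) -> connected A.
Proof.
move=> cA; have [->|/set0P[u Au]] := eqVneq A set0; first exact: connected0.
pose S v : set V := (fun t : R => (1 - t) *: u + t *: v) @` `[0, 1].
have -> : A = \bigcup_(v in A) S v.
  apply/seteqP; split=> v.
    move=> Av; exists v => //; exists 1; first by rewrite /= in_itv/= lexx ler01.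
    by rewrite subrr scale0r scale1r add0r.
  by move=> [w Aw [t]]; rewrite /= in_itv/= => t01 <-; exact: cA.
apply: bigcup_connected.
  exists u => v _; exists 0; first by rewrite /= in_itv/= lexx ler01.
  by rewrite subr0 scale1r scale0r addr0.
move=> v _; apply: connected_continuous_connected; first exact: segment_connected.
apply: continuous_subspaceT; exact: segment_continuous.
Qed.

Lemma ball_convex (x u v : V) (r t : R) : ball x r u -> ball x r v -> 0 <= t <= 1 ->
  ball x r ((1 - t) *: u + t *: v).
Proof.
rewrite -!ball_normE /ball_/= => xu xv /andP[t0 t1].
have -> : x - ((1 - t) *: u + t *: v) = (1 - t) *: (x - u) + t *: (x - v).
  by apply/matrixP => i j; rewrite !mxE; ring.
apply: le_lt_trans (ler_normD _ _) _; rewrite !normrZ !ger0_norm ?subr_ge0//.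
have [tl|tl] := leP t (1 / 2).
  have h1 : 0 < (1 - t) * (r - `|x - u|) by rewrite mulr_gt0//; lra.
  have h2 : 0 <= t * (r - `|x - v|) by rewrite mulr_ge0//; lra.
  lra.
have h1 : 0 <= (1 - t) * (r - `|x - u|) by rewrite mulr_ge0//; lra.
have h2 : 0 < t * (r - `|x - v|) by rewrite mulr_gt0//; lra.
lra.
Qed.

Lemma pt_ball_nbhs (Y : V) (r : R) : Y != 0 -> 0 < r ->
  nbhs (pt Y) [set pt v | v in ball Y r `&` [set v | v != 0]].
Proof.
move=> Y0 r0; apply: open_nbhs_nbhs; split; first exact/pt_open/ball_open.
by exists Y => //; split=> //; exact: ballxx.
Qed.

Lemma pt_within (A : set V) : (forall v, A v -> v != 0) ->
  {within A, continuous (pt : V -> RP R n)}.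
Proof.
by move=> A0; apply: continuous_in_subspaceT => v /set_mem/A0; exact: pt_continuous.
Qed.

Context (Om : set (RP R n)) (K : set V) (hK : is_lift Om K).

Lemma lift_compact_nbhs y : Om y -> exists N, [/\ compact N, N `<=` Om & nbhs y N].
Proof.
have [oK _ _ _ _] := hK.
move=> /(lift_rep hK)[Y KY ->]; have /nbhs_ballP[r /= r0 hr] : nbhs Y K by exact: open_nbhs_nbhs.
pose B := [set v : V | `|Y - v| <= r / 2].
have BK : B `<=` K by move=> v /= h; apply: hr; rewrite -ball_normE /ball_/=; apply: le_lt_trans h _; lra.
have B0 v : B v -> v != 0 by move=> /BK; exact: (lift_neq0 hK).
exists (pt @` B); split.
- apply: continuous_compact; first exact: pt_within.
  apply: (@mx_bounded_closed_compact _ _ _ _ (`|Y| + r / 2)).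
    move=> v Bv; have -> : v = Y - (Y - v) by rewrite subKr.
    by apply: le_trans (ler_normB _ _) _; rewrite lerD2l.
  apply: (@closed_comp _ _ (fun X : V => `|Y - X|) [set x : R | x <= r / 2]); last exact: closed_le.
  move=> X _; apply: (@continuous_comp _ _ _ (fun X : V => Y - X) (fun X : V => `|X|)).
    apply: (@continuousB R V V (fun=> Y) id); first exact: cst_continuous.
    exact: cvg_id.
  exact: norm_continuous.
- by move=> _ [v /BK Kv <-]; exact: (lift_pt hK).
- have r2 : 0 < r / 2 by rewrite divr_gt0.
  apply: (filterS _ (pt_ball_nbhs (lift_neq0 hK KY) r2)).
  by move=> _ [v [Bv v0] <-]; exists v => //; apply: ltW; move: Bv; rewrite -ball_normE.
Qed.

Lemma lift_connected_nbhs y U : Om y -> nbhs y U ->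
  exists N, [/\ connected N, N `<=` U & nbhs y N].
Proof.
have [oK _ _ _ _] := hK.
move=> /(lift_rep hK)[Y KY ->] nU; have Y0 := lift_neq0 hK KY.
have nP : nbhs Y (pt @^-1` U) by exact: (pt_continuous Y0 nU).
have /nbhs_ballP[r /= r0 hr] : nbhs Y (pt @^-1` U `&` K).
  by apply: filterI => //; exact: open_nbhs_nbhs.
exists (pt @` ball Y r); split.
- apply: connected_continuous_connected.
    by apply: convex_set_connected => u v t; exact: ball_convex.
  by apply: pt_within => v /hr[_]; exact: (lift_neq0 hK).
- by move=> _ [v /hr[Uv _] <-].
- apply: (filterS _ (pt_ball_nbhs Y0 r0)).
  by move=> _ [v [Bv v0] <-]; exists v.
Qed.

Lemma lift_connected : connected Om.
Proof.
have -> : Om = pt @` K.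
  apply/seteqP; split=> [p /(lift_rep hK)[v Kv ->]|_ [v Kv <-]]; first by exists v.
  exact: (lift_pt hK).
apply: connected_continuous_connected.
  by apply: convex_set_connected => u v t; exact: (lift_seg hK).
by apply: pt_within => v; exact: (lift_neq0 hK).
Qed.

Context (Gamma : set (PGL R n.+1)) (gG : is_subgroup Gamma) (dG : discrete_subset Gamma)
  (GOm : forall g, Gamma g -> pact g @` Om = Om)
  (oOm : open Om).
Local Notation Q := (quotient_set Om Gamma).

Lemma oproj_within (A : set (RP R n)) : {within A, continuous (oproj Gamma)}.
Proof. by apply: continuous_subspaceT; exact: oproj_continuous. Qed.

Lemma oproj_nbhs y (U : set (RP R n)) : nbhs y U -> nbhs (oproj Gamma y) (oproj Gamma @` U).
Proof.
rewrite nbhsE => -[W [oW Wy] WU].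
have nW : nbhs (oproj Gamma y) (oproj Gamma @` W).
  by apply: open_nbhs_nbhs; split; [exact: oproj_open|exists y].
by apply: (filterS _ nW); exact: image_subset.
Qed.

Lemma invariant_pact g p : Gamma g -> Om p -> Om (pact g p).
Proof. by move=> Gg Op; rewrite -(GOm Gg); exists p. Qed.

Lemma quotient_set_open : open Q.
Proof. exact: oproj_open. Qed.

Lemma quotient_set_connected : connected Q.
Proof.
by apply: connected_continuous_connected; [exact: lift_connected|exact: oproj_within].
Qed.

Lemma quotient_set_hausdorff p q : Q p -> Q q -> p <> q -> exists A B,
  [/\ nbhs p A, nbhs q B & forall x, A x -> B x -> False].
Proof.
move=> [y Oy <-] [z Oz <-] yz.
have h g : Gamma g -> pact g y <> z.
  by move=> Gg E; apply: yz; apply/(oprojP gG); exists g.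
have [U [W [oU oW Uy Wz UW]]] := proper_sep hK gG dG GOm Oy Oz (@subset_refl _ Gamma) h.
exists (oproj Gamma @` U), (oproj Gamma @` W); split.
- by apply: oproj_nbhs; exact: open_nbhs_nbhs.
- by apply: oproj_nbhs; exact: open_nbhs_nbhs.
- move=> _ [u Uu <-] [w Ww /esym /(oprojP gG)[g Gg wE]].
  by apply: (UW g u) => //; rewrite -wE.
Qed.

Lemma quotient_set_compact_nbhs x : Q x -> exists N, [/\ compact N, N `<=` Q & nbhs x N].
Proof.
move=> [y Oy <-]; have [N [cN NO nN]] := lift_compact_nbhs Oy.
exists (oproj Gamma @` N); split.
- by apply: continuous_compact => //; exact: oproj_within.
- exact: image_subset.
- exact: oproj_nbhs.
Qed.

Lemma quotient_set_connected_nbhs x U : Q x -> nbhs x U ->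
  exists N, [/\ connected N, N `<=` U & nbhs x N].
Proof.
move=> [y Oy <-] nU; have nP : nbhs y (oproj Gamma @^-1` U) by exact: oproj_continuous.
have [N [cN NU nN]] := lift_connected_nbhs Oy nP.
exists (oproj Gamma @` N); split.
- by apply: connected_continuous_connected => //; exact: oproj_within.
- by move=> _ [w /NU Uw <-].
- exact: oproj_nbhs.
Qed.

End QuotientTopology.

(** * Transport of cusps by projective maps *)

Section SmoothLinear.
Context {R : realType}.

Lemma near_eq_differentiable (V W : normedModType R) (f g : V -> W) (x : V) :
  (\forall y \near x, f y = g y) -> differentiable f x -> differentiable g x.
Proof.
move=> fg df; have fgx := nbhs_singleton fg.
have [dc /eqaddoP h] := (diff_locallyP x f).1 df.
have e : g \o shift x = cst (g x) + 'd f x +o_ (0 : V) id.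
  apply/eqaddoP => eps eps0.
  have cs : {for 0, continuous (fun y : V => y + x)}.
    apply: (@continuousD R V V id (fun=> x)); first exact: cvg_id.
    exact: cst_continuous.
  have nfg : \forall y \near (0 : V), f (y + x) = g (y + x).
    have n0 : nbhs (0 + x) [set y | f y = g y] by rewrite add0r.
    exact: (cs _ n0).
  apply: filterS2 nfg (h eps eps0) => y E; rewrite -fgx.
  by rewrite /= !fctE /= E.
by apply/diff_locallyP; rewrite (diff_unique dc e).
Qed.

Lemma Ck_near_eq k (V W : normedModType R) (U : set V) (f g : V -> W) : open U ->
  (forall x, U x -> f x = g x) -> Ck k U f -> Ck k U g.
Proof.
move=> oU; elim: k f g => [|k IH] f g fg /=.
  have nfg x : U x -> \forall y \near x, f y = g y.
    by move=> Ux; apply: filterS (open_nbhs_nbhs (conj oU Ux)).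
  move=> cf x Ux; have cfx := cf x Ux.
  rewrite /prop_for /continuous_at -(fg x Ux).
  by apply: cvg_trans cfx; apply: near_eq_cvg; exact: nfg.
have nfg x : U x -> \forall y \near x, f y = g y.
  by move=> Ux; apply: filterS (open_nbhs_nbhs (conj oU Ux)).
move=> [df Df]; split=> [x Ux|v].
  exact: near_eq_differentiable (nfg x Ux) (df x Ux).
apply: IH (Df v) => x Ux.
exact: near_eq_derive (nfg x Ux).
Qed.

Lemma Ck_comp_linear k (V V' W : normedModType R) (L : {linear V' -> V}) (U : set V) (f : V -> W) :
  continuous L -> Ck k U f -> Ck k (L @^-1` U) (f \o L).
Proof.
move=> cL; elim: k f => [|k IH] f /=.
  by move=> cf x Ux; apply: continuous_comp; [exact: cL|exact: (cf _ Ux)].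
move=> [df Df]; split=> [x Ux|v].
  by apply: differentiable_comp; [by apply: linear_differentiable|exact: (df _ Ux)].
have -> : 'D_v (f \o L) = 'D_(L v) f \o L.
  apply/funext => x; rewrite /derive.
  have -> // : (fun h : R => h^-1 *: ((f \o L \o shift x) (h *: v) - (f \o L) x))
      = (fun h => h^-1 *: ((f \o shift (L x)) (h *: L v) - f (L x))).
  by apply/funext => h; rewrite /= (linearD L) (linearZZ L).
exact: IH.
Qed.

Lemma Ck_linear_comp k (V W W' : normedModType R) (L : {linear W -> W'}) (U : set V) (f : V -> W) :
  open U -> continuous L -> Ck k U f -> Ck k U (L \o f).
Proof.
move=> oU cL; elim: k f => [|k IH] f /=.
  by move=> cf x Ux; apply: continuous_comp; [exact: (cf _ Ux)|exact: cL].
move=> [df Df]; split=> [x Ux|v].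
  by apply: differentiable_comp; [exact: (df _ Ux)|by apply: linear_differentiable].
apply: (@Ck_near_eq _ _ _ _ (L \o 'D_v f)) => //; last exact: IH.
move=> x Ux /=; have dfx := df x Ux.
rewrite !deriveE//; last by apply: differentiable_comp => //; by apply: linear_differentiable.
have dL : differentiable L (f x) by apply: linear_differentiable.
have dE := diff_lin (f x) cL; by rewrite (diff_comp dfx dL) /= dE.
Qed.

(** Smoothness is tested on local lifts, which are simply composed with linear maps on both
    sides. *)
Lemma smooth_map_linear (V V' W W' : normedModType R) (X Y X' Y' : Type)
    (P : V -> X) (D : set V) (Q : W -> Y) (E : set W) (f : X -> Y)
    (P' : V' -> X') (D' : set V') (Q' : W' -> Y') (E' : set W')
    (L : {linear V' -> V}) (L' : {linear W -> W'}) (a : X' -> X) (b : Y -> Y') :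
  continuous L -> continuous L' ->
  (forall v, D' v -> D (L v) /\ a (P' v) = P (L v)) ->
  (forall w, E w -> E' (L' w) /\ b (Q w) = Q' (L' w)) ->
  smooth_map P D Q E f -> smooth_map P' D' Q' E' (b \o f \o a).
Proof.
move=> cL cL' hD hE sf v D'v; have [Dv aP] := hD v D'v.
have [U [F [oU Uv sF hF]]] := sf _ Dv.
have oU' : open (L @^-1` U) by apply: open_comp => // x _; exact: cL.
exists (L @^-1` U), (L' \o (F \o L)); split=> //.
  by move=> k; apply: Ck_linear_comp => //; apply: Ck_comp_linear => //; exact: sF.
move=> w Uw D'w; have [Dw aPw] := hD w D'w; have [EF QF] := hF _ Uw Dw.
have [E'F bQ] := hE _ EF.
by split=> //=; rewrite -bQ QF aPw.
Qed.

End SmoothLinear.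

Section CollarLinear.
Context {R : realType} {n : nat}.
Local Notation V := 'cV[R]_n.+1.

Definition collar_mulmx (A : 'M[R]_n.+1) (vt : V * R) : V * R := (A *m vt.1, vt.2).

Fact collar_mulmx_linear A : linear (collar_mulmx A).
Proof.
by move=> c [v s] [w t]; rewrite /collar_mulmx /= mulmxDr -scalemxAr.
Qed.

HB.instance Definition _ A := GRing.isLinear.Build R (V * R)%type (V * R)%type _
  (collar_mulmx A) (collar_mulmx_linear A).

Lemma collar_mulmx_continuous A : continuous (collar_mulmx A).
Proof.
move=> vt; apply: (@cvg_pair _ _ _ _ (nbhs (A *m vt.1)) (nbhs vt.2)).
  apply: (@continuous_comp _ _ _ (fst : V * R -> V) (mulmx A)); first exact: cvg_fst.
  exact: mulmxl_continuous.
exact: cvg_snd.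
Qed.

End CollarLinear.

Section Transport.
Context {R : realType} {n : nat}.
Local Notation V := 'cV[R]_n.+1.
Local Notation G := (PGL R n.+1).

Definition conjset (a : G) (Gamma : set G) : set G := [set (a * g * a^-1)%g | g in Gamma].

Lemma conjsetP a Gamma g : conjset a Gamma g <-> Gamma (a^-1 * g * a)%g.
Proof.
split=> [[h Gh <-]|Gg]; first by rewrite !mulgA mulVg mul1g -mulgA mulVg mulg1.
by exists (a^-1 * g * a)%g => //; rewrite !mulgA mulgV mul1g -mulgA mulgV mulg1.
Qed.

Lemma pact_pgl (a : G) (v : V) : v != 0 -> pact a (pt v) = pt (mat_of a *m v).
Proof. by move=> v0; rewrite -{1}(mat_ofK a) pactE// mat_of_unit. Qed.

Lemma pactV_pgl (a : G) (v : V) : v != 0 -> pact a^-1%g (pt v) = pt (invmx (mat_of a) *m v).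
Proof.
by move=> v0; rewrite -{1}(mat_ofK a) pglV ?mat_of_unit// pactE// unitmx_inv mat_of_unit.
Qed.

Lemma pact_image_interior (a : G) (X : set (RP R n)) :
  (pact a @` X)° = pact a @` X°.
Proof.
apply/seteqP; split.
  move=> p; rewrite {1}/interior nbhsE => -[U [oU Up] UX].
  rewrite pact_image /=.
  have oaU : open (pact a @^-1` U) by exact: pact_preimage_open.
  have : open_nbhs (pact a^-1%g p) (pact a @^-1` U).
    by split=> //=; rewrite pactVK.
  move=> /open_nbhs_nbhs; apply: filterS => q /= /UX; rewrite pact_image /=.
  by rewrite pactK.
have h : pact a @` X° `<=` pact a @` X by apply: image_subset; exact: interior_subset.
move=> p Xp; have np : nbhs p (pact a @` X°).
  by apply: open_nbhs_nbhs; split=> //; apply: pact_image_open; exact: open_interior.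
exact: filterS h np.
Qed.

Lemma pact_image_bdry (a : G) (X : set (RP R n)) :
  bdry (pact a @` X) = pact a @` bdry X.
Proof.
by rewrite /bdry pact_image_interior !pact_image; apply/seteqP; split=> p.
Qed.

Lemma cone_pact_image (a : G) (X : set (RP R n)) v :
  cone (pact a @` X) v <-> cone X (invmx (mat_of a) *m v).
Proof.
rewrite /cone pact_image; split=> -[v0] /=.
  rewrite pactV_pgl// => Xv; split=> //; apply: mulmx_neq0 => //.
  by rewrite unitmx_inv mat_of_unit.
have v0' : v != 0 by apply: contraNneq v0 => ->; rewrite mulmx0.
by rewrite pactV_pgl.
Qed.

Lemma rank2_mulmx_neq0 (W : 'M[R]_(n.+1, 2)) (c : 'cV[R]_2) :
  \rank W = 2%N -> c != 0 -> W *m c != 0.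
Proof.
move=> rW; apply: contra => /eqP Wc.
have fW : row_free W^T by rewrite /row_free mxrank_tr rW.
rewrite -[c]trmxK; apply/eqP; rewrite [c^T](_ : _ = 0) ?trmx0//.
by apply/eqP; rewrite -(mulmx_free_eq0 _ fW) -trmx_mul Wc trmx0.
Qed.

Lemma mxrank_unitl m (A : 'M[R]_n.+1) (W : 'M[R]_(n.+1, m)) : A \in unitmx ->
  \rank (A *m W) = \rank W.
Proof. by move=> uA; rewrite -mxrank_tr trmx_mul mxrankMfree ?mxrank_tr// row_free_unit unitmx_tr. Qed.

Lemma pact_projective_line (a : G) (L : set (RP R n)) :
  projective_line L -> projective_line (pact a @` L).
Proof.
move=> [W rW ->]; exists (mat_of a *m W).
  by rewrite mxrank_unitl ?mat_of_unit.
apply/seteqP; split=> [_ [_ [c c0 <-] <-]|_ [c c0 <-]].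
  by exists c => //; rewrite pact_pgl ?mulmxA// rank2_mulmx_neq0.
exists (pt (W *m c)); first by exists c.
by rewrite pact_pgl ?mulmxA// rank2_mulmx_neq0.
Qed.

Lemma pact_properly_convex (a : G) (X : set (RP R n)) :
  properly_convex X -> properly_convex (pact a @` X).
Proof.
move=> pX L /(pact_projective_line a^-1%g) /pX[cX [p [q [pq [Lp nXp] [Lq nXq]]]]].
have LE : pact a^-1%g @` L = pact a @^-1` L.
  apply/seteqP; split=> [_ [z Lz <-]|z Lz] /=; first by rewrite pactVK.
  by exists (pact a z) => //; rewrite pactK.
rewrite LE in cX Lp Lq; split.
  have -> : pact a @` X `&` L = pact a @` (X `&` pact a @^-1` L).
    apply/seteqP; split=> [_ [[z Xz <-] Lz]|_ [z [Xz Lz] <-]]; first by exists z.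
    by split=> //; exists z.
  apply: connected_continuous_connected => //; apply: continuous_subspaceT.
  exact: pact_continuous.
have h z : ~ X z -> ~ (pact a @` X) (pact a z).
  by move=> nX; rewrite pact_image /= pactK.
exists (pact a p), (pact a q); split; [|by split=> //; exact: h|by split=> //; exact: h].
by move=> /(congr1 (pact a^-1%g)); rewrite !pactK.
Qed.

Lemma conj_mulg (a g h : G) : (a * g * a^-1 * (a * h * a^-1) = a * (g * h) * a^-1)%g.
Proof. by rewrite !mulgA -[(_ * a^-1 * a)%g]mulgA mulVg mulg1. Qed.

Lemma conjset_subgroup (a : G) Gamma : is_subgroup Gamma -> is_subgroup (conjset a Gamma).
Proof.
move=> [G1 GM GV]; split.
- by apply/conjsetP; rewrite mulg1 mulVg.
- by move=> _ _ [g Gg <-] [h Gh <-]; rewrite conj_mulg; exists (g * h)%g => //; exact: GM.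
- move=> _ [g Gg <-]; exists (g^-1)%g; first exact: GV.
  apply: (mulgI (a * g * a^-1)%g); rewrite mulgV conj_mulg mulgV mulg1 mulgV//.
Qed.

Lemma pgl_translate_open (b c : G) (U : set G) : open U -> open [set g | U (b * g * c)%g].
Proof.
move=> /(open_proj_lift (exist (fun B => B \in @invmat R n.+1) _ (invmat1 R n.+1)))[W oW WU].
have uM (X : 'M[R]_n.+1) : X \in unitmx -> mat_of b *m X *m mat_of c \in unitmx.
  by move=> uX; rewrite !unitmx_mul !mat_of_unit uX.
apply: (@open_proj _ _ _ (exist (fun B => B \in @invmat R n.+1) _ (invmat1 R n.+1)) _
  [set X : 'M[R]_n.+1 | W (mat_of b *m X *m mat_of c)]).
  apply: (@open_comp _ _ (fun X : 'M[R]_n.+1 => mat_of b *m X *m mat_of c)) => // X _.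
  apply: (@continuous_comp _ _ _ (mulmx (mat_of b)) (mulmxr (mat_of c))).
    exact: mulmxl_continuous.
  exact: mulmxr_continuous.
move=> X /set_mem uX /=.
have -> : pclass (exist (fun B => B \in @invmat R n.+1) _ (invmat1 R n.+1)) X = pgl X by [].
have -> : (b * pgl X * c)%g = pgl (mat_of b *m X *m mat_of c).
  rewrite -[b in LHS]mat_ofK -[c in LHS]mat_ofK pglM ?mat_of_unit//.
  by rewrite pglM ?mat_of_unit// unitmx_mul mat_of_unit.
by apply: WU; apply/mem_set/uM.
Qed.

Lemma conjset_discrete (a : G) Gamma : discrete_subset Gamma -> discrete_subset (conjset a Gamma).
Proof.
move=> dG _ [g Gg <-]; split; first by apply/mem_set; exists g.
have [_ [U nU UG]] := dG g Gg.
move: nU; rewrite nbhsE => -[U' [oU' U'g] U'U].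
exists [set h | U' (a^-1 * h * a)%g].
  apply: open_nbhs_nbhs; split; first exact: pgl_translate_open.
  by rewrite /= !mulgA mulVg mul1g -mulgA mulVg mulg1.
apply/seteqP; split=> [h [/U'U Uh /conjsetP Gh]|_ ->].
  have : [set g] (a^-1 * h * a)%g by rewrite -UG.
  by move=> /= <-; rewrite !mulgA mulgV mul1g -mulgA mulgV mulg1.
split; last by exists g.
by rewrite /= !mulgA mulVg mul1g -mulgA mulVg mulg1.
Qed.

Lemma pact_manifold (a : G) (X : set (RP R n)) Gamma :
  properly_convex_manifold X Gamma -> properly_convex_manifold (pact a @` X) (conjset a Gamma).
Proof.
move=> [pX [x Xx] gG dG [GX fG]]; split.
- exact: pact_properly_convex.
- by exists (pact a x), x.
- exact: conjset_subgroup.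
- exact: conjset_discrete.
- split.
    move=> _ [g Gg <-]; apply/seteqP; split.
      move=> _ [_ [y Xy <-] <-]; exists (pact g y); first by rewrite -(GX g Gg); exists y.
      by rewrite !pactM pactK.
    move=> _ [y Xy <-]; have : (pact g @` X) y by rewrite GX.
    move=> [z Xz <-]; exists (pact a z); first by exists z.
    by rewrite !pactM pactK.
  move=> _ _ [g Gg <-] [y Xy <-]; rewrite !pactM pactK => /(congr1 (pact a^-1%g)).
  by rewrite !pactK => /(fG g y Gg Xy) ->; rewrite mulg1 mulgV.
Qed.

Lemma conjset_virtually_abelian (a : G) Gamma :
  virtually_abelian Gamma -> virtually_abelian (conjset a Gamma).
Proof.
move=> [H [gH HG HC [s hs]]]; exists (conjset a H); split.
- exact: conjset_subgroup.
- exact: image_subset.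
- by move=> _ _ [g Hg <-] [h Hh <-]; rewrite !conj_mulg (HC g h Hg Hh).
- exists [seq (a * x * a^-1)%g | x <- s] => _ [g Gg <-].
  have [k [h [ks Hh ->]]] := hs g Gg.
  exists (a * k * a^-1)%g, (a * h * a^-1)%g; split.
  + exact: map_f.
  + by exists h.
  + by rewrite conj_mulg.
Qed.

(** The map between orbit spaces induced by [a], through a chosen representative; the choice is
    immaterial once conjugation by [a] sends [Gamma] into [Gamma']. *)
Definition orbit_pact (a : G) (Gamma Gamma' : set G) (q : orbit_space Gamma) : orbit_space Gamma' :=
  oproj Gamma' (pact a (repr q)).

Section OrbitPact.
Context (a : G) (Gamma Gamma' : set G) (gG : is_subgroup Gamma) (gG' : is_subgroup Gamma')
  (aG : forall g, Gamma g -> Gamma' (a * g * a^-1)%g).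

Lemma orbit_pactE p : orbit_pact a Gamma' (oproj Gamma p) = oproj Gamma' (pact a p).
Proof.
have /(oprojP gG)[k Gk pE] : oproj Gamma (repr (oproj Gamma p)) = oproj Gamma p.
  by rewrite /oproj reprK.
rewrite /orbit_pact [in RHS]pE -(oproj_pact gG' (pact a (repr _)) (aG Gk)).
by rewrite !pactM pactK.
Qed.

Lemma orbit_pact_continuous : continuous (orbit_pact a Gamma' : orbit_space Gamma -> _).
Proof.
apply/continuousP => U oU; apply/open_orbit_space.
have -> : oproj Gamma @^-1` (orbit_pact a Gamma' @^-1` U) = pact a @^-1` (oproj Gamma' @^-1` U).
  by apply/seteqP; split=> p /=; rewrite orbit_pactE.
by apply: pact_preimage_open; apply/open_orbit_space.
Qed.

Lemma quotient_set_pact (S : set (RP R n)) :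
  quotient_set (pact a @` S) Gamma' = orbit_pact a Gamma' @` quotient_set S Gamma.
Proof.
apply/seteqP; split=> [_ [_ [p Sp <-] <-]|_ [_ [p Sp <-] <-]].
  by exists (oproj Gamma p); [exists p|exact: orbit_pactE].
by rewrite orbit_pactE; exists (pact a p) => //; exists p.
Qed.

End OrbitPact.

Lemma pact_no_segment (a : G) (S : set (RP R n)) :
  (forall v w s, independent v w -> v + s *: w != 0 :> V) ->
  contains_no_segment S -> contains_no_segment (pact a @` S).
Proof.
move=> nz nS [u [w [b [c [ind bc h]]]]]; apply: nS.
exists (invmx (mat_of a) *m u), (invmx (mat_of a) *m w), b, c; split=> //.
  by rewrite /independent -mul_mx_row mxrank_unitl ?unitmx_inv ?mat_of_unit.
move=> s sbc; have := h s sbc; rewrite pact_image /= /line_pt pactV_pgl; last exact: nz.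
by rewrite mulmxDr scalemxAr.
Qed.

Lemma pact_diffeo (a : G) (X : set (RP R n)) Gamma : is_subgroup Gamma ->
  diffeo_to_collar X Gamma -> diffeo_to_collar (pact a @` X) (conjset a Gamma).
Proof.
move=> gG [f [g [sf sg gf fg]]].
have gG' := conjset_subgroup a gG.
have aG h : Gamma h -> conjset a Gamma (a * h * a^-1)%g by exists h.
have aV h : conjset a Gamma h -> Gamma (a^-1 * h * a^-1^-1)%g by rewrite invgK => /conjsetP.
pose A := mat_of a; have uA : A \in unitmx := mat_of_unit a.
pose T : orbit_space Gamma -> orbit_space (conjset a Gamma) := orbit_pact a (conjset a Gamma).
pose T' : orbit_space (conjset a Gamma) -> orbit_space Gamma := orbit_pact a^-1%g Gamma.
have TE p : T (oproj Gamma p) = oproj _ (pact a p) := orbit_pactE gG gG' aG p.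
have T'E p : T' (oproj _ p) = oproj Gamma (pact a^-1%g p) := orbit_pactE gG' gG aV p.
have TK q : T' (T q) = q by rewrite -(reprK q) -/(oproj Gamma _) TE T'E pactK.
have T'K q : T (T' q) = q by rewrite -(reprK q) -/(oproj _ _) T'E TE pactVK.
pose b (y : orbit_space Gamma * R) := (T y.1, y.2).
pose b' (y : orbit_space (conjset a Gamma) * R) := (T' y.1, y.2).
have bK y : b' (b y) = y by case: y => q t; rewrite /b /b' /= TK.
have b'K y : b (b' y) = y by case: y => q t; rewrite /b /b' /= T'K.
have coneA (Y : set (RP R n)) v : cone Y v ->
    cone (pact a @` Y) (A *m v) /\ T (vproj Gamma v) = vproj (conjset a Gamma) (A *m v).
  move=> Yv; split; first by apply/cone_pact_image; rewrite mulKmx.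
  by rewrite /vproj TE pact_pgl//; case: Yv.
have coneA' (Y : set (RP R n)) v : cone (pact a @` Y) v ->
    cone Y (invmx A *m v) /\ T' (vproj (conjset a Gamma) v) = vproj Gamma (invmx A *m v).
  move=> Yv; have v0 : v != 0 by case: Yv.
  by move/cone_pact_image: Yv => Yv; split=> //; rewrite /vproj T'E pactV_pgl.
pose Y0 : set (RP R n) := pact a @` X.
pose E0 := cone (bdry X) `*` [set t : R | 0 <= t].
pose E1 := cone (bdry Y0) `*` [set t : R | 0 <= t].
pose Q0 (vt : V * R) := (vproj Gamma vt.1, vt.2).
pose Q1 (vt : V * R) := (vproj (conjset a Gamma) vt.1, vt.2).
pose LA : {linear V -> V} := mulmx A.
pose LA' : {linear V -> V} := mulmx (invmx A).
pose CA : {linear (V * R)%type -> (V * R)%type} := collar_mulmx A.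
pose CA' : {linear (V * R)%type -> (V * R)%type} := collar_mulmx (invmx A).
exists (b \o f \o T'), (T \o g \o b'); split.
- refine (@smooth_map_linear R V V (V * R)%type (V * R)%type _ _ _ _ (vproj Gamma) (cone X) Q0 E0 f
    (vproj (conjset a Gamma)) (cone Y0) Q1 E1 LA' CA T' b _ _ _ _ sf).
  + exact: mulmxl_continuous.
  + exact: collar_mulmx_continuous.
  + by move=> v /coneA'.
  + move=> [v t] [/= Sv t0]; have [h1 h2] := coneA _ _ Sv.
    by rewrite /E1 /Y0 pact_image_bdry; split; [split|rewrite /b /Q0 /Q1 /= h2].
- refine (@smooth_map_linear R (V * R)%type (V * R)%type V V _ _ _ _ Q0 E0 (vproj Gamma) (cone X) g
    Q1 E1 (vproj (conjset a Gamma)) (cone Y0) CA' LA b' T _ _ _ _ sg).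
  + exact: collar_mulmx_continuous.
  + exact: mulmxl_continuous.
  + move=> [v t] [/=]; rewrite /Y0 pact_image_bdry => Sv t0; have [h1 h2] := coneA' _ _ Sv.
    by split; [split|rewrite /b' /Q0 /Q1 /= h2].
  + by move=> v /coneA.
- move=> x [v Dv <-] /=; rewrite bK gf ?T'K//.
  by have [h1 ->] := coneA' _ _ Dv; exists (invmx A *m v).
- move=> y [[v t] [/=]]; rewrite pact_image_bdry => Sv t0 <- /=.
  rewrite TK fg ?b'K//; have [h1 h2] := coneA' _ _ Sv.
  by exists (invmx A *m v, t) => //; rewrite /b' /= h2.
Qed.

Lemma generalized_cusp_pact (a : G) (X : set (RP R n)) Gamma :
  generalized_cusp X Gamma -> generalized_cusp (pact a @` X) (conjset a Gamma).
Proof.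
move=> [mX vG [cS nS] seg dX].
have [_ _ gG _ _] := mX.
have gG' := conjset_subgroup a gG.
have aG h : Gamma h -> conjset a Gamma (a * h * a^-1)%g by exists h.
split.
- exact: pact_manifold.
- exact: conjset_virtually_abelian.
- have oc : {within quotient_set (bdry X) Gamma,
      continuous (orbit_pact a (conjset a Gamma) : orbit_space Gamma -> _)}.
    by apply: continuous_subspaceT; exact: orbit_pact_continuous.
  rewrite pact_image_bdry (quotient_set_pact gG gG' aG); split.
    exact: continuous_compact.
  exact: connected_continuous_connected.
- rewrite pact_image_bdry; apply: pact_no_segment => // v w s ind.
  apply/eqP => E; have [] := @independent_neq0 _ _ v w 1 s ind; first by rewrite scale1r.
  by move/eqP; rewrite oner_eq0.
- exact: pact_diffeo.
Qed.

Lemma cusp_in_pact (Om X : set (RP R n)) (Gamma Gamma' : set G) (a : G) :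
  is_subgroup Gamma -> (forall g, Gamma g -> pact g @` Om = Om) -> Gamma a ->
  cusp_in Om Gamma X Gamma' -> cusp_in Om Gamma (pact a @` X) (conjset a Gamma').
Proof.
move=> [G1 GM GV] GOm Ga [cX XO G'G h]; split.
- exact: generalized_cusp_pact.
- by move=> _ [x /XO Ox <-]; rewrite -(GOm a Ga); exists x.
- by move=> _ [g /G'G Gg <-]; apply: (GM); [exact: GM|exact: GV].
- move=> g _ Gg [x Xx <-]; rewrite -pactM pact_image /= -pactM => Xgx.
  apply/conjsetP; rewrite -mulgA; apply: (h _ x) => //.
  by apply: (GM); [exact: GV|exact: GM].
Qed.

End Transport.

(** * The cusp of a displaced element *)

Section DisplacedCusp.
Context {R : realType} {n : nat}.
Local Notation V := 'cV[R]_n.+1.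
Context (Om : set (RP R n)) (K : set V) (hK : is_lift Om K).
Context (Gamma : set (PGL R n.+1)) (gG : is_subgroup Gamma) (dG : discrete_subset Gamma)
  (GOm : forall g, Gamma g -> pact g @` Om = Om)
  (fG : forall g p, Gamma g -> Om p -> pact g p = p -> g = 1%g)
  (oOm : open Om).
Local Notation Q := (quotient_set Om Gamma).
Local Notation pi := (oproj Gamma).

Lemma close_segment (d : R) u v t : 0 <= d -> K u -> K v -> ccl K (v - u) ->
  ccl K ((1 + d) *: u - v) -> 0 <= t <= 1 -> close K d (pt u) (pt ((1 - t) *: u + t *: v)).
Proof.
move=> d0 Ku Kv c1 c2 t01; have /andP[t0 t1] := t01.
exists u, ((1 - t) *: u + t *: v); split=> //; first exact: (lift_seg hK).
split.
  have -> : (1 - t) *: u + t *: v - u = t *: (v - u).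
    by apply/matrixP => i j; rewrite !mxE; ring.
  exact: (cclZ hK).
have -> : (1 + d) *: u - ((1 - t) *: u + t *: v)
    = ((1 - t) * d) *: u + t *: ((1 + d) *: u - v).
  by apply/matrixP => i j; rewrite !mxE; ring.
apply: (cclD hK); apply: (cclZ hK) => //; last exact: ccl_sub.
by rewrite mulr_ge0// subr_ge0.
Qed.

Lemma close_invariant (d : R) g p q : Gamma g -> close K d p q ->
  close K d (pact g p) (pact g q).
Proof. by move=> Gg; have [A gA] := lift_exists hK (GOm Gg); exact: (close_pact hK gA). Qed.

(** Near [y] no nontrivial element brings a small neighbourhood back to itself. A point of the orbit
    over this neighbourhood is displaced as much by [g] as its translate near [y] is by a conjugate
    of [g], which is still nontrivial. *)
Lemma displacement_compact g (C : set (orbit_space Gamma)) : Gamma g -> g <> 1%g ->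
  compact C -> C `<=` Q ->
  exists2 d : R, 0 < d & forall x, Om x -> close K d x (pact g x) -> ~ C (pi x).
Proof.
have [G1 GM GV] := gG; move=> Gg g1 cC CQ.
apply: (@compact_ind _ C (fun A => exists2 d : R, 0 < d &
  forall x, Om x -> close K d x (pact g x) -> ~ A (pi x))) => //.
- by exists 1 => // x _ _ [].
- move=> A B [d d0 hA] [e e0 hB]; exists (Num.min d e); first by rewrite lt_min d0.
  move=> x Ox cx [Ax|Bx].
    by apply: (hA x Ox _ Ax); apply: (close_mono hK _ cx); rewrite ge_min lexx.
  by apply: (hB x Ox _ Bx); apply: (close_mono hK _ cx); rewrite ge_min lexx orbT.
- by move=> A B AB [d d0 hB]; exists d => // x Ox cx /AB; exact: hB.
- move=> _ /CQ[y Oy <-].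
  pose G0 := [set k | Gamma k /\ k <> 1%g].
  have hG0 k : G0 k -> pact k y <> y by move=> [Gk k1] /(fG Gk Oy).
  have G0G : G0 `<=` Gamma by move=> k [].
  have [U [W [oU oW Uy Wy UW]]] := proper_sep hK gG dG GOm Oy Oy G0G hG0.
  have nUW : nbhs y (U `&` W) by apply: open_nbhs_nbhs; split=> //; exact: openI.
  have [W' [oW' W'y] [d d0 hd]] := close_nbhs hK Oy nUW.
  exists (pi @` (W' `&` (U `&` W))).
    apply: (oproj_nbhs gG); apply: open_nbhs_nbhs; split=> //.
    by apply: openI => //; exact: openI.
  exists d => // x Ox cx [x' [W'x' [Ux' _]] /(oprojP gG)[k Gk xE]].
  have Ox' : Om x'.
    by have := invariant_pact GOm (GV _ Gk) Ox; rewrite xE pactK.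
  have : close K d x' (pact (k^-1 * (g * k))%g x').
    have := close_invariant (GV _ Gk) cx; rewrite xE pactK.
    by rewrite !pactM.
  move=> /hd[/(_ W'x')[Uz Wz] _].
  have Gk' : Gamma (k^-1 * (g * k))%g by exact (GM _ _ (GV _ Gk) (GM _ _ Gg Gk)).
  have [k1|k1] := pselect ((k^-1 * (g * k))%g = 1%g); last exact: (UW _ x' (conj Gk' k1)).
  apply: g1; move: k1 => /(congr1 (fun z => (k * z * k^-1)%g)).
  by rewrite !mulgA mulgV mul1g mulg1 mulgV -mulgA mulgV mulg1.
Qed.

(** Used to keep a whole segment off a compact set by a condition on its initial point alone, all
    points of a short segment being close to that one. *)
Lemma close_compact (C : set (orbit_space Gamma)) : compact C -> C `<=` Q ->
  exists C', [/\ compact C', C' `<=` Q & exists2 d : R, 0 < d &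
    forall x z, Om x -> Om z -> close K d x z -> C (pi z) -> C' (pi x)].
Proof.
have [G1 GM GV] := gG; move=> cC CQ.
apply: (@compact_ind _ C (fun A => exists C', [/\ compact C', C' `<=` Q & exists2 d : R, 0 < d &
    forall x z, Om x -> Om z -> close K d x z -> A (pi z) -> C' (pi x)])) => //.
- by exists set0; split; [exact: compact0|by []|by exists 1].
- move=> A B [A' [cA A'Q [d d0 hA]]] [B' [cB B'Q [e e0 hB]]].
  exists (A' `|` B'); split; [exact: compactU|by move=> x [/A'Q|/B'Q]|].
  exists (Num.min d e); first by rewrite lt_min d0.
  move=> x z Ox Oz xz [Az|Bz]; [left|right].
    by apply: (hA x z) => //; apply: (close_mono hK _ xz); rewrite ge_min lexx.
  by apply: (hB x z) => //; apply: (close_mono hK _ xz); rewrite ge_min lexx orbT.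
- move=> A B AB [C' [cC' C'Q [d d0 hd]]]; exists C'; split=> //; exists d => //.
  by move=> x z Ox Oz xz /AB; exact: (hd x z).
- move=> _ /CQ[y Oy <-]; have [N [cN NO nN]] := lift_compact_nbhs hK Oy.
  have [W [oW Wy] [d d0 hd]] := close_nbhs hK Oy nN.
  exists (pi @` W); first by apply: (oproj_nbhs gG); exact: open_nbhs_nbhs.
  exists (pi @` N); split.
  + by apply: continuous_compact => //; exact: oproj_within.
  + exact: image_subset.
  + exists d => // x z Ox Oz xz [z' Wz' /(oprojP gG)[k Gk zE]].
    have := close_invariant (GV _ Gk) xz; rewrite zE pactK => /hd[_ /(_ Wz') Nx].
    by exists (pact k^-1%g x) => //; rewrite (oproj_pact gG)//; exact: GV.
Qed.

(** The canonical map from orbits of [Gamma'] to orbits of [Gamma] is [orbit_pact] at the identity,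
    hence the detour through [pact 1%g]. *)
Lemma quotient_set_compact_le (Gamma' : set (PGL R n.+1)) (S : set (RP R n)) :
  is_subgroup Gamma' -> Gamma' `<=` Gamma ->
  compact (quotient_set S Gamma') -> compact (quotient_set S Gamma).
Proof.
move=> gG' G'G cS.
have aG h : Gamma' h -> Gamma (1 * h * 1^-1)%g by rewrite mul1g invg1 mulg1; exact: G'G.
have <- : pact 1%g @` S = S.
  by apply/seteqP; split=> [_ [p Sp <-]|p Sp]; [rewrite pact1|exists p; rewrite ?pact1].
rewrite (quotient_set_pact gG' gG aG); apply: continuous_compact => //.
by apply: continuous_subspaceT; exact: orbit_pact_continuous.
Qed.

(* A point x of a far piece e C2 that g moves by less than d cannot be joined to
   the boundary of the cusp within distance d, so that the segment from x to
   g x stays in a single translate of the interior of the cusp. *)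
Lemma displaced_cusp (hends : every_end_is_generalized_cusp Om Gamma) g : Gamma g -> g <> 1%g ->
  (forall d : R, 0 < d -> exists2 x, Om x & close K d x (pact g x)) ->
  exists Om' Gamma' k u v, [/\ cusp_in Om Gamma Om' Gamma', Gamma k,
    K u /\ K v, pt v = pact g (pt u) &
    forall t, 0 <= t <= 1 -> Om'° (pact k (pt ((1 - t) *: u + t *: v)))].
Proof.
have [G1 GM GV] := gG; move=> Gg g1 hd.
pose T (d : R) := [set x | Om x /\ close K d x (pact g x)].
pose F0 := filter_from [set d : R | 0 < d] (fun d => pi @` T d).
have pF0 : ProperFilter F0.
  apply: filter_from_proper.
    apply: filter_from_filter; first by exists 1 => /=.
    move=> d e /= d0 e0; exists (Num.min d e); first by rewrite /= lt_min d0.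
    move=> _ [x [Ox cx] <-]; split; exists x => //; split=> //.
      by apply: (close_mono hK _ cx); rewrite ge_min lexx.
    by apply: (close_mono hK _ cx); rewrite ge_min lexx orbT.
  by move=> d /= /hd[x Ox cx]; exists (pi x), x.
have [F [uF F0F]] := ultraFilterLemma pF0.
have FT (d : R) : 0 < d -> F (pi @` T d) by move=> d0; apply: F0F; exists d.
have FQ : F Q.
  by apply: filterS (FT 1 ltr01) => _ [x [Ox _] <-]; exists x.
have FC C : compact C -> C `<=` Q -> F (~` C).
  move=> cC CQ; have [d d0 h] := displacement_compact Gg g1 cC CQ.
  by apply: filterS (FT d d0) => _ [x [Ox cx] <-]; exact: h.
have cQ : connected Q by apply: quotient_set_connected; exact: hK.
have [e [ende Fe]] := ultra_end (quotient_set_open gG oOm) cQ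
  (quotient_set_hausdorff hK gG dG GOm) (quotient_set_compact_nbhs hK gG)
  (quotient_set_connected_nbhs hK gG) uF FQ FC.
have [Om' [Gamma' [cusp [C0 [cC0 C0Q eC0 _]]]]] := hends e ende.
have [[[_ _ gG' _ [G'Om' _]] _ [cS _] _ _] Om'Om G'G hcusp] := cusp.
(* Beyond [C2] the end lies over the cusp and avoids its boundary, hence lies over its interior. *)
pose C2 := C0 `|` quotient_set (bdry Om') Gamma.
have cC2 : compact C2.
  apply: compactU => //; exact: (quotient_set_compact_le gG').
have C2Q : C2 `<=` Q.
  by move=> x [/C0Q//|[y [Oy _] <-]]; exists y => //; exact: Om'Om.
have [C3 [cC3 C3Q [d d0 hC3]]] := close_compact cC2 C2Q.
have [_ [[[x [Ox cx] <-] ex] nC3x]] :=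
  filter_ex (filterI (filterI (FT d d0) (Fe C2 cC2 C2Q)) (FC C3 cC3 C3Q)).
move: (cx) => [u [v [Ku Kv xE gxE [c1 c2]]]].
pose p t := pt ((1 - t) *: u + t *: v).
have cp t : 0 <= t <= 1 -> close K d x (p t).
  by move=> t01; rewrite xE; apply: close_segment => //; exact: ltW.
have Kt t : 0 <= t <= 1 -> K ((1 - t) *: u + t *: v) by exact: (lift_seg hK).
have Op t : 0 <= t <= 1 -> Om (p t) by move=> /Kt; exact: (lift_pt hK).
have nC2 t : 0 <= t <= 1 -> ~ C2 (pi (p t)).
  by move=> t01 Cp; apply: nC3x; apply: (hC3 x (p t)) => //; [exact: Op|exact: cp].
have p0 : p 0 = x by rewrite /p subr0 scale1r scale0r addr0.
have lc : continuous (fun t : R => (1 - t) *: u + t *: v) by exact: segment_continuous.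
have pc t : 0 <= t <= 1 -> {for t, continuous p}.
  move=> t01; apply: continuous_comp; first exact: lc.
  by apply: pt_continuous; apply: (lift_neq0 hK); exact: Kt.
have conn : connected ((pi \o p) @` `[0, 1]).
  apply: connected_continuous_connected; first exact: segment_connected.
  apply: continuous_in_subspaceT => t /set_mem; rewrite /= in_itv/= => t01.
  by apply: continuous_comp; [exact: pc|exact: oproj_continuous].
have sub : (pi \o p) @` `[0, 1] `<=` e C2.
  have [y My eE] := ende.1 C2 cC2 C2Q.
  rewrite eE in ex *; rewrite (same_connected_component ex).
  apply: connected_component_max => //.
    by exists 0; [rewrite /= in_itv/= lexx ler01|rewrite /= p0].
  move=> _ [t +  <-]; rewrite /= in_itv/= => t01; split; last exact: nC2.
  by exists (p t) => //; exact: Op.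
have int t : 0 <= t <= 1 -> exists2 k, Gamma k & Om'° (pact k (p t)).
  move=> t01; have : e C2 (pi (p t)).
    by apply: sub; exists t => //; rewrite /= in_itv.
  have eC2 : e C2 `<=` e C0 by apply: ende.2 => // z; left.
  move=> /eC2/eC0[z Oz /esym /(oprojP gG)[k Gk zE]]; exists k => //; rewrite -zE.
  apply: contrapT => nz; apply: (nC2 t t01); right; exists z => //.
  by rewrite zE (oproj_pact gG).
have int_inv k z : Gamma' k -> Om'° z -> Om'° (pact k z).
  move=> Gk Oz; suff : nbhs z (pact k @^-1` Om').
    move=> h; have : nbhs (pact k z) (pact k @` (Om'°)).
      by apply: open_nbhs_nbhs; split; [exact/pact_image_open/open_interior|exists z].
    apply: filterS => _ [w /interior_subset Ow <-].
    by rewrite -(G'Om' k Gk); exists w.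
  by apply: filterS Oz => w Ow /=; rewrite -(G'Om' k Gk); exists w.
have [k Gk Ok0] := int 0 (ltac:(by rewrite lexx ler01)).
exists Om', Gamma', k, u, v; split; [exact: cusp|exact: Gk|exact: conj|by rewrite -gxE -xE|].
have [_ GM' GV'] := gG'.
have itvM (s t : R) : 0 <= s <= 1 -> 0 <= t <= 1 -> 0 <= s * t <= 1.
  move=> /andP[s0 s1] /andP[t0 t1]; rewrite mulr_ge0//=.
  by apply: le_trans (ler_piMl t0 s1) t1.
have cont (h : PGL R n.+1) (s t : R) : 0 <= s <= 1 -> 0 <= t <= 1 ->
    Om'° (pact h (p (s * t))) -> \forall z \near s, 0 <= z <= 1 -> Om'° (pact h (p (z * t))).
  move=> s01 t01 Oh.
  have c : {for s, continuous (fun z : R => pact h (p (z * t)))}.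
    have c1' : {for s, continuous (fun z : R => z * t)} by exact: mulrr_continuous.
    have c2' : {for s * t, continuous p} by apply: pc; exact: itvM.
    have c3' : {for p (s * t), continuous (pact h)} by exact: pact_continuous.
    exact: (continuous_comp (continuous_comp c1' c2') c3').
  have h0 : \forall z \near s, Om'° (pact h (p (z * t))) by exact: c _ (nbhs_interior Oh).
  by apply: filterS h0.
move=> t t01; rewrite -/(p t) -[t]mul1r.
(* The second set gathers the translates by other cosets of [Gamma']; it is disjoint from the first
   because the cusp embeds. The parameter [s * t] turns an arbitrary [t] into the end point 1 of the
   connectedness argument. *)
apply: (@real_segment_connected R (fun s => Om'° (pact k (p (s * t))))
  (fun s => exists h, [/\ Gamma h, Om'° (pact h (p (s * t))) & ~ Gamma' (h * k^-1)%g])).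
- by rewrite mul0r.
- move=> s s01; have [h Gh Oh] := int (s * t) (itvM _ _ s01 t01).
  have [G'h|nG'h] := pselect (Gamma' (h * k^-1)%g); last by right; exists h.
  have E : pact (h * k^-1)%g (pact k (p (s * t))) = pact h (p (s * t)).
    by rewrite -pactM -mulgA mulVg mulg1.
  left; rewrite -(pactK (h * k^-1)%g (pact k (p (s * t)))) E.
  exact: (int_inv _ _ (GV' _ G'h) Oh).
- move=> s Ok [h [Gh Oh]]; apply.
  apply: (hcusp _ (pact k (p (s * t)))); first by apply: GM => //; exact: GV.
    exact: interior_subset Ok.
  by rewrite -pactM -mulgA mulVg mulg1; exact: interior_subset Oh.
- by move=> s s01 Ok; exact: cont.
- move=> s s01 [h [Gh Oh nG]]; have h0 := cont h s t s01 t01 Oh.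
  by apply: filterS h0 => z hz z01; exists h; split; [exact: Gh|exact: hz|exact: nG].
Qed.

End DisplacedCusp.

(** * The boundary of a cusp *)

Section LocallyClosed.
Context {R : realType} {n : nat}.
Local Notation V := 'cV[R]_n.+1.
Context (Om : set (RP R n)) (K : set V) (hK : is_lift Om K).
Context (Gamma : set (PGL R n.+1)) (gG : is_subgroup Gamma) (dG : discrete_subset Gamma)
  (GOm : forall g, Gamma g -> pact g @` Om = Om).
Context (X : set (RP R n)) (XO : X `<=` Om) (GX : forall g, Gamma g -> pact g @` X = X)
  (cS : compact (quotient_set (bdry X) Gamma)) (dX : diffeo_to_collar X Gamma).

(** The collar diffeomorphism sends any point of [X] to a pair whose first component comes from the
    boundary. *)
Lemma collar_bdry_nonempty : X !=set0 -> bdry X !=set0.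
Proof.
have [f [_ [sf _ _ _]]] := dX; move=> [p Xp].
have cp : cone X (vec_of p) by split; [exact: vec_of_neq0|rewrite vec_ofK].
have [U [F [_ Uv _ hF]]] := sf _ cp.
by have [[[_ h] _] _] := hF _ Uv cp; exists (pt (F (vec_of p)).1).
Qed.

Lemma bdry_invariant g p : Gamma g -> bdry X p -> bdry X (pact g p).
Proof. by move=> Gg Xp; rewrite -(GX Gg) pact_image_bdry; exists p. Qed.

(* Compactness of the collar bdry X x [0, T] and properness make its image
   under f closed in Om / Gamma. *)
Lemma collar_separation (f : orbit_space Gamma * R -> orbit_space Gamma) (T : R) q :
  smooth_map (fun vt : V * R => (vproj Gamma vt.1, vt.2)) (cone (bdry X) `*` [set t | 0 <= t])
    (vproj Gamma) (cone X) f -> Om q -> ~ X q ->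
  exists2 N, nbhs q N & forall p y, N p -> quotient_set (bdry X) Gamma y.1 -> 0 <= y.2 <= T ->
    oproj Gamma p <> f y.
Proof.
move=> sf Oq nXq; pose E0 := quotient_set (bdry X) Gamma `*` `[0, T]%classic.
have cE : compact E0 by apply: compact_setX => //; exact: segment_compact.
pose P (A : set (orbit_space Gamma * R)%type) := exists2 N, nbhs q N &
  forall p y, N p -> A y -> E0 y -> oproj Gamma p <> f y.
suff [N nN hN] : P E0.
  exists N => // p y Np Sy y2; have Ey : E0 y by split=> //=; rewrite in_itv.
  exact: hN.
apply: compact_ind => //.
- by exists setT => //; exact: filterT.
- move=> A B [N nN hN] [N' nN' hN']; exists (N `&` N'); first exact: filterI.
  by move=> p y [Np N'p] [Ay|By]; [exact: hN|exact: hN'].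
- by move=> A B AB [N nN hN]; exists N => // p y Np /AB; exact: hN.
move=> [_ t] [/= [s Ss <-]]; rewrite in_itv/= => /andP[t0 tT].
pose v := vec_of s; have v0 : v != 0 := vec_of_neq0 s.
have sE : pt v = s := vec_ofK s.
have Ev : (cone (bdry X) `*` [set t | 0 <= t]) (v, t) by split=> //=; rewrite /cone /= sE.
have [U [G [oU Uv sG hG]]] := sf _ Ev.
have [[z0 Xz] zE] := hG _ Uv Ev.
set z := G (v, t) in z0 Xz zE.
have sep g : Gamma g -> pact g (pt z) <> q.
  by move=> Gg gz; apply: nXq; rewrite -gz -(GX Gg); exists (pt z).
have [U1 [W1 [oU1 oW1 U1z W1q UW]]] :=
  proper_sep hK gG dG GOm (XO Xz) Oq (@subset_refl _ Gamma) sep.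
have nG : nbhs (v, t) (G @^-1` cone U1).
  have cG : {for (v, t), continuous G} by exact: (sG 0%N _ Uv).
  by apply: cG; apply: open_nbhs_nbhs; split; [exact/open_cone|split].
have [[A1 A2] /= [nA1 nA2] hA] : nbhs (v, t) (U `&` G @^-1` cone U1).
  by apply: filterI => //; exact: open_nbhs_nbhs.
have [r /= r0 hr] := (nbhs_ballP _ _).1 nA1.
exists ((oproj Gamma @` [set pt w | w in ball v r `&` [set w | w != 0]]) `*` A2).
  exists (oproj Gamma @` [set pt w | w in ball v r `&` [set w | w != 0]], A2) => //=.
  split=> //; apply: (oproj_nbhs gG); rewrite -sE.
  exact: pt_ball_nbhs.
exists W1; first exact: open_nbhs_nbhs.
move=> p [_ t'] W1p [/= [_ [w [Bw w0] <-] <-] A2t'] [/= [s' Ss' s'E]].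
rewrite in_itv/= => /andP[t'0 t'T] pE.
have [k Gk wE] := (oprojP gG _ _).1 s'E.
have Ew : (cone (bdry X) `*` [set t | 0 <= t]) (w, t').
  by split=> //=; split=> //; rewrite wE; exact: bdry_invariant.
have [Uw [Gw0 U1w]] := hA (w, t') (conj (hr _ Bw) A2t').
have [[_ _] GwE] := hG _ Uw Ew.
have : oproj Gamma (pt (G (w, t'))) = oproj Gamma p.
  by rewrite pE -[LHS]/(vproj Gamma (G (w, t'))) GwE.
move=> /(oprojP gG)[h Gh pE']; apply: (UW h (pt (G (w, t')))) => //.
by rewrite -pE'.
Qed.

(** Near [p] the points of [X] have collar height below some [T]. A nearby limit [q] in [Om] but
    outside [X] has a neighbourhood free of collar points of height at most [T], by
    [collar_separation], so it is not a limit. *)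
Lemma cusp_locally_closed p : X p ->
  exists2 U, nbhs p U & forall q, U q -> closure X q -> X q.
Proof.
have [f [g [sf sg gf fg]]] := dX; move=> Xp.
have v0 := vec_of_neq0 p; set v := vec_of p in v0; have pE : pt v = p := vec_ofK p.
have cp : cone X v by split=> //; rewrite pE.
have [U [F [oU Uv sF hF]]] := sf _ cp.
pose T := (F v).2 + 1.
have nT : nbhs v (U `&` [set w | (F w).2 < T]).
  apply: filterI; first exact: open_nbhs_nbhs.
  have cF : {for v, continuous F} by exact: (sF 0%N _ Uv).
  have c2 : {for v, continuous (fun w => (F w).2)}.
    by apply: continuous_comp; [exact: cF|exact: cvg_snd].
  have : nbhs (F v).2 [set x : R | x < T].
    by apply: open_nbhs_nbhs; split; [exact: open_lt|rewrite /= /T ltrDl].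
  by move=> /c2.
have [r /= r0 hr] := (nbhs_ballP _ _).1 nT.
pose B1 := [set pt w | w in ball v r `&` [set w : V | w != 0]].
have nB1 : nbhs p B1 by rewrite -pE; exact: pt_ball_nbhs.
have nO : nbhs p Om.
  have [oK _ _ _ _] := hK; have [w Kw pw] := lift_rep hK (XO Xp).
  have := pt_ball_nbhs (lift_neq0 hK Kw); have /nbhs_ballP[e e0 he] : nbhs w K by exact: open_nbhs_nbhs.
  move=> /(_ _ e0); rewrite -pw; apply: filterS => _ [w' [/he Kw' _] <-].
  exact: (lift_pt hK).
exists ((interior B1) `&` Om); first by apply: filterI => //; exact: nbhs_interior.
move=> q [B1q Oq] clq; apply: contrapT => nXq.
have [N nN hN] := @collar_separation g T q sg Oq nXq.
have [p' [Xp' [Np' B1p']]] := clq _ (filterI nN B1q).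
move: B1p' => [w [Bw w0] wE].
have cw : cone X w by split=> //; rewrite wE.
have [Uw Tw] := hr _ Bw.
have [[Sw t0] QF] := hF _ Uw cw.
apply: (hN p' (f (vproj Gamma w))) => //.
- by rewrite -QF /=; exists (pt (F w).1) => //; case: Sw.
- by rewrite -QF /=; apply/andP; split=> //; exact: ltW.
- by rewrite gf; [rewrite /vproj wE|exists w].
Qed.

End LocallyClosed.

(** * The convex cone over a cusp and the hull of its boundary *)

Section CuspCone.
Context {R : realType} {n : nat}.
Local Notation V := 'cV[R]_n.+1.
Context (Om : set (RP R n)) (K : set V) (hK : is_lift Om K).
Context (X : set (RP R n)) (XO : X `<=` Om) (pX : properly_convex X)
  (nS : contains_no_segment (bdry X))
  (lcX : forall p, X p -> exists2 U, nbhs p U & forall q, U q -> closure X q -> X q).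

Definition cusp_cone : set V := [set v | K v /\ X (pt v)].
Local Notation D := cusp_cone.
Local Notation D0 := (interior cusp_cone).
Definition cusp_bdry : set V := [set v | K v /\ bdry X (pt v)].
Local Notation S := cusp_bdry.

Lemma cusp_coneZ (c : R) v : 0 < c -> D v -> D (c *: v).
Proof.
have [_ _ _ KZ _] := hK => c0 [Kv Xv]; split; first exact: KZ.
by rewrite pt_scale// ?gt_eqF//; exact: (lift_neq0 hK).
Qed.

(* X need not be open: connectedness of X on the line through u and v is
   contradicted by the two sides of the missing point. *)
Lemma cusp_cone_seg u v (t : R) : D u -> D v -> 0 <= t <= 1 -> D ((1 - t) *: u + t *: v).
Proof.
have [oK _ _ KZ _] := hK.
move=> Du Dv t01; have [Ku Xu] := Du; have [Kv Xv] := Dv.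
have u0 := lift_neq0 hK Ku; have v0 := lift_neq0 hK Kv.
have Kz := lift_seg hK Ku Kv t01.
split=> //; set z := (1 - t) *: u + t *: v in Kz *.
have [t0|t0] := eqVneq t 0; first by rewrite /z t0 subr0 scale1r scale0r addr0.
have [t1|t1] := eqVneq t 1; first by rewrite /z t1 subrr scale1r scale0r add0r.
have [tp tq] : 0 < t /\ t < 1.
  by move: t01 => /andP[t00 t11]; rewrite !lt_neqAle eq_sym t0 t1.
have [[c vE]|nc] := pselect (exists c : R, v = c *: u).
  have zE : z = ((1 - t) + t * c) *: u by rewrite /z vE scalerA -scalerDl.
  rewrite zE pt_scale//; apply/eqP => E; have := lift_neq0 hK Kz.
  by rewrite zE E scale0r eqxx.
have ind : independent u v by apply: independentP => // c E; apply: nc; exists c.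
have [f [g [cf cg fg fgZ]]] := independent_coord ind.
pose h w := (1 - t) * g w - t * f w.
have ch : continuous h.
  move=> w; apply: (@continuousB R R^o V (fun w => (1 - t) * g w) (fun w => t * f w)).
    apply: (@continuousM R V (fun=> 1 - t) g); [exact: cst_continuous|exact: cg].
  apply: (@continuousM R V (fun=> t) f); [exact: cst_continuous|exact: cf].
have hZ (c : R) w : h (c *: w) = c * h w.
  by have [f' g'] := fgZ c w; rewrite /h f' g'; ring.
have hE x y : h (x *: u + y *: v) = (1 - t) * y - t * x.
  by have [f' g'] := fg x y; rewrite /h f' g'.
apply: contrapT => nXz.
pose L : set (RP R n) := [set pt (row_mx u v *m c) | c in [set c : 'cV[R]_2 | c != 0]].
have LL : projective_line L by exists (row_mx u v).
have [cXL _] := pX LL.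
pose A := [set pt w | w in (K `&` [set w | h w < 0]) `&` [set w | w != 0]].
pose B := [set pt w | w in (K `&` [set w | 0 < h w]) `&` [set w | w != 0]].
have oA : open A.
  apply: pt_open; apply: openI => //.
  by apply: (@open_comp _ _ h [set x : R | x < 0]) => [w _|]; [exact: ch|exact: open_lt].
have oB : open B.
  apply: pt_open; apply: openI => //.
  by apply: (@open_comp _ _ h [set x : R | 0 < x]) => [w _|]; [exact: ch|exact: open_gt].
have AB p : A p -> B p -> False.
  move=> [w [[Kw /= hw] _] <-] [w' [[Kw' /= hw'] _]] /esym /(lift_pt_eq hK Kw Kw')[c c0 E].
  by move: hw'; rewrite E hZ; nra.
have inL (x y : R) : x *: u + y *: v != 0 -> L (pt (x *: u + y *: v)).
  move=> xy0; pose c : 'cV[R]_(1 + 1) := col_mx (const_mx x) (const_mx y).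
  have cE : row_mx u v *m c = x *: u + y *: v.
    by rewrite row_mx_comb /c col_mxKu col_mxKd !mxE.
  by exists c; [apply: contraNneq xy0 => c0; rewrite -cE c0 mulmx0|rewrite cE].
have LA p : X p -> L p -> A p \/ B p.
  move=> Xp [c c0 pE]; have [k Kk pk] := lift_rep hK (XO Xp).
  have k0 := lift_neq0 hK Kk.
  have Wc0 : row_mx u v *m c != 0 by apply: rank2_mulmx_neq0.
  have [d d0 kE] : exists2 d : R, d != 0 & k = d *: (row_mx u v *m c).
    by apply/pt_eq => //; rewrite pE.
  have [x [y {}kE]] : exists x y : R, k = x *: u + y *: v.
    by rewrite row_mx_comb scalerDr !scalerA in kE; eexists; eexists; exact: kE.
  have [hk|hk|hk] := ltgtP (h k) 0; [left; exists k => //|right; exists k => //|exfalso].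
  move: hk; rewrite kE hE => xy.
  apply: nXz; have yE : y = t * (x / (1 - t)).
    have nt : 1 - t != 0 by rewrite subr_eq0 eq_sym.
    have -> : t * (x / (1 - t)) = (t * x) / (1 - t) by rewrite mulrA.
    by apply: (mulfI nt); rewrite [RHS]mulrC mulfVK//; lra.
  have kz : k = (x / (1 - t)) *: z.
    by rewrite kE yE /z scalerDr !scalerA mulfVK ?subr_eq0 1?eq_sym// [t * _]mulrC.
  have xt0 : x / (1 - t) != 0 by apply: contraNneq k0 => E; rewrite kz E scale0r.
  by rewrite -(pt_scale xt0) ?(lift_neq0 hK Kz)// -kz -pk.
have Lu : L (pt u) by have := inL 1 0; rewrite scale1r scale0r addr0; exact.
have Lv : L (pt v) by have := inL 0 1; rewrite scale1r scale0r add0r; exact.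
have E : X `&` L `&` A = X `&` L.
  apply: cXL.
  - exists (pt u); split=> //; exists u => //; split=> //; split=> //=.
    by have := hE 1 0; rewrite scale1r scale0r addr0 => ->; lra.
  - by exists A.
  - exists (~` B); first exact: open_closedC.
    apply/seteqP; split=> p [[Xp Lp] h1]; split=> //; first by move=> /(AB p h1).
    by have [] := LA p Xp Lp.
have : (X `&` L `&` A) (pt v) by rewrite E.
move=> [_ Av]; apply: (AB _ Av); exists v => //; split=> //; split=> //=.
by have := hE 0 1; rewrite scale1r scale0r add0r => ->; lra.
Qed.

Lemma cusp_coneD u v : D u -> D v -> D (u + v).
Proof.
move=> Du Dv; have -> : u + v = 2 *: ((1 - 2^-1) *: u + 2^-1 *: v).
  by apply/matrixP => i j; rewrite !mxE; field.
by apply: cusp_coneZ => //; apply: cusp_cone_seg => //; lra.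
Qed.

Lemma cusp_bdryW v : S v -> D v.
Proof. by move=> [Kv [Xv _]]. Qed.

Lemma cusp_bdryP v : S v <-> D v /\ ~ D0 v.
Proof.
have [oK _ _ _ _] := hK; split=> [[Kv [Xv nXv]]|[[Kv Xv] nDv]].
  split=> // /nbhs_ballP[r /= r0 hr]; apply: nXv.
  apply: (filterS _ (pt_ball_nbhs (lift_neq0 hK Kv) r0)).
  by move=> _ [w [/hr[_ Xw] _] <-].
split=> //; split=> // nX; apply: nDv.
have h1 : nbhs v (pt @^-1` X) by exact: (pt_continuous (lift_neq0 hK Kv) nX).
by apply: filterS (filterI h1 (open_nbhs_nbhs (conj oK Kv))) => w [].
Qed.

Lemma cusp_intD u v : D0 u -> D v -> D0 (u + v).
Proof.
move=> /nbhs_ballP[r r0 hr] Dv; apply/nbhs_ballP; exists r => // w.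
rewrite -ball_normE /ball_/= => uw; rewrite -[w](subrK v); apply: cusp_coneD => //.
by apply: hr; rewrite -ball_normE /ball_/= opprB addrA.
Qed.

Lemma cusp_intZ (c : R) u : 0 < c -> D0 u -> D0 (c *: u).
Proof.
move=> c0 Du; have : nbhs (c *: u) (fun w => D (c^-1 *: w)).
  apply: (@scaler_continuous R V c^-1 (c *: u)).
  by rewrite scalerA mulVf ?scale1r// gt_eqF.
apply: filterS => w /(cusp_coneZ c0).
by rewrite scalerA mulfV ?scale1r// gt_eqF.
Qed.

Lemma cusp_closed : closed (ccl D).
Proof. rewrite cclE; exact: closed_closure. Qed.

Lemma cusp_sub_ccl v : D v -> ccl D v.
Proof. rewrite cclE; exact: subset_closure. Qed.

Lemma cusp_ccl_sub v : ccl D v -> ccl K v.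
Proof. by rewrite !cclE; apply: closure_subset => w []. Qed.

Lemma cusp_ccl_cone : D !=set0 -> convex_cone (ccl D).
Proof.
move=> [w Dw]; rewrite cclE; have cD := @closed_closure _ D.
have addl u v : D u -> closure D v -> closure D (u + v).
  move=> Du cv B nB; have cu : {for v, continuous (fun x : V => u + x)}.
    apply: (@continuousD R V V (fun=> u) id); first exact: cst_continuous.
    exact: cvg_id.
  have [x [Dx Bx]] := cv _ (cu _ nB).
  by exists (u + x); split=> //; exact: cusp_coneD.
split.
- apply: (@closed_approx_ray R V (closure D) 0 w) => // k; rewrite add0r.
  by apply: subset_closure; apply: cusp_coneZ => //; rewrite invr_gt0.
- move=> u v cu cv B nB; have cu' : {for u, continuous (fun x : V => x + v)}.
    apply: (@continuousD R V V id (fun=> v)); first exact: cvg_id.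
    exact: cst_continuous.
  have [x [Dx Bx]] := cu _ (cu' _ (nbhs_interior nB)).
  exact: (addl x v Dx cv B Bx).
- move=> c u; rewrite le_eqVlt => /predU1P[<- _|c0 cu].
    rewrite scale0r; apply: (@closed_approx_ray R V (closure D) 0 w) => // k; rewrite add0r.
    by apply: subset_closure; apply: cusp_coneZ => //; rewrite invr_gt0.
  move=> B /(@scaler_continuous R V c u) nB.
  by have [x [Dx Bx]] := cu _ nB; exists (c *: x); split=> //; exact: cusp_coneZ.
Qed.

Lemma cusp_near s : D s -> exists2 r : R, 0 < r &
  forall v, `|s - v| < r -> ccl D v -> D v.
Proof.
have [oK _ _ _ _] := hK; move=> [Ks Xs]; have [U nU hU] := lcX Xs.
have s0 := lift_neq0 hK Ks.
have /nbhs_ballP[r r0 hr] : nbhs s (pt @^-1` U `&` K).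
  apply: filterI; last exact: open_nbhs_nbhs.
  exact: (pt_continuous s0 nU).
exists r => // v sv; rewrite cclE => cv.
have [Uv Kv] : (pt @^-1` U `&` K) v by apply: hr; rewrite -ball_normE.
split=> //; apply: hU => // B nB.
have [w [[Kw Xw] Bw]] := cv _ (pt_continuous (lift_neq0 hK Kv) nB).
by exists (pt w).
Qed.

(** By local closedness [s + t *: v] stays in the cone for small [t]. If none of these points were
    interior, they would trace a segment in the boundary; once one is interior, so are those between
    it and [s]. *)
Lemma cusp_into_interior s v : S s -> ccl D v -> (forall c : R, v <> c *: s) ->
  exists2 t0 : R, 0 < t0 & forall t, 0 < t <= t0 -> D0 (s + t *: v).
Proof.
move=> Ss cv ind; have Ds := cusp_bdryW Ss; have [_ CD CZ] := cusp_ccl_cone (ex_intro _ s Ds).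
have [r r0 hr] := cusp_near Ds.
have s0 : s != 0 by case: Ss => /(lift_neq0 hK).
pose t0 := r / (`|v| + 1) / 2.
have q0 : 0 < `|v| + 1 by rewrite ltr_wpDl.
have t00 : 0 < t0 by rewrite !divr_gt0.
have Dt t : 0 <= t <= t0 -> D (s + t *: v).
  move=> /andP[tp tt]; apply: hr; last first.
    by apply: CD; [exact: cusp_sub_ccl|exact: CZ].
  rewrite opprD addrA subrr sub0r normrN normrZ ger0_norm//.
  apply: (@le_lt_trans _ _ (t0 * (`|v| + 1))); last first.
    have -> : t0 * (`|v| + 1) = r / 2 by rewrite /t0; field; rewrite gt_eqF.
    lra.
  by apply: ler_pM => //; rewrite lerDl.
have [[t1 [t1p Dt1]]|nt] := pselect (exists t1, 0 < t1 <= t0 /\ D0 (s + t1 *: v)).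
  have /andP[t10 t1t] := t1p.
  exists t1; first exact: t10.
  move=> t /andP[tp tt]; have [->|tt1] := eqVneq t t1; first exact: Dt1.
  have -> : s + t *: v = (t / t1) *: (s + t1 *: v) + (1 - t / t1) *: s.
    by apply/matrixP => i j; rewrite !mxE; field; rewrite gt_eqF.
  have Dl : D0 ((t / t1) *: (s + t1 *: v)) by apply: cusp_intZ => //; rewrite divr_gt0.
  apply: cusp_intD; [exact: Dl|apply: cusp_coneZ; last exact: Ds].
  by rewrite subr_gt0 ltr_pdivrMr// mul1r lt_neqAle tt1.
exfalso; apply: nS; exists s, v, (t0 / 2), t0; split.
- exact: independentP.
- by lra.
move=> t /andP[ta tb]; suff [_ h] : S (s + t *: v) by [].
apply/cusp_bdryP; split; first by apply: Dt; apply/andP; split; lra.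
by move=> h; apply: nt; exists t; split=> //; apply/andP; split; lra.
Qed.

Lemma cusp_exit z w (eta : R) : D0 z -> 0 < eta -> ~ ccl D (z + eta *: w) ->
  exists b : R, [/\ 0 < b < eta, ccl D (z + b *: w) & ~ D0 (z + b *: w)].
Proof.
move=> Dz eta0 nE; have zD := interior_subset Dz.
pose P := [set t : R | 0 <= t <= eta /\ ccl D (z + t *: w)].
have hP : has_sup P.
  split; last by exists eta => t [/andP[]].
  by exists 0; split; [rewrite lexx ltW|rewrite scale0r addr0; exact: cusp_sub_ccl].
pose b := sup P.
have clw : continuous (fun s : R => z + s *: w).
  move=> s; apply: (@continuousD R V R (fun=> z) (fun s => s *: w)); first exact: cst_continuous.
  exact: scalel_continuous.
have bP t : P t -> t <= b by move=> Pt; exact: sup_upper_bound.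
have b0 : 0 <= b by apply: bP; split; [rewrite lexx ltW|rewrite scale0r addr0; exact: cusp_sub_ccl].
have beta : b <= eta by apply: ge_sup => [|t [/andP[]]//]; have [] := hP.
have cb : ccl D (z + b *: w).
  have c : closed [set s : R | ccl D (z + s *: w)].
    by apply: (@closed_comp _ _ (fun s : R => z + s *: w)) => [s _|]; [exact: clw|exact: cusp_closed].
  apply: (@closed_approx R R^o _ b c) => e e0.
  have [t [t01 Pt] et] := sup_adherent e0 hP; exists t => //.
  rewrite ger0_norm ?subr_ge0; last by apply: bP.
  by rewrite /b; lra.
have blt : b < eta by rewrite lt_neqAle beta andbT; apply/eqP => E; apply: nE; rewrite -E.
have step t : 0 <= t < eta -> D0 (z + t *: w) -> t < b.
  move=> /andP[t0 te] /(nbhs_interior) /(clw t) /nbhs_ballP[e /= e0 he].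
  pose m := Num.min e (eta - t); have m0 : 0 < m by rewrite lt_min e0 subr_gt0.
  have [me mt] : m <= e /\ m <= eta - t by split; rewrite ge_min lexx ?orbT.
  apply: (@lt_le_trans _ _ (t + m / 2)); first by lra.
  apply: bP; split; first by apply/andP; split; lra.
  apply: cusp_sub_ccl; apply: interior_subset; apply: he.
  by rewrite -ball_normE /ball_/= opprD addNKr normrN ger0_norm; lra.
exists b; split=> //.
  rewrite blt andbT; apply: step; last by rewrite scale0r addr0.
  by rewrite lexx.
by move=> Db; have := step b; rewrite b0 blt => /(_ isT Db); rewrite ltxx.
Qed.

(** As an intersection, the hull inherits every closed convex conical condition satisfied by the
    boundary vectors, without limits of finite combinations. *)
Definition cusp_hull : set V :=
  [set v | forall F, closed F -> convex_cone F -> S `<=` F -> F v].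
Local Notation C := cusp_hull.

Lemma cusp_hull_closed : closed C.
Proof.
have -> : C = \bigcap_(F in [set F : set V | [/\ closed F, convex_cone F & S `<=` F]]) F.
  by apply/seteqP; split=> v h F => [[cF vF SF]|cF vF SF]; apply: h.
by apply: closed_bigI => F [].
Qed.

Lemma cusp_hull_cone : convex_cone C.
Proof.
split.
- by move=> F _ [].
- by move=> u v hu hv F cF vF SF; have [_ h _] := vF; apply: h; [exact: hu|exact: hv].
- by move=> c u c0 hu F cF vF SF; have [_ _ h] := vF; apply: h => //; exact: hu.
Qed.

Lemma cusp_hull_bdry s : S s -> C s.
Proof. by move=> Ss F _ _; exact. Qed.

Lemma cusp_hull_ccl : D !=set0 -> C `<=` ccl D.
Proof.
move=> D1 v; apply; [exact: cusp_closed|exact: cusp_ccl_cone|].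
by move=> s /cusp_bdryW /cusp_sub_ccl.
Qed.

(* The line through z in a direction w transverse at s leaves the cone of X on
   both sides, through boundary points near s, and z lies between them. *)
Lemma cusp_hull_near s w : S s ->
  (forall eta : R, 0 < eta -> ~ ccl D (s + eta *: w) /\ ~ ccl D (s - eta *: w)) ->
  exists2 r : R, 0 < r & forall z, `|s - z| < r -> D0 z -> C z.
Proof.
move=> Ss hw; have Ds := cusp_bdryW Ss; have [r r0 hr] := cusp_near Ds.
pose eta := r / (`|w| + 1) / 4.
have q0 : 0 < `|w| + 1 by rewrite ltr_wpDl.
have eta0 : 0 < eta by rewrite !divr_gt0.
have etaw : eta * `|w| < r / 2.
  apply: (@le_lt_trans _ _ (eta * (`|w| + 1))); last first.
    have -> : eta * (`|w| + 1) = r / 4 by rewrite /eta; field; rewrite gt_eqF.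
    lra.
  by apply: ler_wpM2l; [exact: ltW|rewrite lerDl].
have [nw1 nw2] := hw eta eta0.
have outside w' : ~ ccl D (s + w') -> exists2 r1 : R, 0 < r1 &
    forall z, `|s - z| < r1 -> ~ ccl D (z + w').
  move=> h; have /nbhs_ballP[r1 r10 hr1] : nbhs (s + w') (~` ccl D).
    by apply: open_nbhs_nbhs; split=> //; apply: closed_openC; exact: cusp_closed.
  exists r1 => // z sz; apply: hr1; rewrite -ball_normE /ball_/=.
  by have -> : s + w' - (z + w') = s - z by rewrite opprD addrACA subrr addr0.
have [r1 r10 h1] := outside _ nw1; have [r2 r20 h2] := outside _ nw2.
pose m := Num.min (Num.min r1 r2) (r / 2).
have m0 : 0 < m by rewrite !lt_min r10 r20 divr_gt0.
exists m => // z; rewrite !lt_min => /andP[/andP[z1 z2] z3] Dz.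
have [b [/andP[b0 be] cb nb]] := cusp_exit Dz eta0 (h1 z z1).
have := cusp_exit (w := - w) Dz eta0; rewrite scalerN => /(_ (h2 z z2)).
move=> [b' [/andP[b'0 b'e] cb' nb']].
have inS w' t : `|w'| = `|w| -> 0 < t < eta -> ccl D (z + t *: w') -> ~ D0 (z + t *: w') -> S (z + t *: w').
  move=> w'w /andP[t0 te] c nd; apply/cusp_bdryP; split=> //; apply: hr => //.
  rewrite opprD addrA; apply: le_lt_trans (ler_normB _ _) _.
  rewrite normrZ ger0_norm ?(ltW t0)// w'w [r]splitr; apply: ltrD => //.
  by apply: le_lt_trans etaw; apply: ler_wpM2r => //; exact: ltW.
have S1 : S (z + b *: w) by apply: (inS w b erefl _ cb nb); rewrite b0.
have S2 : S (z + b' *: (- w)) by apply: (inS (- w) b' (normrN w) _ cb' nb'); rewrite b'0.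
have [_ CD CZ] := cusp_hull_cone.
have -> : z = (b' / (b + b')) *: (z + b *: w) + (b / (b + b')) *: (z + b' *: (- w)).
  by apply/matrixP => i j; rewrite !mxE; field; rewrite gt_eqF// addr_gt0.
by apply: CD; apply: CZ; rewrite ?cusp_hull_bdry ?divr_ge0 ?addr_ge0 ?(ltW b0) ?(ltW b'0)//; exact: cusp_hull_bdry.
Qed.

(** For small [t] the point [s + t *: v] is interior to the cone over the cusp and close to [s], so
    a neighbourhood of it lies in the hull; adding the rest of [v], itself in the hull, keeps it
    interior. *)
Lemma cusp_hull_strict s w v : S s ->
  (forall eta : R, 0 < eta -> ~ ccl D (s + eta *: w) /\ ~ ccl D (s - eta *: w)) ->
  C v -> (forall c : R, v <> c *: s) -> C° (s + v).
Proof.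
move=> Ss hw Cv ind; have Ds := cusp_bdryW Ss.
have cv : ccl D v by apply: cusp_hull_ccl => //; exists s.
have [t0 t00 ht] := cusp_into_interior Ss cv ind.
have [r r0 hr] := cusp_hull_near Ss hw.
have q0 : 0 < `|v| + 1 by rewrite ltr_wpDl.
pose t := Num.min (Num.min t0 1) (r / (`|v| + 1) / 2).
have tp : 0 < t by rewrite !lt_min t00 ltr01 !divr_gt0.
have [tt0 t1 tr] : [/\ t <= t0, t <= 1 & t <= r / (`|v| + 1) / 2].
  by split; rewrite !ge_min lexx ?orbT.
have Dt : D0 (s + t *: v) by apply: ht; rewrite tp.
have st : `|s - (s + t *: v)| < r.
  rewrite opprD addrA subrr sub0r normrN normrZ gtr0_norm//.
  apply: (@le_lt_trans _ _ ((r / (`|v| + 1) / 2) * (`|v| + 1))).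
    by apply: ler_pM => //; [exact: ltW|rewrite lerDl].
  have -> : r / (`|v| + 1) / 2 * (`|v| + 1) = r / 2 by field; rewrite gt_eqF.
  lra.
have nC : nbhs (s + t *: v) C.
  have h1 : nbhs (s + t *: v) [set z | `|s - z| < r].
    have /nbhs_ballP := nbhsx_ballx s r r0; move=> _.
    have bo : open_nbhs (s + t *: v) (ball s r).
      by split; [exact: ball_open|rewrite -ball_normE].
    by apply: filterS (open_nbhs_nbhs bo) => z; rewrite -ball_normE.
  by apply: filterS (filterI h1 (nbhs_interior Dt)) => z [sz Dz]; exact: hr.
have [_ CD CZ] := cusp_hull_cone.
have -> : s + v = (s + t *: v) + (1 - t) *: v.
  by apply/matrixP => i j; rewrite !mxE; ring.
have cu' : {for (s + t *: v) + (1 - t) *: v, continuous (fun x : V => x - (1 - t) *: v)}.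
  apply: (@continuousB R V V id (fun=> (1 - t) *: v)); first exact: cvg_id.
  exact: cst_continuous.
have nC' : nbhs ((s + t *: v) + (1 - t) *: v - (1 - t) *: v) C by rewrite addrK.
have h1 : nbhs ((s + t *: v) + (1 - t) *: v) (fun z => C (z - (1 - t) *: v)) by exact: (cu' _ nC').
apply: filterS h1 => z /= Cz; rewrite -[z](subrK ((1 - t) *: v)).
by apply: CD => //; apply: CZ => //; rewrite subr_ge0.
Qed.

End CuspCone.

(** * Directions transverse to the boundary *)

Section CuspTransverse.
Context {R : realType} {n : nat}.
Local Notation V := 'cV[R]_n.+1.

Lemma exists_outside (m : nat) (W : 'M[R]_(n.+1, m)) : (m < n.+1)%N ->
  exists z : V, forall c, z <> W *m c.
Proof.
move=> mn; apply: contrapT => h.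
have /choice[f hf] : forall z : V, exists c, z = W *m c.
  move=> z; apply: contrapT => nz; apply: h; exists z => c zE; apply: nz; by exists c.
have E : 1%:M = W *m (\matrix_(i, j) f (delta_mx j 0) i 0) :> 'M[R]_n.+1.
  apply/matrixP => i j.
  have /matrixP/(_ i 0) := hf (delta_mx j 0); rewrite !mxE andbT => ->.
  by apply: eq_bigr => k _; rewrite mxE.
have := mxrankM_maxl W (\matrix_(i, j) f (delta_mx j 0) i 0).
by rewrite -E mxrank1 leqNgt (leq_ltn_trans (rank_leq_col W) mn).
Qed.

Context (Om : set (RP R n)) (K : set V) (hK : is_lift Om K).
Context (X : set (RP R n)) (XO : X `<=` Om) (pX : properly_convex X)
  (nS : contains_no_segment (bdry X))
  (lcX : forall p, X p -> exists2 U, nbhs p U & forall q, U q -> closure X q -> X q).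
Local Notation D := (cusp_cone K X).
Local Notation D0 := (interior (cusp_cone K X)).
Local Notation S := (cusp_bdry K X).

(* The set T of directions entering the interior at s is open, T and -T are
   disjoint, and they would cover the complement of the line R s, which is
   connected for n >= 2. *)
Lemma cusp_transverse s : (2 <= n)%N -> S s -> exists w, forall eta : R, 0 < eta ->
  ~ ccl D (s + eta *: w) /\ ~ ccl D (s - eta *: w).
Proof.
move=> n2 Ss; have Ds := cusp_bdryW Ss; have s0 : s != 0 by case: Ss => /(lift_neq0 hK).
have [_ nDs] := (cusp_bdryP hK X s).1 Ss.
apply: contrapT => nw.
pose T (w : V) := exists2 eta : R, 0 < eta & D0 (s + eta *: w).
have TT w : T w -> T (- w) -> False.
  move=> [a a0 Da] [b b0 Db]; apply: nDs.
  have -> : s = (b / (a + b)) *: (s + a *: w) + (a / (a + b)) *: (s + b *: (- w)).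
    by apply/matrixP => i j; rewrite !mxE; field; rewrite gt_eqF// addr_gt0.
  apply: (cusp_intD hK XO pX).
    by apply: (cusp_intZ hK) => //; rewrite divr_gt0 ?addr_gt0.
  by apply: (cusp_coneZ hK); [rewrite divr_gt0 ?addr_gt0|exact: interior_subset].
have Tor w : (forall c : R, w <> c *: s) -> T w \/ T (- w).
  move=> ind.
  have gen w' : (forall c : R, w' <> c *: s) -> (exists2 eta : R, 0 < eta & ccl D (s + eta *: w')) -> T w'.
    move=> ind' [eta eta0 cD].
    have indE (c : R) : s + eta *: w' <> c *: s.
      move=> E; apply: (ind' (eta^-1 * (c - 1))).
      by rewrite -scalerA scalerBl scale1r -E addrAC subrr add0r scalerA mulVf ?scale1r// gt_eqF.
    have [t t0 ht] := cusp_into_interior hK XO pX nS lcX Ss cD indE.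
    exists (t * eta / (1 + t)); first by rewrite divr_gt0 ?mulr_gt0 ?addr_gt0.
    have -> : s + (t * eta / (1 + t)) *: w' = (1 + t)^-1 *: (s + t *: (s + eta *: w')).
      by apply/matrixP => i j; rewrite !mxE; field; rewrite gt_eqF// addr_gt0.
    apply: (cusp_intZ hK); first by rewrite invr_gt0 addr_gt0.
    by apply: ht; rewrite t0 lexx.
  have [eta [eta0 hor]] : exists eta : R, 0 < eta /\ (ccl D (s + eta *: w) \/ ccl D (s - eta *: w)).
    apply: contrapT => h; apply: nw; exists w => eta eta0; split=> hD; apply: h; exists eta.
      by split=> //; left.
    by split=> //; right.
  case: hor => h; [left|right]; apply: gen => //; try by exists eta.
    by move=> c E; apply: (ind (- c)); rewrite scaleNr -E opprK.
  by exists eta => //; rewrite scalerN.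
have To w : T w -> \forall u \near w, T u.
  move=> [eta eta0 Dw].
  have c : {for w, continuous (fun u : V => s + eta *: u)}.
    apply: (@continuousD R V V (fun=> s) (fun u => eta *: u)); first exact: cst_continuous.
    exact: scaler_continuous.
  have h : nbhs w (fun u => D0 (s + eta *: u)) by exact: (c _ (nbhs_interior Dw)).
  by apply: filterS h => u Du; exists eta.
clearbody T; have path u v : (forall (t : R) c, (1 - t) *: u + t *: v <> c *: s) -> T u -> T v.
  move=> huv Tu.
  have cl : continuous (fun t : R => (1 - t) *: u + t *: v) by exact: segment_continuous.
  have clN (x : R) : {for x, continuous (fun t : R => - ((1 - t) *: u + t *: v))}.
    by apply: (@continuousN _ _ _ (fun t : R => (1 - t) *: u + t *: v)); exact: cl.
  have -> : v = (1 - 1) *: u + 1 *: v by rewrite subrr scale0r scale1r add0r.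
  apply: (@real_segment_connected R (fun t => T ((1 - t) *: u + t *: v))
    (fun t => T (- ((1 - t) *: u + t *: v)))).
  - by rewrite subr0 scale1r scale0r addr0.
  - by move=> t _; apply: Tor => c; exact: huv.
  - by move=> t; exact: TT.
  - move=> t _ Tt; have nT := To _ Tt; have h : \forall z \near t, T ((1 - z) *: u + z *: v) by exact: (cl t _ nT).
    by apply: filterS h.
  - move=> t _ Tt; have nT := To _ Tt; have h : \forall z \near t, T (- ((1 - z) *: u + z *: v)) by exact: (clN t _ nT).
    by apply: filterS h.
have [w0 hw0] : exists w, forall c : R, w <> c *: s.
  have [w hw] := @exists_outside 1 s (leq_trans (ltnSn 1) (leq_trans n2 (leqnSn n))).
  by exists w => c E; apply: (hw (c%:M)); rewrite mul_mx_scalar.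
have [w hw Tw] : exists2 w, (forall c : R, w <> c *: s) & T w.
  have [h|h] := Tor _ hw0; first by exists w0.
  by exists (- w0) => // c E; apply: (hw0 (- c)); rewrite scaleNr -E opprK.
(* A vector outside the plane of [s] and [w] allows the detour from [w] through [z] to [- w] without
   meeting the line of [s], so that [w] and [- w] would both enter the interior. *)
have [z hz] : exists z : V, forall a b : R, z <> a *: s + b *: w.
  have [z hz] := @exists_outside (1 + 1) (row_mx s w) n2.
  exists z => a b E; apply: (hz (col_mx (const_mx a) (const_mx b))).
  by rewrite row_mx_comb col_mxKu col_mxKd !mxE.
have Tz : T z.
  apply: (path w z) => // t c E; have [t0|t0] := eqVneq t 0.
    by apply: (hw c); rewrite -E t0 subr0 scale1r scale0r addr0.
  apply: (hz (c / t) ((t - 1) / t)).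
  have -> : z = t^-1 *: ((1 - t) *: w + t *: z) + ((t - 1) / t) *: w.
    by apply/matrixP => i j; rewrite !mxE; field.
  by rewrite E scalerA [t^-1 * c]mulrC.
apply: (TT w Tw); apply: (path z (- w)) => // t c E; have [t1|t1] := eqVneq t 1.
  by apply: (hw (- c)); rewrite scaleNr -E t1 subrr scale0r scale1r add0r opprK.
have t1' : 1 - t != 0 by rewrite subr_eq0 eq_sym.
apply: (hz (c / (1 - t)) (t / (1 - t))).
have -> : z = (1 - t)^-1 *: ((1 - t) *: z + t *: (- w)) + (t / (1 - t)) *: w.
  by apply/matrixP => i j; rewrite !mxE; field.
by rewrite E scalerA [_^-1 * c]mulrC.
Qed.

Lemma plane_span (u v w : V) : n = 1%N -> (forall c : R, v <> c *: u) -> u != 0 ->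
  exists x y : R, w = x *: u + y *: v.
Proof.
move=> n1 ind u0; have iuv : independent u v by exact: independentP.
have rW : row_full (row_mx u v)^T by rewrite /row_full mxrank_tr iuv n1.
have /submxP[c wE] : (w^T <= (row_mx u v)^T)%MS by exact: submx_full.
exists ((usubmx c^T) ord0 ord0), ((dsubmx c^T) ord0 ord0).
by rewrite -row_mx_comb -[LHS]trmxK wE trmx_mul trmxK.
Qed.

Lemma cusp_planar (u v : V) (a b : R) : n = 1%N -> D u -> D v -> (forall c : R, v <> c *: u) ->
  0 < a -> 0 < b -> D0 (a *: u + b *: v).
Proof.
move=> n1 Du Dv ind a0 b0; have u0 : u != 0 by case: Du => /(lift_neq0 hK).
have [f [g [cf cg fg _]]] := independent_coord (independentP u0 ind).
have [fE gE] := fg a b.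
have h1 : nbhs (a *: u + b *: v) (fun w => 0 < f w).
  have h0 : nbhs (f (a *: u + b *: v)) [set x : R | 0 < x].
    by rewrite fE; apply: open_nbhs_nbhs; split; [exact: open_gt|].
  exact: (cf _ _ h0).
have h2 : nbhs (a *: u + b *: v) (fun w => 0 < g w).
  have h0 : nbhs (g (a *: u + b *: v)) [set x : R | 0 < x].
    by rewrite gE; apply: open_nbhs_nbhs; split; [exact: open_gt|].
  exact: (cg _ _ h0).
apply: filterS (filterI h1 h2) => w [fw gw].
have [x [y wE]] := plane_span w n1 ind u0.
have [fx gy] := fg x y; rewrite wE fx in fw; rewrite wE gy in gw.
by rewrite wE; apply: (cusp_coneD hK XO pX); exact: (cusp_coneZ hK).
Qed.

(** Of three pairwise independent vectors in a planar pointed cone, one is a positive combination of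
    the other two, hence interior; so [s] and its first two images cannot all be boundary vectors.
    This excludes dimension one, where the detour argument for transverse directions fails. *)
Lemma cusp_planar_contra (A : 'M[R]_n.+1) s : n = 1%N -> S s -> S (A *m s) -> S (A *m (A *m s)) ->
  (forall c : R, A *m s <> c *: s) -> (forall c : R, A *m (A *m s) <> c *: s) ->
  (forall c : R, A *m (A *m s) <> c *: (A *m s)) -> False.
Proof.
move=> n1 S0 S1 S2 i1 i2 i3.
have [D_0 n0] := (cusp_bdryP hK X _).1 S0; have [D_1 n1'] := (cusp_bdryP hK X _).1 S1.
have [D_2 n2] := (cusp_bdryP hK X _).1 S2.
have s0 : s != 0 by case: S0 => /(lift_neq0 hK).
have [x [y E]] := plane_span (A *m (A *m s)) n1 i1 s0.
have sw (u v : V) (c : R) : c != 0 -> u = c *: v -> v = c^-1 *: u.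
  by move=> c0 ->; rewrite scalerA mulVf ?scale1r.
have [x0|x0|x0] := ltgtP x 0; last by apply: (i3 y); rewrite E x0 scale0r add0r.
- have [y0|y0] := ltP 0 y.
    apply: n1'; have -> : A *m s = y^-1 *: (A *m (A *m s)) + (- x / y) *: s.
      by rewrite E; apply/matrixP => i j; rewrite !mxE; field; rewrite gt_eqF.
    rewrite addrC; apply: cusp_planar => //; first by rewrite divr_gt0// oppr_gt0.
    by rewrite invr_gt0.
  have Kc (u : V) : D u -> ccl K u by move=> [/ccl_sub].
  have [_ _ KZ] := ccl_cone hK.
  have : A *m (A *m s) = 0.
    apply: (ccl_pointed hK); first exact: Kc.
    rewrite E opprD -!scaleNr; apply: (cclD hK); apply: KZ; rewrite ?oppr_ge0 ?(ltW x0)//; exact: Kc.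
  by case: S2 => /(lift_neq0 hK)/eqP.
- have [y0|y0|y0] := ltgtP y 0; last by apply: (i2 x); rewrite E y0 scale0r addr0.
    apply: n0; have -> : s = x^-1 *: (A *m (A *m s)) + (- y / x) *: (A *m s).
      by rewrite E; apply/matrixP => i j; rewrite !mxE; field; rewrite gt_eqF.
    rewrite addrC; apply: cusp_planar => //; first by rewrite divr_gt0// oppr_gt0.
    by rewrite invr_gt0.
  by apply: n2; rewrite E; exact: cusp_planar.
Qed.

End CuspTransverse.

(** * Lifts of group elements *)

Section GroupLifts.
Context {R : realType} {n : nat}.
Local Notation V := 'cV[R]_n.+1.
Local Notation M := 'M[R]_n.+1.
Local Notation G := (PGL R n.+1).

Lemma exists_root (r : R) (m : nat) : 0 < r -> (0 < m)%N -> exists2 x : R, 0 < x & x ^+ m = r.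
Proof.
move=> r0 m0; exists (r `^ (m%:R^-1)); first exact: powR_gt0.
by rewrite -powR_mulrn ?powR_ge0// -powRrM mulVf ?powRr1 ?(ltW r0)// pnatr_eq0 -lt0n.
Qed.

Lemma seq_collision (T : eqType) (f : nat -> T) (s : seq T) : (forall k, f k \in s) ->
  exists i j, (i < j)%N /\ f i = f j.
Proof.
move=> fs; pose t := [seq f k | k <- iota 0 (size s).+1].
have : ~~ uniq t.
  apply/negP => ut; have ts : {subset t <= s} by move=> x /mapP[k _ ->].
  have := uniq_leq_size ut ts.
  by rewrite size_map size_iota ltnn.
move=> /(uniqPn (f 0%N))[i [j [ij]]]; rewrite size_map size_iota => js.
have is' : (i < (size s).+1)%N by exact: ltn_trans ij js.
rewrite !(nth_map 0%N) ?size_iota// !nth_iota// !add0n => E.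
by exists i, j.
Qed.

Lemma expg_inj_torsion (g : G) i j : (i < j)%N -> (g ^+ i = g ^+ j)%g -> (g ^+ (j - i) = 1)%g.
Proof.
move=> ij E; apply: (mulgI (g ^+ i)%g).
by rewrite -expgnDr subnKC ?(ltnW ij)// mulg1 -E.
Qed.

Lemma finite_index_power (Gamma H : set G) (s : seq G) g : is_subgroup Gamma -> is_subgroup H ->
  (forall g, Gamma g -> exists k h, [/\ k \in s, H h & g = (k * h)%g]) -> Gamma g ->
  exists2 N, (0 < N)%N & H (g ^+ N)%g.
Proof.
move=> [G1 GM GV] [H1 HM HV] hs Gg.
have Gk k : Gamma (g ^+ k)%g.
  by elim: k => [|k IH]; [exact: G1|rewrite expgS; exact: GM].
have /choice[f hf] : forall k, exists x, x \in s /\ exists2 h, H h & (g ^+ k = x * h)%g.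
  by move=> k; have [x [h [xs Hh E]]] := hs _ (Gk k); exists x; split=> //; exists h.
have [i [j [ij fij]]] := seq_collision (fun k => (hf k).1).
exists (j - i)%N; first by rewrite subn_gt0.
have [_ [h Hh iE]] := hf i; have [_ [h' Hh' jE]] := hf j.
have : (g ^+ i * g ^+ (j - i) = f j * h')%g by rewrite -expgnDr subnKC ?(ltnW ij).
rewrite iE fij => E.
have -> : (g ^+ (j - i) = h^-1 * h')%g.
  apply: (mulgI (f j * h)%g); rewrite E -mulgA; congr (_ * _)%g.
  by rewrite mulgA mulgV mul1g.
by apply: HM => //; exact: HV.
Qed.

Context (Om : set (RP R n)) (K : set V) (hK : is_lift Om K).

Lemma lifts1 : lifts K 1%g 1%:M.
Proof.
split; first exact: unitmx1.
- by [].
- by move=> v; rewrite mul1mx.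
- by move=> v; rewrite invmx1 mul1mx.
Qed.

Lemma liftsX g A k : lifts K g A -> lifts K (g ^+ k)%g (A ^+ k).
Proof.
move=> gA; elim: k => [|k IH]; first by rewrite expg0 expr0; exact: lifts1.
by rewrite expgS exprS -mulmxE; exact: liftsM.
Qed.

Lemma lifts_unique g A B : lifts K g A -> lifts K g B -> exists2 c : R, 0 < c & B = c *: A.
Proof.
have [_ [v Kv] _ KZ [_ KN _]] := hK.
move=> [uA gA KA _] [uB gB KB _].
have [c c0 BE] : exists2 c : R, c != 0 & B = c *: A by apply/pgl_eq => //; rewrite -gA.
exists c => //; rewrite lt_neqAle eq_sym c0 leNgt; apply/negP => c1.
apply: (KN (B *m v)); first exact: KB.
rewrite BE -scalemxAl -scaleNr; apply: KZ; first by rewrite oppr_gt0.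
exact: KA.
Qed.

(** The two products lift the same element, so they differ by a positive factor, whose power of
    exponent [n.+1] is 1 by taking determinants. *)
Lemma lifts_commute g h A B : lifts K g A -> lifts K h B -> (g * h = h * g)%g ->
  A * B = B * A.
Proof.
move=> gA hB gh; have AB := liftsM gA hB; have := liftsM hB gA; rewrite -gh => BA.
have [c c0 E] := lifts_unique AB BA.
have [uA _ _ _] := gA; have [uB _ _ _] := hB.
have : \det (B *m A) = c ^+ n.+1 * \det (A *m B) by rewrite E detZ.
rewrite !det_mulmx [\det B * _]mulrC -[LHS]mul1r => /mulIf.
have d0 : \det A * \det B != 0 by rewrite mulf_neq0// -unitfE -unitmxE.
move=> /(_ d0)/esym/eqP; rewrite pexpr_eq1 ?(ltW c0)// => /eqP c1.
by rewrite -!mulmxE E c1 scale1r.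
Qed.

Context (Gamma : set G) (gG : is_subgroup Gamma) (dG : discrete_subset Gamma)
  (GOm : forall g, Gamma g -> pact g @` Om = Om)
  (fG : forall g p, Gamma g -> Om p -> pact g p = p -> g = 1%g).

(* The sum of a finite orbit of the cone is a fixed point. *)
Lemma lift_group_torsion_free g m : Gamma g -> (0 < m)%N -> (g ^+ m = 1)%g -> g = 1%g.
Proof.
have [_ [v Kv] KD KZ _] := hK.
move=> Gg m0 gm1; have [A gA] := lift_exists hK (GOm Gg).
have := liftsX m gA; rewrite gm1 => gAm.
have [c c0 AmE] := lifts_unique lifts1 gAm.
have [r r0 rm] := exists_root c0 m0.
pose B := r^-1 *: A; have gB : lifts K g B by apply: (liftsZ hK) => //; rewrite invr_gt0.
have Bm : B ^+ m = 1.
  by rewrite /B exprZn AmE exprVn rm scalerA mulVf ?scale1r// gt_eqF.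
have KBk k : K (B ^+ k *m v) by have [_ _ h _] := liftsX k gB; exact: h.
pose y := \sum_(i < m) B ^+ i *m v.
have Ky : K y.
  rewrite /y; case: m m0 {gm1 AmE rm Bm y gAm} => // m _; elim: m => [|m IH].
    by rewrite big_ord_recr big_ord0 /= add0r.
  by rewrite big_ord_recr /=; exact: KD.
have By : B *m y = y.
  rewrite /y mulmx_sumr; under eq_bigr do rewrite mulmxA mulmxE -exprS.
  case: m m0 Bm {gm1 AmE rm y Ky gAm} => // m _ Bm.
  by rewrite big_ord_recr /= Bm addrC big_ord_recl /= expr0.
apply: (fG Gg (lift_pt hK Ky)).
by rewrite (lifts_pact hK gB Ky) By.
Qed.

Lemma lift_powers_unbounded g A A' : Gamma g -> g <> 1%g -> lifts K g A -> A * A' = 1 ->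
  ~ exists c : R, forall k, `|A ^+ k| <= c /\ `|A' ^+ k| <= c.
Proof.
have [G1 GM GV] := gG.
move=> Gg g1 gA AA' [c hc].
have Gk k : Gamma (g ^+ k)%g.
  by elim: k => [|k IH]; [exact: G1|rewrite expgS; exact: GM].
have /finite_seqP[s sE] := discrete_finite gG dG c.
have [i [j [ij E]]] : exists i j, (i < j)%N /\ (g ^+ i = g ^+ j)%g.
  apply: (@seq_collision _ _ s) => k.
  have : [set` s] (g ^+ k)%g; last by [].
  rewrite -sE; split=> //; have [uA gE _ _] := liftsX k gA.
  exists (A ^+ k); split=> //; first by have [] := hc k.
  have -> : invmx (A ^+ k) = A' ^+ k; last by have [] := hc k.
  have AkA' : A ^+ k *m A' ^+ k = 1%:M.
    have cAA' : GRing.comm A A' by rewrite /GRing.comm AA'; apply/esym/mulmx1C.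
    by rewrite mulmxE -exprMn_comm// AA' expr1n.
  by rewrite -[LHS]mulmx1 -AkA' mulKmx.
by apply: g1; apply: (lift_group_torsion_free Gg (m := j - i)); [rewrite subn_gt0|exact: expg_inj_torsion].
Qed.

(** If [b] is the largest factor with [b x' <= x] in the order of the closed cone, then
    [m x >= A x >= b A x' >= b m' x'], whence [b m' / m <= b]. Proportional vectors are treated
    apart, since [lift_exit] requires independence. *)
Lemma growth_le g A x x' (m m' : R) : lifts K g A -> K x -> K x' -> 0 < m -> 0 < m' ->
  ccl K (A *m x' - m' *: x') -> ccl K (m *: x - A *m x) -> m' <= m.
Proof.
have [_ _ _ KZ _] := hK.
move=> gA Kx Kx' m0 m'0 c' c.
have [[a xE]|ind] := pselect (exists a : R, x = a *: x').
  have a0 : 0 < a.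
    rewrite ltNge; apply/negP => a0; have := ccl_pointed hK (ccl_sub Kx).
    rewrite xE -scaleNr => /(_ (cclZ hK _ (ccl_sub Kx'))); rewrite oppr_ge0 => /(_ a0) E.
    by have := lift_neq0 hK Kx; rewrite xE E eqxx.
  rewrite leNgt; apply/negP => mm; have := cclD hK (cclZ hK (ltW a0) c') c.
  rewrite xE -scalemxAr scalerBr !scalerA addrC addrA subrK -scalerBl => h.
  have := liftD_ccl hK (KZ ((m' - m) * a) x' _ Kx') h.
  rewrite -scalerDl [X in X *: _](_ : _ = 0) ?scale0r; last by ring.
  by rewrite mulr_gt0 ?subr_gt0// => /(_ isT) /(liftN0 hK).
have indN (a : R) : - x' <> a *: x.
  move=> E; have [a0|a0] := eqVneq a 0.
    by have := lift_neq0 hK Kx'; rewrite -oppr_eq0 E a0 scale0r eqxx.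
  by apply: ind; exists (- a^-1); rewrite scaleNr -scalerN E scalerA mulVf ?scale1r.
have nx' : ~ ccl K (- x').
  by move=> h; have := liftD_ccl hK Kx' h; rewrite subrr; exact: (liftN0 hK).
have [b b0 [bE _ cb]] := lift_exit hK Kx indN nx'.
rewrite leNgt; apply/negP => mm.
pose s := m' * b / m; have bs : b < s by rewrite ltr_pdivlMr// mulrC ltr_pM2r.
have s0 : 0 < s by exact: lt_trans bs.
have cs : ccl K (x + s *: (- x')).
  have -> : x + s *: (- x') = m^-1 *: ((m *: x - A *m x) + (A *m (x + b *: (- x')) + b *: (A *m x' - m' *: x'))).
    rewrite mulmxDr -scalemxAr mulmxN /s; move: (A *m x) (A *m x') => y y'.
    by apply/matrixP => i j; rewrite !mxE; field; rewrite gt_eqF.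
  apply: (cclZ hK); first by rewrite invr_ge0 ltW.
  apply: (cclD hK) => //; apply: (cclD hK); first exact: (lifts_ccl gA).
  by apply: (cclZ hK) => //; exact: ltW.
have : K (x + b *: (- x')).
  have -> : x + b *: (- x') = (1 - b / s) *: x + (b / s) *: (x + s *: (- x')).
    by apply/matrixP => i j; rewrite !mxE; field; rewrite gt_eqF.
  apply: (liftD_ccl hK); first by apply: KZ => //; rewrite subr_gt0 ltr_pdivrMr// mul1r.
  by apply: (cclZ hK) => //; rewrite divr_ge0// ltW.
by move=> /(bE _ (ltW b0)); rewrite ltxx.
Qed.

(** A point moved by little satisfies [m x <= A x <= (1 + d) m x] for some factor [m]. By
    [growth_le] every such factor is at most [1 + d] times any other one, so their supremum [a]
    serves for all [d]. *)
Lemma displacement_scaling g A : lifts K g A ->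
  (forall d : R, 0 < d -> exists2 x, Om x & close K d x (pact g x)) ->
  exists2 a : R, 0 < a & forall d : R, 0 < d -> exists2 x, K x &
    ccl K (A *m x - (a / (1 + d)) *: x) /\ ccl K ((a * (1 + d)) *: x - A *m x).
Proof.
have [_ _ _ KZ _] := hK.
move=> gA hd; have [_ _ KA _] := gA.
pose Q d m x := [/\ K x, 0 < m, ccl K (A *m x - m *: x) & ccl K (((1 + d) * m) *: x - A *m x)].
have hQ d : 0 < d -> exists m x, Q d m x.
  move=> d0; have [p Op [u [v [Ku Kv pE qE [c1 c2]]]]] := hd d d0.
  have [c c0 vE] : exists2 c : R, 0 < c & v = c *: (A *m u).
    apply: (lift_pt_eq hK) => //; first exact: KA.
    by rewrite -qE pE; apply/esym/(lifts_pact hK gA).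
  exists c^-1, u; split=> //; first by rewrite invr_gt0.
    have -> : A *m u - c^-1 *: u = c^-1 *: (v - u).
      by rewrite vE scalerBr scalerA mulVf ?scale1r// gt_eqF.
    by apply: (cclZ hK) => //; rewrite invr_ge0 ltW.
  have -> : ((1 + d) * c^-1) *: u - A *m u = c^-1 *: ((1 + d) *: u - v).
    by rewrite vE scalerBr !scalerA mulVf ?scale1r ?gt_eqF// [_ * c^-1]mulrC.
  by apply: (cclZ hK) => //; rewrite invr_ge0 ltW.
have QQ d d' m m' x x' : 0 < d -> Q d m x -> Q d' m' x' -> m' <= (1 + d) * m.
  move=> d0 [Kx m0 _ c] [Kx' m'0 c' _].
  by apply: (growth_le gA Kx Kx') => //; rewrite mulr_gt0// addr_gt0.
pose E := [set m : R | exists d x, 0 < d /\ Q d m x].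
have [m1 [x1 Q1]] := hQ 1 ltr01.
have hE : has_sup E.
  split; first by exists m1, 1, x1.
  by exists ((1 + 1) * m1) => m [d [x [d0 Qm]]]; apply: (QQ 1 d m1 m x1 x).
pose a := sup E.
have aE d m x : 0 < d -> Q d m x -> m <= a <= (1 + d) * m.
  move=> d0 Qm; apply/andP; split; first by apply: sup_upper_bound => //; exists d, x.
  apply: ge_sup; first by have [] := hE.
  by move=> m' [d' [x' [d'0 Qm']]]; exact: (QQ d d' m m' x x').
have a0 : 0 < a.
  by have /andP[h _] := aE _ _ _ ltr01 Q1; case: Q1 => _ h' _ _; exact: lt_le_trans h.
exists a => // d d0; have [m [x Qm]] := hQ d d0; have /andP[ma am] := aE _ _ _ d0 Qm.
have [Kx m0 c1 c2] := Qm; have d1 : 0 < 1 + d by rewrite addr_gt0.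
exists x => //; split.
  have -> : A *m x - (a / (1 + d)) *: x = (A *m x - m *: x) + (m - a / (1 + d)) *: x.
    by rewrite scalerBl addrA subrK.
  apply: (cclD hK) => //; apply: (cclZ hK); last exact: ccl_sub.
  by rewrite subr_ge0 ler_pdivrMr// mulrC.
have -> : (a * (1 + d)) *: x - A *m x = (((1 + d) * m) *: x - A *m x) + ((a - m) * (1 + d)) *: x.
  by move: (A *m x) => y; apply/matrixP => i j; rewrite !mxE; ring.
apply: (cclD hK) => //; apply: (cclZ hK); last exact: ccl_sub.
by rewrite mulr_ge0 ?subr_ge0// ltW.
Qed.

(** From [A x <= q x] follows [A ^+ k x <= q ^+ k x], and [x] controls the norm of a preserving
    matrix. [q] is an [N]-th root of [r] because powers of [A ^+ N] are estimated. *)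
Lemma subexponential_powers g A : lifts K g A ->
  (forall d : R, 0 < d -> exists2 x, K x & ccl K ((1 + d) *: x - A *m x)) ->
  forall N r, 1 < r :> R -> (0 < N)%N -> exists c : R, forall k, `|(A ^+ N) ^+ k| <= c * r ^+ k.
Proof.
move=> gA h N r r1 N0; have r0 : 0 < r by exact: lt_trans r1.
have [q q0 qN] := exists_root r0 N0.
have q1 : 1 < q.
  rewrite ltNge; apply/negP => q1; have := exprn_ile1 N (ltW q0) q1.
  by rewrite qN leNgt r1.
have d0 : 0 < q - 1 by rewrite subr_gt0.
have [x Kx] := h _ d0; rewrite [1 + _]addrC subrK => cx.
have pow k : ccl K (q ^+ k *: x - A ^+ k *m x).
  elim: k => [|k IH]; first by rewrite !expr0 scale1r mul1mx subrr; exact: (ccl0 hK).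
  have -> : q ^+ k.+1 *: x - A ^+ k.+1 *m x
      = q ^+ k *: (q *: x - A *m x) + A *m (q ^+ k *: x - A ^+ k *m x).
    rewrite mulmxBr scalerBr scalerA -exprSr [A ^+ _]exprS -mulmxE -scalemxAr mulmxA.
    by rewrite addrA subrK.
  apply: (cclD hK); last exact: (lifts_ccl gA).
  by apply: (cclZ hK) => //; rewrite exprn_ge0// ltW.
have [C C0 hC] := preserving_norm_bound hK Kx.
exists (C * `|x|) => k; rewrite -exprM.
have : `|A ^+ (N * k)| <= C * `|q ^+ (N * k) *: x|.
  by apply: hC => // v; apply: (lifts_ccl (liftsX (N * k) gA)).
rewrite normrZ ger0_norm ?exprn_ge0 ?(ltW q0)// [q ^+ _]exprM qN.
by rewrite [r ^+ k * _]mulrC mulrA.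
Qed.

End GroupLifts.

Lemma PGL_trivial (R : realType) n (g : PGL R n.+1) : n = 0%N -> g = 1%g.
Proof.
move=> n0; move: g; rewrite n0 => g.
have uA := mat_of_unit g; rewrite -(mat_ofK g); have -> : (1%g : PGL R 1) = pgl 1%:M by [].
apply/pgl_eq; rewrite ?unitmx1//; move: (mat_of g) uA => A uA.
have AE : A = (A 0 0)%:M by exact: mx11_scalar.
have a0 : A 0 0 != 0.
  by apply: contraTneq uA => a0; rewrite AE a0 raddf0 unitmxE det0 unitr0.
by exists (A 0 0)^-1; rewrite ?invr_eq0// {2}AE scale_scalar_mx mulVf.
Qed.

(** * Cusp elements of zero displacement are parabolic *)

Section CuspParabolic.
Context {R : realType} {n : nat}.
Local Notation V := 'cV[R]_n.+1.
Local Notation M := 'M[R]_n.+1.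
Local Notation G := (PGL R n.+1).
Context (Om : set (RP R n)) (K : set V) (hK : is_lift Om K).
Context (Gamma : set G) (gG : is_subgroup Gamma) (dG : discrete_subset Gamma)
  (GOm : forall g, Gamma g -> pact g @` Om = Om)
  (fG : forall g p, Gamma g -> Om p -> pact g p = p -> g = 1%g).
Context (X : set (RP R n)) (XO : X `<=` Om) (pX : properly_convex X) (X0 : X !=set0)
  (GX : forall g, Gamma g -> pact g @` X = X)
  (nS : contains_no_segment (bdry X))
  (cS : compact (quotient_set (bdry X) Gamma)) (dX : diffeo_to_collar X Gamma).
Local Notation S := (cusp_bdry K X).
Local Notation C := (cusp_hull K X).

Let lcX p : X p -> exists2 U, nbhs p U & forall q, U q -> closure X q -> X q.
Proof. exact: (cusp_locally_closed hK gG dG GOm XO GX cS dX). Qed.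

Lemma cusp_bdry_lift p : bdry X p -> exists2 s, S s & pt s = p.
Proof.
move=> Xp; have [s Ks pE] := lift_rep hK (XO Xp.1).
by exists s => //; split=> //; rewrite -pE.
Qed.

Lemma lift_not_fixed g A s (c : R) : Gamma g -> g <> 1%g -> lifts K g A -> K s -> A *m s <> c *: s.
Proof.
move=> Gg g1 gA Ks E; apply: g1; apply: (fG Gg (lift_pt hK Ks)).
have [_ _ KA _] := gA.
rewrite (lifts_pact hK gA Ks) E pt_scale ?(lift_neq0 hK Ks)//.
by apply/eqP => c0; have := lift_neq0 hK (KA _ Ks); rewrite E c0 scale0r eqxx.
Qed.

Lemma cusp_bdry_invariant g A s : Gamma g -> lifts K g A -> S s -> S (A *m s).
Proof.
move=> Gg gA [Ks Xs]; have [_ _ KA _] := gA; split; first exact: KA.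
by rewrite -(lifts_pact hK gA Ks); exact: (bdry_invariant GX).
Qed.

(** The vectors which [A] sends into a closed convex cone form a closed convex cone themselves. *)
Lemma cusp_hull_preserves (A : M) : (forall s, S s -> C (A *m s)) -> preserves C A.
Proof.
move=> h v Cv F cF [F0 FD FZ] SF; apply: (Cv [set u | F (A *m u)]).
- apply: (@closed_comp _ _ (mulmx A)) => // u _; exact: mulmxl_continuous.
- split; first by rewrite /= mulmx0.
    by move=> u w Fu Fw /=; rewrite mulmxDr; exact: FD.
  by move=> c u c0 Fu /=; rewrite -scalemxAr; exact: FZ.
- by move=> s /h /= ; apply.
Qed.

Context (H : set G) (gH : is_subgroup H) (HG : H `<=` Gamma)
  (HC : forall g h, H g -> H h -> (g * h = h * g)%g) (l : seq G)
  (hl : forall g, Gamma g -> exists k h, [/\ k \in l, H h & g = (k * h)%g]).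
Context (g : G) (Gg : Gamma g) (g1 : g <> 1%g)
  (disp : forall d : R, 0 < d -> exists2 x, Om x & close K d x (pact g x)).

Lemma cusp_bdry_nonempty : exists s, S s.
Proof.
have [p Xp] := collar_bdry_nonempty dX X0.
by have [s Ss _] := cusp_bdry_lift Xp; exists s.
Qed.

Lemma cusp_bdry_transverse s : S s -> exists w, forall eta : R, 0 < eta ->
  ~ ccl (cusp_cone K X) (s + eta *: w) /\ ~ ccl (cusp_cone K X) (s - eta *: w).
Proof.
move=> Ss; have [n2|] := leqP 2 n; first exact: (cusp_transverse hK XO pX nS lcX n2 Ss).
rewrite ltnS leq_eqVlt ltnS leqn0 => /orP[/eqP n1|/eqP n0]; last first.
  by exfalso; apply: g1; exact: PGL_trivial.
exfalso; have [A gA] := lift_exists hK (GOm Gg); have [_ _ KA _] := gA.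
have [Ks _] := Ss; have S1 := cusp_bdry_invariant Gg gA Ss.
have S2 := cusp_bdry_invariant Gg gA S1; have [K1 _] := S1.
apply: (cusp_planar_contra hK XO pX n1 Ss S1 S2) => c.
- exact: (lift_not_fixed Gg g1 gA Ks).
- have [G1 GM _] := gG; rewrite mulmxA; apply: (lift_not_fixed (GM _ _ Gg Gg)) => //.
    by move=> gg; apply: g1; apply: (lift_group_torsion_free hK GOm fG Gg (m := 2)).
  exact: (liftsM gA gA).
- exact: (lift_not_fixed Gg g1 gA K1).
Qed.

Lemma cusp_hull_int s v : S s -> C v -> (forall c : R, v <> c *: s) -> C° (s + v).
Proof.
move=> Ss; have [w hw] := cusp_bdry_transverse Ss.
exact: (cusp_hull_strict hK XO pX nS lcX Ss hw).
Qed.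

Lemma cusp_hull_pointed : pointed_cone C.
Proof.
have D1 : cusp_cone K X !=set0 by have [s Ss] := cusp_bdry_nonempty; exists s; exact: cusp_bdryW.
have CK v : C v -> ccl K v by move=> /(cusp_hull_ccl hK XO pX D1) /cusp_ccl_sub.
by move=> v /CK Cv /CK; exact: (ccl_pointed hK).
Qed.

Definition cusp_matrices : set M := [set A | exists2 h, H h & lifts K h A].
Local Notation HM := cusp_matrices.

Lemma cusp_matrices_preserve A : HM A -> preserves C A.
Proof.
move=> [h Hh hA]; apply: cusp_hull_preserves => s Ss.
by apply: cusp_hull_bdry; exact: (cusp_bdry_invariant (HG Hh)).
Qed.

Lemma cusp_matrices_commute A B : HM A -> HM B -> A * B = B * A.
Proof. by move=> [h Hh hA] [k Hk kB]; apply: (lifts_commute hK hA kB); exact: HC. Qed.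

Section Key.
Context (Z Y : M) (PZ : preserves C Z) (cZ : centralizes HM Z) (ZZ : Z * Z = 0) (Z0 : Z != 0)
  (cY : centralizes HM Y).
Context (N : nat) (N0 : (0 < N)%N) (HgN : H (g ^+ N)%g).

Let good (e : R) (s : V) := C (s + Z *m s + e *: (Y *m s)).

(** [Z s = c s] with [c] nonzero contradicts [Z ^+ 2 = 0]. If [Z s = 0], then [Z], commuting with a
    lift [B] of a power of [g], also kills [B s]; it would vanish at the interior point [s + B s],
    hence everywhere. *)
Lemma cusp_key_interior s : S s -> C° (s + Z *m s).
Proof.
move=> Ss; have [Ks _] := Ss; have Cs := cusp_hull_bdry Ss.
have Zs0 : Z *m s != 0.
  apply/eqP => Zs; have [B gB] := lift_exists hK (GOm (HG HgN)).
  have HB : HM B by exists (g ^+ N)%g.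
  have gN1 : (g ^+ N)%g <> 1%g by move=> E; apply: g1; exact: (lift_group_torsion_free hK GOm fG Gg N0).
  have iB : C° (s + B *m s).
    apply: cusp_hull_int => //; first exact: cusp_matrices_preserve.
    by move=> c; exact: (lift_not_fixed (HG HgN)).
  have : Z = 0.
    apply: (preserves_annih cusp_hull_pointed PZ iB).
    by rewrite mulmxDr Zs add0r mulmxA mulmxE (cZ HB) -mulmxE -mulmxA Zs mulmx0.
  by move/eqP; rewrite (negPf Z0).
apply: cusp_hull_int => //; first exact: PZ.
move=> c E; move/eqP: Zs0; apply.
have : Z *m (Z *m s) = 0 by rewrite mulmxA mulmxE ZZ mul0mx.
rewrite E -scalemxAr E scalerA => /eqP; rewrite scaler_eq0 mulf_eq0 orbb.
by rewrite (negPf (lift_neq0 hK Ks)) orbF => /eqP ->; rewrite scale0r.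
Qed.

Lemma cusp_key_mono (e e' : R) s : S s -> 0 < e -> 0 <= e' <= e -> good e s -> good e' s.
Proof.
move=> Ss e0 /andP[e'0 e'e] ge; rewrite /good.
have Cs : C (s + Z *m s) by apply: interior_subset; exact: cusp_key_interior.
have [_ CD CZ] := @cusp_hull_cone _ _ K X.
have -> : s + Z *m s + e' *: (Y *m s)
    = (1 - e' / e) *: (s + Z *m s) + (e' / e) *: (s + Z *m s + e *: (Y *m s)).
  move: (Z *m s) (Y *m s) => a b.
  by apply/matrixP => i j; rewrite !mxE; field; rewrite gt_eqF.
apply: CD; apply: CZ => //; last by rewrite divr_ge0// ltW.
by rewrite subr_ge0 ler_pdivrMr// mul1r.
Qed.

Lemma cusp_key_local p : bdry X p -> exists2 e : R, 0 < e &
  exists2 W, nbhs p W & forall s, S s -> W (pt s) -> good e s.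
Proof.
have [oK _ _ _ _] := hK.
move=> /cusp_bdry_lift[s0 Ss0 <-]; have [Ks0 _] := Ss0.
have iC := cusp_key_interior Ss0.
have iiC : (C°)° (s0 + Z *m s0).
  by have /interior_id -> := @open_interior _ C.
have [e e0 [Ce _]] := interior_perturb (Y *m s0) iiC.
exists e => //.
pose A : M := 1 + Z + e *: Y.
have AE s : A *m s = s + Z *m s + e *: (Y *m s) by rewrite /A !mulmxDl mul1mx scalemxAl.
have nC : nbhs (A *m s0) C by rewrite AE.
have /nbhs_ballP[r /= r0 hr] : nbhs s0 (mulmx A @^-1` C `&` K).
  by apply: filterI; [exact: (@mulmxl_continuous R n.+1 n.+1 1 A s0 _ nC)|exact: open_nbhs_nbhs].
exists [set pt v | v in ball s0 r `&` [set v | v != 0]].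
  exact: (pt_ball_nbhs (lift_neq0 hK Ks0) r0).
move=> s [Ks _] [v [/hr[Cv Kv] v0] vs].
have [c c0 ->] := lift_pt_eq hK Kv Ks vs.
have [_ _ CZ] := @cusp_hull_cone _ _ K X.
by rewrite /good -AE -scalemxAr; apply: CZ => //; exact: ltW.
Qed.

(* A uniform e exists since bdry X / Gamma is compact and the condition on s is
   invariant under H, of finite index in Gamma. *)
Lemma cusp_key : exists2 e : R, 0 < e & preserves C (1 + Z + e *: Y).
Proof.
have [G1 GM GV] := gG; have [H1 HMul HV] := gH.
pose P A := exists2 e : R, 0 < e & forall s, S s -> A (oproj Gamma (pt s)) -> good e s.
have min_r (a b : R) : 0 < a -> 0 < b -> 0 <= Num.min a b <= a.
  by move=> a0 b0; rewrite le_min (ltW a0) (ltW b0) /= ge_min lexx.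
have min_l (a b : R) : 0 < a -> 0 < b -> 0 <= Num.min a b <= b.
  by move=> a0 b0; rewrite le_min (ltW a0) (ltW b0) /= ge_min lexx orbT.
suff [e e0 he] : P (quotient_set (bdry X) Gamma).
  exists e => //; apply: cusp_hull_preserves => s Ss.
  rewrite !mulmxDl mul1mx -scalemxAl; apply: he => //.
  by exists (pt s) => //; case: Ss.
apply: (compact_ind cS).
- by exists 1.
- move=> A B [e e0 he] [f f0 hf]; exists (Num.min e f); first by rewrite lt_min e0.
  move=> s Ss [As|Bs].
    exact: (cusp_key_mono Ss e0 (min_r _ _ e0 f0) (he _ Ss As)).
  exact: (cusp_key_mono Ss f0 (min_l _ _ e0 f0) (hf _ Ss Bs)).
- by move=> A B AB [e e0 he]; exists e => // s Ss /AB; exact: he.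
move=> _ [p Xp <-].
(* [good] is invariant under [H] only, so each of the finitely many points [k^-1 p], for coset
   representatives [k] in [Gamma], contributes its own bound and neighbourhood. *)
have [e e0 [W nW hW]] : exists2 e : R, 0 < e & exists2 W, nbhs p W &
    forall k s q, k \in l -> Gamma k -> S s -> W q -> pt s = pact k^-1%g q -> good e s.
  elim: (l) => [|k l' [e e0 [W nW hW]]]; first by exists 1 => //; exists setT => //; exact: filterT.
  have [Gk|nGk] := pselect (Gamma k); last first.
    exists e => //; exists W => // k' s q; rewrite inE => /predU1P[->//|k'l]; exact: hW.
  have [f f0 [W' nW' hW']] := cusp_key_local (bdry_invariant GX (GV _ Gk) Xp).
  exists (Num.min e f); first by rewrite lt_min e0.
  exists (W `&` pact k^-1%g @^-1` W').
    by apply: filterI => //; exact: (pact_continuous nW').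
  move=> k' s q; rewrite inE => /orP[/eqP->|k'l] Gk' Ss [Wq W'q] sE.
    apply: (cusp_key_mono Ss f0 (min_l _ _ e0 f0)).
    by apply: hW' => //; rewrite sE.
  exact: (cusp_key_mono Ss e0 (min_r _ _ e0 f0) (hW k' s q k'l Gk' Ss Wq sE)).
exists (oproj Gamma @` W); first exact: (oproj_nbhs gG).
exists e => // s Ss [q Wq /(oprojP gG)[k0 Gk0 sE]].
have [k [h [kl Hh k0E]]] := hl (GV _ Gk0).
have Gk : Gamma k.
  have -> : k = (k0^-1 * h^-1)%g by rewrite k0E -mulgA mulgV mulg1.
  by apply: GM; [exact: GV|exact/GV/HG].
(* [h] moves the class of [s] to [k^-1 q], where the bound is known. The inverse of its lift
   preserves the hull and commutes with [Z] and [Y], which brings the bound back to [s]. *)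
have [A hA] := lift_exists hK (GOm (HG Hh)).
have [uA _ _ _] := hA; have [Ks _] := Ss.
have SA : S (A *m s) := cusp_bdry_invariant (HG Hh) hA Ss.
have AE : pt (A *m s) = pact k^-1%g q.
  by rewrite -(lifts_pact hK hA Ks) -[in RHS](pactK k0 q) -sE k0E pactM pactK.
have HA' : HM (invmx A) by exists h^-1%g; [exact: HV|exact: liftsV].
have := cusp_matrices_preserve HA' (hW k (A *m s) q kl Gk SA Wq AE).
rewrite /good !mulmxDr -scalemxAr mulKmx//.
have com (T : M) : centralizes HM T -> invmx A *m (T *m (A *m s)) = T *m s.
  move=> cT; have E : invmx A *m T = T *m invmx A by exact: (esym (cT _ HA')).
  have -> : invmx A *m (T *m (A *m s)) = (invmx A *m T) *m (A *m s) by exact: mulmxA.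
  by rewrite E -(mulmxA T) mulKmx.
by rewrite !com.
Qed.

End Key.

Theorem cusp_element_parabolic : exists h : G, parabolic (h * g * h^-1)%g.
Proof.
have [G1 GM GV] := gG; have [H1 HMul HV] := gH.
have [N N0 HgN] := finite_index_power gG gH hl Gg.
have gN1 : (g ^+ N)%g <> 1%g by move=> E; apply: g1; exact: (lift_group_torsion_free hK GOm fG Gg N0).
have [A0 gA0] := lift_exists hK (GOm Gg).
have [a a0 ha] := displacement_scaling hK gA0 disp.
have ai0 : 0 < a^-1 by rewrite invr_gt0.
(* After division by the common scale [a], both [A] and its inverse have, for every [d > 0], a
   vector enlarged by at most [1 + d] in the order of the cone. *)
have [A AE] : exists A, A = a^-1 *: A0 by eexists.
have gA : lifts K g A by rewrite AE; exact: (liftsZ hK).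
have gA' := liftsV gA; have [uA gE _ _] := gA.
have A0E : A0 = a *: A by rewrite AE scalerA mulfV ?scale1r// gt_eqF.
have [A' A'E] : exists A', A' = invmx A by eexists.
rewrite -A'E in gA'.
have up (d : R) : 0 < d -> exists2 x, K x & ccl K ((1 + d) *: x - A *m x).
  move=> d0; have [x Kx [_ h]] := ha d d0; exists x => //.
  have := cclZ hK (ltW ai0) h.
  by rewrite A0E scalerBr -scalemxAl !scalerA mulrA mulVf ?gt_eqF// mul1r scale1r.
have dn (d : R) : 0 < d -> exists2 x, K x & ccl K ((1 + d) *: x - A' *m x).
  move=> d0; have [x Kx [h _]] := ha d d0; exists x => //.
  have d1 : 0 < 1 + d by rewrite addr_gt0.
  have := lifts_ccl gA' (cclZ hK (ltW (mulr_gt0 d1 ai0)) h).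
  rewrite A0E -scalemxAl scalerBr !scalerA mulmxBr -!scalemxAr {1}A'E mulKmx//.
  have -> : (1 + d) * a^-1 * a = 1 + d by rewrite mulfVK// gt_eqF.
  have -> : (1 + d) * a^-1 * (a / (1 + d)) = 1 by field; rewrite !gt_eqF.
  by rewrite scale1r.
have BB' : A ^+ N * A' ^+ N = 1.
  have AA' : A * A' = 1 by rewrite A'E -mulmxE mulmxV.
  have cAA' : GRing.comm A A' by rewrite /GRing.comm AA'; apply/esym/mulmx1C.
  by rewrite -exprMn_comm// AA' expr1n.
have gB := liftsX N gA; have gB' := liftsX N gA'.
have HB : cusp_matrices (A ^+ N) by exists (g ^+ N)%g.
have HB' : cusp_matrices (A' ^+ N).
  by exists (g^-1 ^+ N)%g => //; rewrite expVgn; exact: HV.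
have [s Ss] := cusp_bdry_nonempty; have [Ks _] := Ss.
have iy : C° (s + A ^+ N *m s).
  apply: cusp_hull_int => //; first exact: (cusp_matrices_preserve HB (cusp_hull_bdry Ss)).
  by move=> c; exact: (lift_not_fixed (HG HgN) gN1 gB Ks).
have unb := lift_powers_unbounded hK gG dG GOm fG (HG HgN) gN1 gB BB'.
have [P [Q [N' [e [w [u [v [c [[h1 h2 h3 h4] [[h5 h6 h7 h8] [[h9 h10 h11 h12] [h13 h14 h15]]]]]]]]]]]] :=
  @parabolic_structure R n C cusp_matrices _ (A ^+ N) (A' ^+ N)
  (@cusp_hull_closed _ _ K X) (@cusp_hull_cone _ _ K X) cusp_hull_pointed iy
  cusp_matrices_preserve (fun h Hh k Hk => cusp_matrices_commute Hh Hk)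
  (fun Z Y PZ cZ ZZ Z0 cY => cusp_key PZ cZ ZZ Z0 cY N0 HgN) HB HB' BB'
  (fun r r1 => subexponential_powers hK gA up r1 N0)
  (fun r r1 => subexponential_powers hK gA' dn r1 N0) unb.
rewrite gE; exact: (parabolic_conjugate uA N0 erefl BB' h1 h2 h3 h4 h5 h6 h7 h8 h9 h10 h11 h12 h13 h14 h15).
Qed.

End CuspParabolic.

Theorem corollary0p4 (R : realType) (n : nat)
    (Omega : set (RP R n)) (Gamma : set (PGL R n.+1))
    (hM : properly_convex_manifold Omega Gamma) (hopen : open Omega)
    (hends : every_end_is_generalized_cusp Omega Gamma)
    (g : PGL R n.+1) (hg : Gamma g) (hg1 : g <> 1%g)
    (hinf : inf [set hilbert_dist Omega x (pact g x) | x in Omega] = 0) :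
  (exists (Omega' : set (RP R n)) (Gamma' : set (PGL R n.+1)),
     cusp_in Omega Gamma Omega' Gamma' /\ holonomy_pi1 Omega' Gamma' g) /\
  (exists h : PGL R n.+1, parabolic (h * g * h^-1)%g).
Proof.
have [pO Om1 gG dG [GOm fG]] := hM; have [G1 GM GV] := gG.
have [K hK] := convex_lift pO hopen Om1.
have disp := hilbert_inf_close hK (@subset_refl _ Omega) Om1
  (fun x Ox => invariant_pact GOm hg Ox) hinf.
have [Om' [Gamma' [k [u [v [cusp Gk [Ku Kv] vE int]]]]]] :=
  displaced_cusp hK gG dG GOm fG hopen hends hg hg1 disp.
have cusp1 := cusp_in_pact gG GOm (GV _ Gk) cusp.
have [_ Om'O G'G hcusp] := cusp.
have int0 : Om' (pact k (pt u)).
  have /int/interior_subset : 0 <= (0 : R) <= 1 by rewrite lexx ler01.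
  by rewrite subr0 scale1r scale0r addr0.
have int1 : Om' (pact k (pt v)).
  have /int/interior_subset : 0 <= (1 : R) <= 1 by rewrite lexx ler01.
  by rewrite subrr scale0r scale1r add0r.
(* [k g k^-1] maps the translate of [pt u] to that of [pt v], both in the cusp; since the cusp
   embeds, this element belongs to [Gamma']. *)
have G''g : conjset k^-1%g Gamma' g.
  apply/conjsetP; rewrite invgK; apply: (hcusp _ (pact k (pt u))) => //.
    by apply: (GM); [exact: GM|exact: GV].
  by rewrite !pactM pactK -vE.
split.
  exists (pact k^-1%g @` Om'), (conjset k^-1%g Gamma'); split=> //; split=> //.
  (* The segment from a point to its image under [g] stays in the translated cusp; it is the lift of
     a loop with holonomy [g]. *)
  exists (fun t => pt ((1 - t) *: u + t *: v)); split.
  - apply: continuous_in_subspaceT => t /set_mem; rewrite /= in_itv/= => t01.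
    apply: continuous_comp; first exact: segment_continuous.
    by apply: pt_continuous; apply: (lift_neq0 hK); exact: (lift_seg hK).
  - move=> t t01; rewrite pact_image /= invgK; exact: interior_subset (int t t01).
  - by rewrite subrr scale0r scale1r add0r subr0 scale1r scale0r addr0.
have [gc XO G''G _] := cusp1.
have [[pX X0 gG'' dG'' [GX _]] [H [gH HG HC [l hl]]] [cS _] seg dX] := gc.
(* The group of the translated cusp acts on all of [Omega], so the lift [K] and the displacement in
   [Omega] are used with this smaller group. *)
apply: (cusp_element_parabolic hK gG'' dG'' (fun h Gh => GOm h (G''G h Gh))
  (fun h p Gh => fG h p (G''G h Gh)) XO pX X0 GX seg cS dX gH HG HC hl G''g hg1 disp).
Qed.
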